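(* Let $q$ be a prime power, let $\mathcal{A}_n(q)$ be the family of abelian subgroups of $\mathrm{GL}_n(q)$ defined in the context, and let $l(q)=\prod_{k=1}^\infty(1-q^{-k})^{-k(k+1)/2-1}$. If $q>2$, then the sequence $\{q^n|\mathcal{A}_n(q)|/|\mathrm{GL}_n(q)|\}_{n\geq 0}$ is increasing with limit $l(q)$, and for every positive $r<q$, $$\left|q^n\frac{|\mathcal{A}_n(q)|}{|\mathrm{GL}_n(q)|}-l(q)\right|=o(r^{-n/2})\quad\text{as } n\to\infty.$$ If $q=2$, there exists a real sequence $\{b_n\}_{n\geq 0}$ such that $\{2^nb_n\}_{n\geq 0}$ is increasing with limit $l(2)$, $|\mathcal{A}_n(2)|/|\mathrm{GL}_n(2)|\leq b_n$ for all $n$, and for every positive $r<2$, $$\left|2^nb_n-l(2)\right|=o(r^{-n/2})\quad\text{as } n\to\infty.$$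
   Context: $\mathrm{GL}_n(q)$ is the group of invertible $n\times n$ matrices over the field $k$ with $q$ elements, acting on $V=k^n$. For a group $A$ acting $k$-linearly, an $A$-module is indecomposable if it is nonzero and is not the direct sum of two nonzero $A$-submodules. For $n\geq1$, $\mathcal{A}_n(q)$ is the set of abelian subgroups $A$ of $\mathrm{GL}_n(q)$ such that the $A$-module $V$ has a decomposition $V=V_1\oplus\cdots\oplus V_r$ into indecomposable $A$-modules satisfying: (i) $A=A_1\times\cdots\times A_r$, where $A_i\subseteq\mathrm{GL}(V_i)$ (with $A_i$ acting trivially on $V_j$ for $j\neq i$); (ii) for each $i=1,\ldots,r$, $A_i=C_{\mathrm{GL}(V_i)}(a_i)$ for some $a_i\in\mathrm{GL}(V_i)$ such that $V_i$ is an indecomposable $\langle a_i\rangle$-module. By convention the ratio $|\mathcal{A}_n(q)|/|\mathrm{GL}_n(q)|$ is taken to be $1$ for $n=0$. *)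

(* Defs.v *)
From HB Require Import structures.
From mathcomp Require Import all_boot all_order all_algebra all_fingroup.
From mathcomp Require Import all_solvable all_field all_character.
From mathcomp Require Import boolp classical_sets reals topology normedtype.
From mathcomp Require Import landau sequences exp.

Set Implicit Arguments.
Unset Strict Implicit.
Unset Printing Implicit Defensive.

Import Order.TTheory GRing.Theory Num.Theory.
Import numFieldNormedType.Exports.

Local Open Scope ring_scope.

(* Subspaces of row vectors are given by row spaces of matrices, and groups act
   by right multiplication, as everywhere in mxrepresentation. *)
Definition mxindecomposable (K : fieldType) (gT : finGroupType)
    (G : {group gT}) (n : nat) (rG : mx_representation K G n)
    (U : 'M[K]_n) : Prop :=
  [/\ mxmodule rG U, U != 0
    & ~ exists W1 W2 : 'M[K]_n,
          [/\ mxmodule rG W1 /\ W1 != 0, mxmodule rG W2 /\ W2 != 0,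
              mxdirect (W1 + W2) & (W1 + W2 == U)%MS]].

Section AbelianFamily.

(* The degree n = m.+1 is positive: {'GL_0[F]} consists of 1 x 1 matrices in
   MathComp, so degree 0 is dealt with separately in abelian_ratio. *)
Variables (F : finFieldType) (m : nat).
Local Notation n := m.+1.

Definition natural_repr (A : {group {'GL_n[F]}}) : mx_representation F A n :=
  subg_repr (GLrepr F m) (finset.subsetT A).

(* GL(V_i), embedded in GL(V) by letting it act trivially on V_j, j != i. *)
Definition GL_summand (r : nat) (V : 'I_r -> 'M[F]_n) (i : 'I_r) :
    {group {'GL_n[F]}} :=
  (rstabs (GLrepr F m) (V i)
     :&: \bigcap_(j < r | j != i) rstab (GLrepr F m) (V j))%G.

Definition in_abelian_family (A : {group {'GL_n[F]}}) : Prop :=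
  abelian A /\
  exists (r : nat) (V : 'I_r -> 'M[F]_n) (B : 'I_r -> {group {'GL_n[F]}}),
    [/\ mxdirect (\sum_(i < r) V i)%MS /\ (\sum_(i < r) V i == 1%:M)%MS,
        forall i : 'I_r, mxindecomposable (natural_repr A) (V i),
        (\big[dprod/1]_(i < r) B i)%g = A
      & forall i : 'I_r, exists a : {'GL_n[F]},
          [/\ a \in GL_summand V i,
              B i :=: ('C_(GL_summand V i)[a])%g
            & mxindecomposable (natural_repr <[a]>%G) (V i)]].

Definition abelian_family : {set {group {'GL_n[F]}}} :=
  [set A : {group {'GL_n[F]}} | `[< in_abelian_family A >]]%SET.

End AbelianFamily.

Definition abelian_ratio (F : finFieldType) (n : nat) (R : realType) : R :=
  if n is m.+1 then #|abelian_family F m|%:R / #|('GL_n[F])%g|%:R else 1.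

Definition l_const (R : realType) (q : nat) : R :=
  limn (fun N : nat =>
    \prod_(1 <= k < N.+1) (1 - (q%:R : R) ^- k) ^- ((k * k.+1)./2 + 1)).

(* Main.v *)
Require Import Defs.
From HB Require Import structures.
From mathcomp Require Import boolp classical_sets reals topology normedtype.
From mathcomp Require Import landau sequences exp.
From mathcomp Require Import all_boot all_order all_algebra all_fingroup.
From mathcomp Require Import all_solvable all_field all_character.
From mathcomp Require Import zify ring lra.

Set Implicit Arguments.
Unset Strict Implicit.
Unset Printing Implicit Defensive.

Import Order.TTheory GRing.Theory Num.Theory.
Import numFieldNormedType.Exports.

Local Open Scope ring_scope.

(** Let q be the order of F. The groups of the family are the unit groups of some
    commutative algebras of matrices, called block algebras below: an algebra B is
    one if, for each primitive idempotent e of B, the corner e B is the whole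
    centralizer, in the algebra of all e b e, of one invertible element. From a
    decomposition of the space for a group A, with projections e_i and elements
    a_i, one gets the block algebra of the matrices that commute with all the e_i
    and all the a_i, whose unit group is A ([abelian_family_algebra]); here B is
    commutative because each element of a local algebra becomes invertible after
    adding a suitable central element. Conversely the unit group of a block algebra
    is in the family ([algebra_abelian_family]). If q > 2, a block algebra is spanned
    by its units, so that counting groups amounts to counting block algebras
    ([card_abelian_family]); if q = 2, there may be more algebras than groups
    ([card_abelian_family_le]), and their number provides the sequence b_n.

    Let u_n be q ^ n times the number of block algebras of degree n over the order of
    GL_n. The ranks of the primitive idempotents of B add up to n, and a pair (B, e)
    with e of rank k is made of an idempotent of rank k, a local block algebra of
    degree k and a block algebra of degree n - k ([card_block_algebras_rec]). Hence
    n u_n is the sum over k of w_k u_(n-k), where w_k is k q ^ k times the number of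
    local block algebras of degree k over the order of GL_k ([ratio_rec]).

    A local block algebra is the centralizer of a matrix whose minimal polynomial is
    p ^ m and is of degree k, with p irreducible of degree d
    ([local_block_algebra_primary]); it is isomorphic to F[X]/(p ^ m). For a fixed p,
    the matrices with minimal polynomial p ^ m form one conjugacy class, whose
    elements have a centralizer with q ^ k - q ^ (k - d) units
    ([card_primary_class]); and an algebra F[X]/(p' ^ m), with p' irreducible of
    degree d, contains a number of them that Hensel lifting of the roots of p gives
    ([card_gens_mod]). So the number of local algebras is known
    ([card_local_of_degree]), and w_k is the sum over the divisors b of k of

       1 / (1 - y) if b = 1, and b y ^ (b - 1) / (1 - y) ^ 2 if b > 1,

    where y = q ^ (- k / b) ([weighted_localE]). After expanding in powers of y, the
    recursion for u_n says that the series of the u_n z ^ n has the logarithmic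
    derivative of

       1 / (1 - z) times the product over a > 0 and 0 < b < a + 2 of
                             (1 - q ^ -a z ^ b) ^ - c(a, b),

    with c(a, 1) = 1 and c(a, b) = a + 2 - b for b > 1. The increments of u are
    therefore the coefficients of the second product; they are positive
    ([increment_gt0]), and their sum is its value at 1. This value is l(q), since the
    sum over b of the c(a, b) is a (a + 1) / 2 + 1 ([sum_mult], [sequence_cvg]). The
    product converges at each positive rho with rho ^ 2 < q, the least favourable
    factor being a = 1, b = 2; this bounds the sum of the increments weighted by
    rho ^ n, whence an error of the order of rho ^ -n ([sequence_error]).

    The infinite product is used through its finite subproducts only. Their
    coefficients satisfy a similar recursion with smaller weights, so that they are
    bounded by the increments and converge to them ([partial_le], [partial_cvg]). *)

(** * Block algebras and their primitive idempotents *)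

Section Algebras.

Variables (F : finFieldType) (n : nat).
Implicit Types (B : {set 'M[F]_n}) (a b e f g x y z : 'M[F]_n).

(** The commutative unital subalgebras of the algebra of matrices. *)
Definition comm_subalgebra B : bool :=
  [&& 1 \in B,
      [forall c : F, forall x in B, forall y in B, c *: x + y \in B],
      [forall x in B, forall y in B, x * y \in B]
    & [forall x in B, forall y in B, x * y == y * x]].

(** Primitive idempotents of B: the nonzero idempotents e that are minimal, an
    idempotent f being below e when f * e = f. *)
Definition prim_idem B e : bool :=
  [&& e \in B, e * e == e, e != 0
    & [forall f in B, (f * f == f) && (f * e == f) ==> (f == 0) || (f == e)]].

(** The corner of B at e contains the whole centralizer, in the algebra of the
    matrices b with b e = e b = b, of some invertible element of B. When B is
    commutative this corner is equal to that centralizer. *)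
Definition monogenic_at B e : bool :=
  [exists a in B, (a \in unitmx) &&
     [forall b : 'M[F]_n, [&& b * e == b, e * b == b & a * b == b * a] ==> (b \in B)]].

(** The algebras whose unit groups are the groups of the abelian family. *)
Definition block_algebra B : bool :=
  comm_subalgebra B && [forall e : 'M[F]_n, prim_idem B e ==> monogenic_at B e].

Definition local_block_algebra B : bool := block_algebra B && prim_idem B 1.

Lemma comm_subalgebraP B :
  reflect [/\ 1 \in B,
              forall (c : F) x y, x \in B -> y \in B -> c *: x + y \in B,
              forall x y, x \in B -> y \in B -> x * y \in B
            & forall x y, x \in B -> y \in B -> x * y = y * x]
          (comm_subalgebra B).
Proof.
apply: (iffP and4P) => -[B1 BL BM BC]; split=> //.
- by move=> c x y Bx By; move/forallP/(_ c)/forall_inP/(_ x Bx)/forall_inP: BL; apply.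
- by move=> x y Bx By; move/forall_inP/(_ x Bx)/forall_inP: BM; apply.
- by move=> x y Bx By; apply/eqP; move/forall_inP/(_ x Bx)/forall_inP: BC; apply.
- by apply/forallP=> c; apply/forall_inP=> x Bx; apply/forall_inP=> y; apply: BL.
- by apply/forall_inP=> x Bx; apply/forall_inP=> y; apply: BM.
by apply/forall_inP=> x Bx; apply/forall_inP=> y By; apply/eqP/BC.
Qed.

Lemma prim_idemP B e :
  reflect [/\ e \in B, e * e = e, e != 0
            & forall f, f \in B -> f * f = f -> f * e = f -> f = 0 \/ f = e]
          (prim_idem B e).
Proof.
apply: (iffP and4P) => -[Be ee e0 em]; split=> //; try exact/eqP.
  move=> f Bf ff fe; move/forall_inP/(_ f Bf): em.
  by rewrite ff fe !eqxx => /orP[]/eqP; [left|right].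
apply/forall_inP=> f Bf; apply/implyP=> /andP[/eqP ff /eqP fe].
by case: (em f Bf ff fe) => ->; rewrite eqxx ?orbT.
Qed.

Lemma monogenic_atP B e :
  reflect (exists a, [/\ a \in B, a \in unitmx
             & forall b, b * e = b -> e * b = b -> a * b = b * a -> b \in B])
          (monogenic_at B e).
Proof.
apply: (iffP exists_inP) => [[a Ba /andP[ua am]]|[a [Ba ua am]]]; exists a => //.
  split=> // b be eb ab; move/forallP/(_ b): am.
  by rewrite be eb ab !eqxx; apply.
by rewrite ua; apply/forallP=> b; apply/implyP=> /and3P[/eqP ? /eqP ? /eqP ?]; apply: am.
Qed.

Section Subalgebra.

Variable B : {set 'M[F]_n}.
Hypothesis sB : comm_subalgebra B.

Lemma subalg1 : 1 \in B. Proof. by case/comm_subalgebraP: sB. Qed.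
Lemma subalgM x y : x \in B -> y \in B -> x * y \in B.
Proof. by case/comm_subalgebraP: sB => _ _ + _; apply. Qed.
Lemma subalgC x y : x \in B -> y \in B -> x * y = y * x.
Proof. by case/comm_subalgebraP: sB => _ _ _; apply. Qed.
Lemma subalgL c x y : x \in B -> y \in B -> c *: x + y \in B.
Proof. by case/comm_subalgebraP: sB => _ + _ _; apply. Qed.
Lemma subalg0 : 0 \in B.
Proof. by have := subalgL (-1) subalg1 subalg1; rewrite scaleN1r addNr. Qed.
Lemma subalgZ c x : x \in B -> c *: x \in B.
Proof. by move=> Bx; have := subalgL c Bx subalg0; rewrite addr0. Qed.
Lemma subalgD x y : x \in B -> y \in B -> x + y \in B.
Proof. by move=> Bx By; have := subalgL 1 Bx By; rewrite scale1r. Qed.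
Lemma subalgN x : x \in B -> - x \in B.
Proof. by move=> Bx; rewrite -scaleN1r subalgZ. Qed.
Lemma subalgB x y : x \in B -> y \in B -> x - y \in B.
Proof. by move=> Bx By; rewrite subalgD ?subalgN. Qed.
Lemma subalg_sum (I : finType) (P : pred I) (f : I -> 'M[F]_n) :
  (forall i, P i -> f i \in B) -> \sum_(i | P i) f i \in B.
Proof. by move=> Bf; elim/big_ind: _ => //; [exact: subalg0 | exact: subalgD]. Qed.
Lemma subalgX x m : x \in B -> x ^+ m \in B.
Proof. by move=> Bx; elim: m => [|m IH]; rewrite ?expr0 ?subalg1 // exprS subalgM. Qed.

Lemma prim_idem_ortho e f : prim_idem B e -> prim_idem B f -> e != f -> e * f = 0.
Proof.
case/prim_idemP=> Be ee e0 em /prim_idemP[Bf ff f0 fm] nef.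
have ef := subalgC Be Bf.
have efef : e * f * (e * f) = e * f by rewrite mulrA -(mulrA e) -ef !mulrA ee -mulrA ff.
case: (em (e * f)) => //; [exact: subalgM | by rewrite ef -mulrA ee |].
case: (fm (e * f)) => //; [exact: subalgM | by rewrite -mulrA ff |].
by move=> -> fe; rewrite fe eqxx in nef.
Qed.

(** An idempotent that is of minimal rank among those below t is primitive. *)
Lemma prim_idem_below t : t \in B -> t * t = t -> t != 0 ->
  exists2 e, prim_idem B e & e * t = e.
Proof.
move=> Bt tt t0; pose P f := [&& f \in B, f * f == f, f * t == f & f != 0].
have Pt : P t by rewrite /P Bt tt t0 !eqxx.
case: (arg_minnP (fun f => \rank f) Pt) => e /and4P[Be /eqP ee /eqP et e0] emin.
exists e => //; apply/prim_idemP; split=> // f Bf ff fe.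
have [->|f0] := eqVneq f 0; [by left | right].
have := emin f; rewrite /P Bf ff f0 -fe -mulrA et fe eqxx => /(_ isT) ref.
have sfe : (f <= e)%MS by rewrite -fe submxMl.
have /eqmxP/andP[_ /submxP[u eu]] : (f :=: e)%MS.
  by apply/eqmxP; rewrite -(geq_leqif (mxrank_leqif_eq sfe)).
by rewrite -fe subalgC // eu mulmxE -mulrA ff.
Qed.

Lemma prim_idem_sum : \sum_(e | prim_idem B e) e = 1.
Proof.
set s := \sum_(e | _) e.
have Bp e : prim_idem B e -> e \in B by case/prim_idemP.
have Bs : s \in B by apply: subalg_sum.
have se e : prim_idem B e -> s * e = e.
  move=> pe; rewrite mulr_suml (bigD1 e) //= big1 ?addr0.
    by case/prim_idemP: pe.
  by move=> f /andP[pf nef]; apply: prim_idem_ortho.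
have ss : s * s = s by rewrite {2}/s mulr_sumr; apply: eq_bigr.
apply/eqP; rewrite eq_sym -subr_eq0; apply: contraT => t0.
case: (@prim_idem_below (1 - s)) => //.
- by rewrite subalgB ?subalg1.
- by rewrite mulrBl mul1r mulrBr mulr1 ss subrr subr0.
move=> e pe; rewrite mulrBr mulr1 (subalgC (Bp e pe) Bs) se // subrr.
by move=> e0; case/prim_idemP: pe; rewrite -e0 eqxx.
Qed.

End Subalgebra.

Lemma mxrank_idemD e f : e * e = e -> f * f = f -> e * f = 0 -> f * e = 0 ->
  \rank (e + f)%R = (\rank e + \rank f)%N.
Proof.
move=> ee ff ef fe; rewrite -mxrank_disjoint_sum.
  apply: eqmx_rank; rewrite addmx_sub_adds ?submx_refl //=.
  rewrite addsmx_sub; apply/andP; split.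
    by rewrite -{1}ee -[e * e]addr0 -ef -mulrDr -mulmxE submxMl.
  by rewrite -{1}ff -[f * f]add0r -fe -mulrDr -mulmxE submxMl.
apply/eqP; rewrite -submx0; apply/rV_subP=> v.
rewrite sub_capmx => /andP[/submxP[x vx] /submxP[y vy]].
have -> : v = v *m f by rewrite vy -mulmxA [f *m f]ff.
by rewrite vx -mulmxA [e *m f]ef mulmx0 sub0mx.
Qed.

Lemma mxrank_idemC e : e * e = e -> \rank (1 - e) = (n - \rank e)%N.
Proof.
move=> ee; have := @mxrank_idemD e (1 - e) ee.
have -> : e + (1 - e) = 1%:M by rewrite addrC subrK.
rewrite mxrank1 !mulrBr !mulrBl !mulr1 !mul1r ee !subrr subr0.
by move=> /(_ erefl erefl erefl) rk; rewrite -[LHS](addKn (\rank e)) -rk.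
Qed.

Lemma mxrank_prim_idem B : comm_subalgebra B ->
  (\sum_(e | prim_idem B e) \rank e = n)%N.
Proof.
move=> sB; rewrite -[RHS](@mxrank1 F n) -[1%:M]/(1 : 'M[F]_n) -(prim_idem_sum sB).
have := index_enum_uniq ('M[F]_n).
suff H s : uniq s -> let t := \sum_(e <- s | prim_idem B e) e in
   [/\ \sum_(e <- s | prim_idem B e) \rank e = \rank t, t * t = t,
    forall f, prim_idem B f -> f \notin s -> f * t = 0 &
    forall f, prim_idem B f -> f \notin s -> t * f = 0].
  by case/H.
elim: s => [|e s IH] /=.
  by rewrite !big_nil mxrank0 mulr0; split=> // f; rewrite (mulr0, mul0r).
case/andP=> nes /IH[rt tt ft tf]; rewrite !big_cons.
case: ifP => pe; last first.
  by split=> // f pf; rewrite inE negb_or => /andP[_]; [exact: ft|exact: tf].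
case/prim_idemP: (pe) => Be ee _ _.
split.
- by rewrite rt mxrank_idemD // ?ft ?tf.
- by rewrite mulrDl !mulrDr ee tt ft ?tf // addr0 add0r.
- move=> f pf; rewrite inE negb_or => /andP[nfe nfs].
  by rewrite mulrDr ft // (prim_idem_ortho sB) // addr0.
move=> f pf; rewrite inE negb_or => /andP[nfe nfs].
by rewrite mulrDl tf // (prim_idem_ortho sB) 1?eq_sym // addr0.
Qed.

End Algebras.

(** * Corners at an idempotent *)

Section Corner.

Variables (F : finFieldType) (n k : nat) (A : 'M[F]_(k, n)) (C : 'M[F]_(n, k)).
Hypothesis AC : A *m C = 1%:M.

(** Since A C = 1, this embeds 'M_k onto the algebra of the matrices e b e, where
    e = C A is idempotent; the unit of 'M_k is sent to e. *)
Definition corner (x : 'M[F]_k) : 'M[F]_n := C *m x *m A.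

Lemma cornerL c x y : corner (c *: x + y) = c *: corner x + corner y.
Proof. by rewrite /corner mulmxDr mulmxDl -scalemxAr -scalemxAl. Qed.

Lemma corner0 : corner 0 = 0. Proof. by rewrite /corner mulmx0 mul0mx. Qed.

Lemma corner1 : corner 1 = C *m A. Proof. by rewrite /corner mulmx1. Qed.

Lemma cornerM x y : corner x * corner y = corner (x * y).
Proof.
rewrite /corner -!mulmxE !mulmxA; congr (_ *m _); rewrite -!mulmxA; congr (_ *m _).
by congr (_ *m _); rewrite mulmxA AC mul1mx.
Qed.

Lemma corner_inj : injective corner.
Proof.
suff H x : A *m corner x *m C = x by move=> x y xy; rewrite -(H x) xy H.
by rewrite /corner !mulmxA AC mul1mx -mulmxA AC mulmx1.
Qed.

Lemma corner_sur z : z * corner 1 = z -> corner 1 * z = z -> exists x, z = corner x.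
Proof.
rewrite corner1 => z1 z2; exists (A *m z *m C).
by rewrite /corner !mulmxA -[C *m A *m z]/(C *m A * z) z2 -mulmxA -[z *m _]/(z * (C *m A)) z1.
Qed.

Lemma cornerl1 x : corner 1 * corner x = corner x. Proof. by rewrite cornerM mul1r. Qed.
Lemma cornerr1 x : corner x * corner 1 = corner x. Proof. by rewrite cornerM mulr1. Qed.

Lemma corner_unit x : x \in unitmx -> corner x + (1 - corner 1) \in unitmx.
Proof.
move=> ux; apply: (proj1 (@mulmx1_unit _ _ _ (corner (invmx x) + (1 - corner 1)) _)).
have EE : (1 - corner 1) * (1 - corner 1) = 1 - corner 1.
  by rewrite mulrBr mulr1 mulrBl mul1r cornerM mulr1 subrr subr0.
rewrite mulmxE mulrDl !(mulrDr _ (corner (invmx x))) EE [corner x * (1 - _)]mulrBr.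
rewrite [(1 - _) * corner (invmx x)]mulrBl.
rewrite cornerl1 cornerr1 mulr1 mul1r !subrr add0r addr0 cornerM -[x * _]/(x *m _).
by rewrite mulmxV // addrC subrK.
Qed.

Lemma unit_corner a : a \in unitmx -> a * corner 1 = corner 1 * a ->
  exists2 x, x \in unitmx & a * corner 1 = corner x.
Proof.
move=> ua ac.
have ac' : invmx a * corner 1 = corner 1 * invmx a.
  apply: (can_inj (mulKmx ua)); rewrite !mulmxE mulrA -mulmxE mulmxV // mul1mx.
  by rewrite !mulmxE mulrA ac -mulrA -[a * _]/(a *m _) mulmxV // mulr1.
have c1 := cornerl1 1.
have [x ax] : exists x, a * corner 1 = corner x.
  by apply: corner_sur; rewrite -?mulrA ?c1 // mulrA -ac -mulrA c1.
have [y ay] : exists y, invmx a * corner 1 = corner y.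
  by apply: corner_sur; rewrite -?mulrA ?c1 // mulrA -ac' -mulrA c1.
exists x => //; apply: (proj1 (@mulmx1_unit _ _ _ y _)).
apply: corner_inj; rewrite mulmxE -cornerM -ax -ay ac' mulrA -(mulrA a) c1 -mulrA -ac'.
by rewrite mulrA -[a * _]/(a *m _) mulmxV // mul1r.
Qed.

(** The algebra on the image of the idempotent C A, of rank k, that a subalgebra B
    containing it induces. *)
Definition corner_alg (B : {set 'M[F]_n}) := [set x | corner x \in B].

Variable B : {set 'M[F]_n}.
Hypotheses (sB : comm_subalgebra B) (B1 : corner 1 \in B).

Lemma corner_alg_subalgebra : comm_subalgebra (corner_alg B).
Proof.
apply/comm_subalgebraP; rewrite /corner_alg inE; split=> // [c x y|x y|x y]; rewrite !inE => Bx By.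
- by rewrite cornerL subalgL.
- by rewrite -cornerM subalgM.
by apply: corner_inj; rewrite -!cornerM (subalgC sB).
Qed.

Lemma corner_prim f : prim_idem (corner_alg B) f = prim_idem B (corner f).
Proof.
apply/prim_idemP/prim_idemP; rewrite inE => -[Bf ff f0 fm]; split=> //.
- by rewrite cornerM ff.
- by apply: contraNneq f0 => f0; apply/eqP/corner_inj; rewrite corner0.
- move=> g Bg gg gf.
  have [x gx] : exists x, g = corner x.
    have g1 : g * corner 1 = g by rewrite -[in LHS]gf -mulrA cornerr1.
    by apply: corner_sur => //; rewrite (subalgC sB B1 Bg).
  have xx : x * x = x by apply: corner_inj; rewrite -cornerM -gx.
  have xf : x * f = x by apply: corner_inj; rewrite -cornerM -gx.
  have Bx : x \in corner_alg B by rewrite inE -gx.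
  by rewrite gx; case: (fm x Bx xx xf) => ->; [left; rewrite corner0 | right].
- by apply: corner_inj; rewrite -cornerM.
- by apply: contraNneq f0 => ->; rewrite corner0.
move=> g; rewrite inE => Bg gg gf.
case: (fm (corner g) Bg); rewrite ?cornerM ?gg ?gf // => /eqP.
  by rewrite -corner0 => /eqP/corner_inj ->; left.
by move/eqP/corner_inj ->; right.
Qed.

Lemma corner_monogenic f : monogenic_at (corner_alg B) f = monogenic_at B (corner f).
Proof.
apply/monogenic_atP/monogenic_atP => -[a [Ba ua am]].
  exists (corner a + (1 - corner 1)); split.
  - by rewrite inE in Ba; rewrite subalgD ?subalgB ?subalg1.
  - exact: corner_unit.
  move=> b bf fb ab.
  have b1 : b * corner 1 = b by rewrite -bf -mulrA cornerr1.
  have b2 : corner 1 * b = b by rewrite -fb mulrA cornerl1.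
  have [x bx] := corner_sur b1 b2.
  suff : x \in corner_alg B by rewrite inE bx.
  move: bf fb; rewrite bx !cornerM => /corner_inj bf /corner_inj fb.
  apply: am => //; apply: corner_inj.
  move: ab; rewrite mulrDl [b * (_ + _)]mulrDr [(1 - _) * b]mulrBl [b * (1 - _)]mulrBr.
  by rewrite mul1r mulr1 b1 b2 subrr !addr0 bx !cornerM.
have [x ux ax] := unit_corner ua (subalgC sB Ba B1).
exists x; split=> //; first by rewrite inE -ax subalgM.
move=> b bf fb xb; rewrite inE; apply: am; rewrite ?cornerM ?bf ?fb //.
have -> : a * corner b = corner (x * b) by rewrite -cornerM -ax -mulrA cornerl1.
by rewrite xb -cornerM -ax (subalgC sB Ba B1) mulrA cornerr1.
Qed.

End Corner.

(** * Block algebras with a chosen primitive idempotent *)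

Lemma mulVmxr (F : fieldType) n (g : 'M[F]_n) : g \in unitmx -> invmx g * g = 1.
Proof. exact: mulVmx. Qed.

Lemma mulmxVr (F : fieldType) n (g : 'M[F]_n) : g \in unitmx -> g * invmx g = 1.
Proof. exact: mulmxV. Qed.

Section DirectSum.

Variables (F : finFieldType) (n k l : nat).
Variables (A : 'M[F]_(k, n)) (C : 'M[F]_(n, k)) (A' : 'M[F]_(l, n)) (C' : 'M[F]_(n, l)).
Hypotheses (AC : A *m C = 1%:M) (AC' : A' *m C' = 1%:M).
Hypothesis CA : C *m A + C' *m A' = 1%:M.

Local Notation i1 := (corner A C).
Local Notation i2 := (corner A' C').

Lemma corner1D : i1 1 + i2 1 = 1. Proof. by rewrite !corner1 CA. Qed.

Lemma corner_ortho12 : A *m C' = 0.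
Proof.
have := congr1 (mulmx A) CA; rewrite mulmxDr mulmx1 !mulmxA AC mul1mx => /eqP.
rewrite -subr_eq0 addrAC subrr add0r => /eqP/(congr1 (mulmx^~ C')).
by rewrite /= -mulmxA AC' mulmx1 mul0mx.
Qed.

Lemma corner_ortho21 : A' *m C = 0.
Proof.
have := congr1 (mulmx A') CA; rewrite mulmxDr mulmx1 !mulmxA AC' mul1mx => /eqP.
rewrite -subr_eq0 addrK => /eqP/(congr1 (mulmx^~ C)).
by rewrite /= -mulmxA AC mulmx1 mul0mx.
Qed.

Lemma cornerM12 x y : i1 x * i2 y = 0.
Proof. by rewrite /corner -mulmxE !mulmxA -[_ *m A *m C']mulmxA corner_ortho12 mulmx0 !mul0mx. Qed.

Lemma cornerM21 x y : i2 x * i1 y = 0.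
Proof. by rewrite /corner -mulmxE !mulmxA -[_ *m A' *m C]mulmxA corner_ortho21 mulmx0 !mul0mx. Qed.

Lemma cornerDM x y x' y' : (i1 x + i2 y) * (i1 x' + i2 y') = i1 (x * x') + i2 (y * y').
Proof. by rewrite mulrDl !mulrDr cornerM12 cornerM21 addr0 add0r !cornerM. Qed.

Lemma cornerD_inj x y x' y' : i1 x + i2 y = i1 x' + i2 y' -> x = x' /\ y = y'.
Proof.
move=> xy; split.
  have := congr1 (fun z => i1 1 * z) xy.
  by rewrite !mulrDr !cornerM12 !addr0 !cornerM // !mul1r => /corner_inj; apply.
have := congr1 (fun z => i2 1 * z) xy.
by rewrite !mulrDr !cornerM21 !add0r !cornerM // !mul1r => /corner_inj; apply.
Qed.

(** The direct sum of algebras of matrices on the images of two complementary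
    idempotents. *)
Definition dsum_alg (B1 : {set 'M[F]_k}) (B2 : {set 'M[F]_l}) : {set 'M[F]_n} :=
  [set i1 x + i2 y | x in B1, y in B2].

Lemma mem_dsum (B1 : {set 'M[F]_k}) (B2 : {set 'M[F]_l}) x y :
  (i1 x + i2 y \in dsum_alg B1 B2) = (x \in B1) && (y \in B2).
Proof.
apply/imset2P/andP => [[x' y' Bx By /cornerD_inj[-> ->]]|[Bx By]] //.
by exists x y.
Qed.

Lemma dsum_algP (B1 : {set 'M[F]_k}) (B2 : {set 'M[F]_l}) z :
  reflect (exists x y, [/\ x \in B1, y \in B2 & z = i1 x + i2 y]) (z \in dsum_alg B1 B2).
Proof.
apply: (iffP imset2P) => [[x y Bx By ->]|[x [y [Bx By ->]]]]; first by exists x, y.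
by exists x y.
Qed.

Section OfAlgebras.

Variables (B1 : {set 'M[F]_k}) (B2 : {set 'M[F]_l}).
Hypotheses (sB1 : comm_subalgebra B1) (sB2 : comm_subalgebra B2).

Lemma dsum_subalgebra : comm_subalgebra (dsum_alg B1 B2).
Proof.
apply/comm_subalgebraP; split.
- by rewrite -corner1D mem_dsum !subalg1.
- move=> c _ _ /dsum_algP[x [y [Bx By ->]]] /dsum_algP[x' [y' [Bx' By' ->]]].
  by rewrite scalerDr addrACA -!cornerL mem_dsum !subalgL.
- move=> _ _ /dsum_algP[x [y [Bx By ->]]] /dsum_algP[x' [y' [Bx' By' ->]]].
  by rewrite cornerDM mem_dsum !subalgM.
move=> _ _ /dsum_algP[x [y [Bx By ->]]] /dsum_algP[x' [y' [Bx' By' ->]]].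
by rewrite !cornerDM (subalgC sB1 Bx) // (subalgC sB2 By).
Qed.

Lemma dsum_corner1 : corner_alg A C (dsum_alg B1 B2) = B1.
Proof.
by apply/setP=> x; rewrite inE -[i1 x]addr0 -(corner0 A' C') mem_dsum subalg0 ?andbT.
Qed.

Lemma dsum_corner2 : corner_alg A' C' (dsum_alg B1 B2) = B2.
Proof.
by apply/setP=> x; rewrite inE -[i2 x]add0r -(corner0 A C) mem_dsum subalg0.
Qed.

Lemma corner1_dsum : i1 1 \in dsum_alg B1 B2.
Proof. by rewrite -[i1 1]addr0 -(corner0 A' C') mem_dsum subalg0 ?subalg1. Qed.

Lemma corner2_dsum : i2 1 \in dsum_alg B1 B2.
Proof. by rewrite -[i2 1]add0r -(corner0 A C) mem_dsum subalg0 ?subalg1. Qed.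

Lemma prim_dsum f : prim_idem (dsum_alg B1 B2) f ->
  (exists x, f = i1 x) \/ (exists y, f = i2 y).
Proof.
case/prim_idemP=> /dsum_algP[x [y [Bx By ->]]] + _ fm.
rewrite cornerDM => /cornerD_inj[xx yy].
case: (fm (i1 x)).
- by rewrite -[i1 x]addr0 -(corner0 A' C') mem_dsum Bx subalg0.
- by rewrite cornerM // xx.
- by rewrite mulrDr cornerM // cornerM12 addr0 xx.
- by move=> ->; right; exists y; rewrite add0r.
by move=> <-; left; exists x.
Qed.

End OfAlgebras.

Lemma corner_dsum B : comm_subalgebra B -> i1 1 \in B ->
  dsum_alg (corner_alg A C B) (corner_alg A' C' B) = B.
Proof.
move=> sB B1; have B2 : i2 1 \in B.
  by rewrite -[i2 1](addKr (i1 1)) corner1D addrC subalgB ?subalg1.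
apply/setP=> z; apply/dsum_algP/idP=> [[x [y]]|Bz].
  by rewrite !inE => -[Bx By ->]; apply: subalgD.
have zc1 := subalgC sB Bz B1; have zc2 := subalgC sB Bz B2.
have [x zx] : exists x, z * i1 1 = i1 x.
  by apply: corner_sur; rewrite // -?mulrA ?cornerl1 // mulrA -zc1 -mulrA cornerl1.
have [y zy] : exists y, z * i2 1 = i2 y.
  by apply: corner_sur; rewrite // -?mulrA ?cornerl1 // mulrA -zc2 -mulrA cornerl1.
exists x, y; rewrite !inE -zx -zy !subalgM //; split=> //.
by rewrite -mulrDr corner1D mulr1.
Qed.

Lemma block_algebra_dsum B1 B2 :
  block_algebra B1 -> block_algebra B2 -> block_algebra (dsum_alg B1 B2).
Proof.
move=> /andP[sB1 /forallP b1] /andP[sB2 /forallP b2].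
rewrite /block_algebra dsum_subalgebra //; apply/forallP=> f; apply/implyP=> pf.
case: (prim_dsum sB2 pf) => -[x fx]; move: pf; rewrite fx.
  rewrite -corner_prim -?corner_monogenic ?dsum_subalgebra ?corner1_dsum ?dsum_corner1 //.
  by move: (b1 x) => /implyP.
rewrite -corner_prim -?corner_monogenic ?dsum_subalgebra ?corner2_dsum ?dsum_corner2 //.
by move: (b2 x) => /implyP.
Qed.

End DirectSum.

Section Count.

Variable F : finFieldType.

Lemma corner_block_algebra n k (A : 'M[F]_(k, n)) C (B : {set 'M[F]_n}) : A *m C = 1%:M ->
  corner A C 1 \in B -> block_algebra B -> block_algebra (corner_alg A C B).
Proof.
move=> AC Bc /andP[sB /forallP b]; rewrite /block_algebra corner_alg_subalgebra //.
apply/forallP=> f; apply/implyP; rewrite corner_prim // corner_monogenic //.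
exact/implyP.
Qed.

(** A block algebra with a primitive idempotent e = C A is the direct sum of a local
    block algebra on the image of e and a block algebra on that of 1 - e. *)
Lemma card_block_algebra_corner n k l (A : 'M[F]_(k, n)) C (A' : 'M_(l, n)) C' :
    A *m C = 1%:M -> A' *m C' = 1%:M -> C *m A + C' *m A' = 1%:M ->
  #|[set B : {set 'M[F]_n} | block_algebra B & prim_idem B (C *m A)]| =
  (#|[set B : {set 'M[F]_k} | local_block_algebra B]| *
   #|[set B : {set 'M[F]_l} | block_algebra B]|)%N.
Proof.
move=> AC AC' CA; rewrite -cardsX -corner1.
set X := setX _ _.
have sub1 B : block_algebra B -> @comm_subalgebra F _ B by case/andP.
rewrite -(card_in_imset (f := fun p => dsum_alg A C A' C' p.1 p.2) (D := mem X)); last first.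
  move=> [B1 B2] [B1' B2']; rewrite !inE /= => /andP[/andP[/sub1 s1 _] /sub1 s2].
  move=> /andP[/andP[/sub1 s1' _] /sub1 s2'] eB.
  congr pair.
    by rewrite -(dsum_corner1 AC AC' CA B1 s2) eB dsum_corner1.
  by rewrite -(dsum_corner2 AC AC' CA B2 s1) eB dsum_corner2.
apply: eq_card => B; rewrite inE; apply/andP/imsetP.
  move=> [bB pB]; have sB := sub1 _ _ bB; have Bc : corner A C 1 \in B by case/prim_idemP: pB.
  have Bc' : corner A' C' 1 \in B.
    by rewrite -[corner _ _ 1](addKr (corner A C 1)) (corner1D CA) addrC subalgB ?subalg1 // sub1.
  exists (corner_alg A C B, corner_alg A' C' B); last by rewrite /= corner_dsum ?sub1.
  by rewrite !inE /= /local_block_algebra !corner_block_algebra //= (corner_prim AC sB Bc) pB.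
move=> [[B1 B2]]; rewrite !inE /= => /andP[/andP[bB1 pB1] bB2] ->.
rewrite block_algebra_dsum //; split=> //.
have [s1 s2] := (sub1 _ _ bB1, sub1 _ _ bB2).
by rewrite -corner_prim ?dsum_subalgebra ?corner1_dsum // (dsum_corner1 AC AC' CA).
Qed.

(** The order of the general linear group, also in degree 0, where {'GL_n[F]} would
    be made of matrices of degree 1. *)
Definition card_unitmx n := #|[set g : 'M[F]_n | g \in unitmx]|.

(** The centralizer of x in the group of invertible matrices. *)
Definition unit_cent n (x : 'M[F]_n) := [set h : 'M[F]_n | (h \in unitmx) && (h * x == x * h)].

(** The orbit formula for the conjugacy class O of x. *)
Lemma card_conj_class n (x : 'M[F]_n) (O : {set 'M[F]_n}) :
    (forall y, y \in O <-> exists2 g, g \in unitmx & g * y = x * g) ->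
  card_unitmx n = (#|O| * #|unit_cent x|)%N.
Proof.
move=> OP; pose S y := [set g : 'M[F]_n | (g \in unitmx) && (g * y == x * g)].
rewrite /card_unitmx -sum1_card.
rewrite (partition_big (fun g : 'M[F]_n => invmx g * (x * g)) (mem O)) /=; last first.
  move=> g; rewrite inE => ug; apply/OP; exists g => //.
  by rewrite mulrA mulmxVr // mul1r.
rewrite -sum_nat_const; apply: eq_bigr => y Oy.
have [g0 ug0 gy] := iffLR (OP y) Oy.
rewrite sum1dep_card -(card_imset (mem (unit_cent x)) (f := fun h : 'M[F]_n => h * g0)); last first.
  exact: (can_inj (mulmxK ug0)).
apply: eq_card => g; rewrite !inE; apply/andP/imsetP.
  move=> [ug /eqP gx]; exists (g * invmx g0); last by rewrite -!mulrA mulVmxr // mulr1.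
  rewrite inE unitmx_mul ug unitmx_inv ug0 /=.
  have xg : x * g = g * y by rewrite -gx mulrA mulmxVr // mul1r.
  rewrite mulrA xg -!mulrA; apply/eqP; congr (_ * _).
  have -> : x = g0 * y * invmx g0.
    by rewrite gy -mulrA mulmxVr // mulr1.
  by rewrite !mulrA mulVmxr // mul1r.
move=> [h]; rewrite inE => /andP[uh /eqP hx] ->; rewrite unitmx_mul uh; split=> //.
have -> : x * (h * g0) = h * g0 * y by rewrite mulrA -hx -mulrA -gy mulrA.
by rewrite mulrA mulVmxr ?unitmx_mul ?uh // mul1r.
Qed.

Lemma idem_factor n k (e : 'M[F]_n) : e * e = e -> \rank e = k ->
  exists (A : 'M_(k, n)) (C : 'M_(n, k)), C *m A = e /\ A *m C = 1%:M.
Proof.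
move=> ee <-; exists (row_base e), (col_base e); split; first exact: mulmx_base.
move: ee; rewrite -mulmxE -[X in X *m X](mulmx_base e) -[RHS](mulmx_base e).
rewrite mulmxA => /(row_free_inj (row_base_free e)) cc.
have [D DC] := row_fullP (col_base_full e).
move: (col_base e) (row_base e) cc DC => c r cc DC.
by move: (congr1 (mulmx D) cc); rewrite !mulmxA DC !mul1mx.
Qed.

(** The idempotent matrices of rank k; they form one conjugacy class. *)
Definition idem_of_rank n k := [set e : 'M[F]_n | (e * e == e) && (\rank e == k)].

Lemma card_idem n k : (k <= n)%N ->
  (#|idem_of_rank n k| * (card_unitmx k * card_unitmx (n - k))
   = card_unitmx n)%N.
Proof.
move=> kn; pose e : 'M[F]_n := pid_mx k.
have ee : e * e = e by rewrite -mulmxE pid_mx_id.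
have re : \rank e = k by rewrite rank_pid_mx.
have idemC f : f * f = f -> (1 - f) * (1 - f) = 1 - f :> 'M[F]_n.
  by move=> ff; rewrite mulrBr mulr1 mulrBl mul1r ff subrr subr0.
have fac (f : 'M[F]_n) : f * f = f -> \rank f = k ->
    exists (A : 'M_(k, n)) (C : 'M_(n, k)) (A' : 'M_(n - k, n)) (C' : 'M_(n, n - k)),
    [/\ A *m C = 1%:M, A' *m C' = 1%:M, C *m A = f & C *m A + C' *m A' = 1%:M].
  move=> ff rf; have [A [C [CA AC]]] := idem_factor ff rf.
  have [||A' [C' [CA' AC']]] := @idem_factor n (n - k)%N (1 - f); rewrite ?mxrank_idemC ?rf ?idemC //.
  by exists A, C, A', C'; split=> //; rewrite CA CA' addrC subrK.
have [A [C [A' [C' [AC AC' CAe CA]]]]] := fac e ee re.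
rewrite (@card_conj_class n e (idem_of_rank n k)); last first.
  move=> f; rewrite inE; split.
    move=> /andP[/eqP ff /eqP rf].
    have [D [G [D' [G' [DG DG' GDf GD]]]]] := fac f ff rf.
    exists (C *m D + C' *m D').
      apply: (proj1 (@mulmx1_unit _ _ _ (G *m A + G' *m A') _)).
      rewrite mulmxDl !mulmxDr -!mulmxA !(mulmxA D) !(mulmxA D').
      rewrite DG DG' (corner_ortho12 DG DG' GD) (corner_ortho21 DG DG' GD).
      by rewrite !mul0mx !mulmx0 !mul1mx addr0 add0r.
    rewrite -GDf -CAe -!mulmxE mulmxDl mulmxDr -!mulmxA !(mulmxA D) !(mulmxA D') !(mulmxA A).
    rewrite DG (corner_ortho21 DG DG' GD) AC (corner_ortho12 AC AC' CA).
    by rewrite !mul0mx !mulmx0 !addr0 !mul1mx.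
  move=> [g ug gf].
  have fg : f = invmx g * (e * g) by rewrite -gf -[LHS](mulKmx ug).
  rewrite -re; have -> : \rank f = \rank e.
    rewrite fg -mulmxE eqmxMfull ?row_full_unit ?unitmx_inv //.
    by rewrite mxrankMfree ?row_free_unit.
  rewrite eqxx andbT; apply/eqP; apply: (can_inj (mulKmx ug)).
  by rewrite !mulmxE mulrA gf -mulrA gf mulrA ee.
congr muln; rewrite /card_unitmx -cardsX.
rewrite -(card_in_imset (f := fun p => corner A C p.1 + corner A' C' p.2)) //; last first.
  by move=> [x y] [x' y'] _ _ /= /(cornerD_inj AC AC' CA)[-> ->].
apply: eq_card => h; rewrite !inE; apply/imsetP/andP.
  move=> [[x y]]; rewrite !inE /= => /andP[ux uy] ->; split.
    apply: (proj1 (@mulmx1_unit _ _ _ (corner A C (invmx x) + corner A' C' (invmx y)) _)).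
    rewrite mulmxE (cornerDM AC AC' CA) -!mulmxE !mulmxV //.
    exact: (corner1D CA).
  rewrite -CAe -corner1 mulrDl mulrDr (cornerM12 AC AC' CA) (cornerM21 AC AC' CA).
  by rewrite cornerr1 // cornerl1.
move=> [uh /eqP]; rewrite -CAe -corner1 => he.
have c1 : corner A C 1 = 1 - corner A' C' 1 by rewrite -(corner1D CA) addrK.
have he' : h * corner A' C' 1 = corner A' C' 1 * h.
  move: he; rewrite c1 mulrBl mulrBr mul1r mulr1 => /(congr1 (fun z => h - z)).
  by rewrite !opprB ![h + _]addrC !subrK.
have [x ux hx] := unit_corner AC uh he.
have [y uy hy] := unit_corner AC' uh he'.
exists (x, y); first by rewrite !inE ux.
by rewrite /= -hx -hy -mulrDr (corner1D CA) mulr1.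
Qed.

Definition block_algebras n := [set B : {set 'M[F]_n} | block_algebra B].
Definition local_block_algebras n := [set B : {set 'M[F]_n} | local_block_algebra B].

(** Counting the pairs formed by an algebra and one of its primitive idempotents,
    weighted by the rank of the latter. *)
Lemma card_block_algebras_rec n :
  (n * #|block_algebras n| =
   \sum_(k < n.+1) k * (#|idem_of_rank n k| *
                        (#|local_block_algebras k| * #|block_algebras (n - k)|)))%N.
Proof.
transitivity (\sum_(B in block_algebras n) \sum_(e | prim_idem B e) \rank e)%N.
  rewrite mulnC -sum_nat_const; apply: eq_bigr => B; rewrite inE => /andP[sB _].
  by rewrite mxrank_prim_idem.
rewrite (exchange_big_dep (fun e : 'M[F]_n => e * e == e)) /=; last first.
  by move=> B e _ /prim_idemP[_ ->].
rewrite (partition_big (fun e : 'M[F]_n => inord (\rank e) : 'I_n.+1) predT) //=.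
apply: eq_bigr => k _; rewrite mulnCA -sum_nat_const; apply: eq_big => e.
  by rewrite inE; congr (_ && _); rewrite -val_eqE /= inordK // ltnS rank_leq_row.
move=> /andP[/eqP ee /eqP rk].
have re : \rank e = k by rewrite -rk inordK // ltnS rank_leq_row.
have [A [C [CA AC]]] := idem_factor ee re.
have ee' : (1 - e) * (1 - e) = 1 - e by rewrite mulrBr mulr1 mulrBl mul1r ee subrr subr0.
have [||A' [C' [CA' AC']]] := @idem_factor n (n - k)%N (1 - e); rewrite ?mxrank_idemC ?re //.
rewrite -(card_block_algebra_corner AC AC'); last by rewrite CA CA' addrC subrK.
by rewrite sum_nat_cond_const mulnC; congr muln; apply: eq_card => B; rewrite !inE CA.
Qed.

End Count.

(** * Polynomials modulo powers of an irreducible polynomial *)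

Section Irreducible.

Variables (F : fieldType) (p : {poly F}).
Hypothesis pI : irreducible_poly p.
Implicit Types g h : {poly F}.

Lemma irred_dvdpM g h : (p %| g * h) = (p %| g) || (p %| h).
Proof.
have [pg|npg] /= := boolP (p %| g); first by rewrite dvdp_mulr.
by rewrite Gauss_dvdpr // irreducible_poly_coprime.
Qed.

Lemma irred_dvdpX g m : (0 < m)%N -> (p %| g ^+ m) = (p %| g).
Proof.
case: m => // m _; elim: m => [|m IH]; first by rewrite expr1.
by rewrite exprS irred_dvdpM IH orbb.
Qed.

Lemma irred_coprimepX g m : ~~ (p %| g) -> coprimep (p ^+ m) g.
Proof. by move=> npg; rewrite coprimep_expl // irreducible_poly_coprime. Qed.

(** Modulo a power of p, every nonzero ideal contains the last nonzero power of p. *)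
Lemma irred_socle g m : ~~ (p ^+ m %| g) -> exists h, p ^+ m %| g * h - p ^+ m.-1.
Proof.
elim: m g => [|m IH] g; first by rewrite expr0 dvd1p.
have [/dvdpP[g1 ->]|npg] := boolP (p %| g).
  have p0 := irredp_neq0 pI.
  rewrite exprSr dvdp_mul2r // => ng1; have [h hP] := IH _ ng1.
  exists h => /=; case: m {IH} hP ng1 => [|m] hP ng1; first by rewrite expr0 dvd1p in ng1.
  have -> : g1 * p * h - p ^+ m.+1 = (g1 * h - p ^+ m) * p by rewrite mulrBl -exprSr mulrAC.
  by rewrite dvdp_mul2r.
move=> _; have /Bezout_eq1_coprimepP[[u v] /= uv] := irred_coprimepX m.+1 npg.
exists (v * p ^+ m); rewrite mulrA [g * v]mulrC.
have -> : v * g = 1 - u * p ^+ m.+1 by rewrite -uv addrC addKr.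
by rewrite mulrBl mul1r addrC addKr dvdpNr mulrAC dvdp_mull.
Qed.

End Irreducible.

Section PolyCount.

Variable F : finFieldType.
Local Notation q := #|F|.
Implicit Types (g h p w : {poly F}).

Lemma val_npolyp n g : (size g <= n)%N -> val (npolyp n g) = g.
Proof. exact: npolypK. Qed.

(** Division by w: a property that depends only on the class modulo w is counted on
    remainders. *)
Lemma card_poly_mod a b w (P : pred {poly F}) : w \is monic -> size w = a.+1 ->
  (forall g h, P (g + w * h) = P g) ->
  #|[set g : {poly_(a + b) F} | P g]| = (#|[set g : {poly_a F} | P g]| * q ^ b)%N.
Proof.
move=> wm sw Pw; rewrite -card_npoly -cardsT -cardsX.
have w0 := monic_neq0 wm.
have sz (r : {poly_a F}) (h : {poly_b F}) : (size (val r + w * val h)%R <= a + b)%N.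
  rewrite (leq_trans (size_polyD _ _)) // geq_max; apply/andP; split.
    by rewrite (leq_trans (size_npoly r)) // leq_addr.
  rewrite (leq_trans (size_polyMleq _ _)) // sw addSn /= leq_add2l.
  exact: size_npoly.
pose f (rh : {poly_a F} * {poly_b F}) : {poly_(a + b) F} := npolyp _ (val rh.1 + w * val rh.2).
have fE (r : {poly_a F}) (h : {poly_b F}) : val (f (r, h)) = val r + w * val h by exact: (npolypK (sz r h)).
have rlt (r : {poly_a F}) : (size (val r) < size w)%N by rewrite sw ltnS size_npoly.
rewrite -(card_in_imset (f := f)); last first.
  move=> [r h] [r' h'] _ _ /(congr1 val); rewrite !fE => E.
  have rr : val r = val r'.
    have := congr1 (fun x => x %% w) E.
    by rewrite !modpD ![w * _]mulrC !modp_mull !addr0 !modp_small.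
  move: E; rewrite rr => /addrI /(mulfI w0) hh.
  by congr pair; apply: val_inj.
apply: eq_card => g; rewrite inE; apply/idP/imsetP.
  move=> Pg.
  have sr : (size (val g %% w)%R <= a)%N by rewrite -ltnS -sw ltn_modp.
  have sh : (size (val g %/ w)%R <= b)%N.
    by rewrite size_divp // sw /= leq_subLR size_npoly.
  have gE : val g = val g %% w + w * (val g %/ w) by rewrite mulrC addrC -divp_eq.
  exists (npolyp _ (val g %% w), npolyp _ (val g %/ w)).
    by rewrite !inE andbT /= npolypK // -(Pw _ (val g %/ w)) -gE.
  by apply: val_inj; rewrite fE !val_npolyp.
move=> [[r h]]; rewrite !inE andbT /= => Pr ->.
by rewrite -[X in P X]/(val (f (r, h))) fE Pw.
Qed.

Lemma card_dvdp a b w : w \is monic -> size w = a.+1 ->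
  #|[set g : {poly_(a + b) F} | w %| g]| = (q ^ b)%N.
Proof.
move=> wm sw; rewrite (card_poly_mod (a := a) b (P := fun g => w %| g) wm sw); last first.
  by move=> g h; rewrite dvdp_addl // dvdp_mulr.
rewrite (_ : [set g : {poly_a F} | w %| val g] = [set 0]) ?cards1 ?mul1n //.
apply/setP=> g; rewrite !inE; apply/idP/eqP=> [wg|->]; last exact: dvdp0.
apply: val_inj; apply/eqP; apply: contraT => g0.
by have := dvdp_leq g0 wg; rewrite sw leqNgt ltnS size_npoly.
Qed.

(** The residue field at p, as a finite field with a quotient morphism. *)
Lemma residue_field d p : monic_irreducible_poly p -> size p = d.+1 ->
  exists (K : finFieldType) (phi : {rmorphism {poly F} -> K}),
    [/\ #|K| = (q ^ d)%N, forall g, (phi g == 0) = (p %| g)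
      & forall x, exists2 g : {poly F}, (size g <= d)%N & phi g = x].
Proof.
move=> pI sp; pose K : finFieldType := {poly %/ p with pI}.
pose f (g : {poly F}) : K := in_qpoly p g.
have fB : zmod_morphism f by move=> x y; rewrite /f; exact: (raddfB (in_qpoly p)).
have fM : monoid_morphism f by split; [exact: in_qpoly1 | exact: in_qpolyM].
pose fb := GRing.isZmodMorphism.Build _ _ f fB.
pose fm := GRing.isMonoidMorphism.Build _ _ f fM.
pose phi : {rmorphism {poly F} -> K} := HB.pack f fb fm.
exists K, phi; split.
- by rewrite card_qfpoly sp.
- move=> g; apply/eqP/idP => [/val_eqP /= | hDp].
    by rewrite -Pdiv.IdomainMonic.modpE (mk_monicE pI) ?pI.
  by apply/val_eqP; rewrite /= -Pdiv.IdomainMonic.modpE (mk_monicE pI) ?pI.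
move=> x; exists ((x : {poly %/ p}) : {poly F}).
  by rewrite (leq_trans (size_npoly _)) // (mk_monicE pI) sp.
apply: val_inj; apply: in_qpoly_small; apply: leq_ltn_trans (size_npoly x) _.
by rewrite (mk_monicE pI) sp.
Qed.

Lemma irred_dvd_Xq d p : monic_irreducible_poly p -> size p = d.+1 ->
  p %| 'X^(q ^ d) - 'X.
Proof.
move=> pI sp; have [K [phi [cK phi0 _]]] := residue_field pI sp.
by rewrite -phi0 rmorphB rmorphXn /= -cK expf_card subrr.
Qed.

Lemma comp_poly_taylor (P x y : {poly F}) : exists t,
  P \Po (x + y) = P \Po x + y * (P^`() \Po x) + y ^+ 2 * t.
Proof.
elim/poly_ind: P => [|P c [t IH]].
  by exists 0; rewrite deriv0 !comp_poly0 !mulr0 !addr0.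
exists (t * (x + y) + (P^`() \Po x)).
rewrite !comp_polyD !comp_polyM !comp_polyX !comp_polyC IH.
rewrite derivD derivM derivX derivC addr0 mulr1 comp_polyD comp_polyM comp_polyX.
by ring.
Qed.

Lemma card_natr_eq0 : q%:R = 0 :> F.
Proof. by rewrite -[in LHS]cardsT -FinRing.zmodXgE cyclic.expg_cardG // inE. Qed.

(** This is why a divisor of 'X^(q ^ d) - 'X has simple roots only. *)
Lemma deriv_Xq d : (0 < d)%N -> ('X^(q ^ d) - 'X)^`() = -1 :> {poly F}.
Proof.
move=> d0; rewrite derivB derivXn derivX -mulr_natr -polyC_natr natrX card_natr_eq0.
by rewrite expr0n gtn_eqF // polyC0 mulr0 sub0r.
Qed.

Section Roots.

Variables (d : nat) (p p' : {poly F}).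
Hypotheses (d_gt0 : (0 < d)%N).
Hypotheses (pI : monic_irreducible_poly p) (sp : size p = d.+1).
Hypotheses (pI' : monic_irreducible_poly p') (sp' : size p' = d.+1).

(** The roots of p' modulo p. *)
Lemma card_roots_mod : #|[set g : {poly_d F} | p %| p' \Po g]| = d.
Proof.
have [K [phi [cK phi0 phis]]] := residue_field pI sp.
have phi_inj (g h : {poly_d F}) : phi g = phi h -> g = h.
  move=> /eqP; rewrite -subr_eq0 -rmorphB phi0 => pgh; apply: val_inj.
  apply/eqP; rewrite -subr_eq0; apply: contraT => gh0.
  have := dvdp_leq gh0 pgh; rewrite sp ltnNge (leq_trans (size_polyD _ _)) //.
  by rewrite size_polyN geq_max !size_npoly.
pose c : {rmorphism F -> K} := phi \o polyC.
have phiE g h : phi (g \Po h) = (map_poly c g).[phi h].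
  rewrite comp_polyE rmorph_sum horner_poly /=; apply: eq_bigr => i _.
  by rewrite -mul_polyC rmorphM rmorphXn.
have : map_poly c p' %| \prod_x ('X - x%:P).
  rewrite -finField_genPoly cK.
  have -> : 'X^(q ^ d) - 'X = map_poly c ('X^(q ^ d) - 'X).
    by rewrite rmorphB /= map_polyXn map_polyX.
  by rewrite dvdp_map irred_dvd_Xq.
case/dvdp_prod_XsubC => m; set s := mask m _ => ps.
have us : uniq s by rewrite mask_uniq // index_enum_uniq.
have : size (map_poly c p') = (size s).+1 by rewrite (eqp_size ps) size_prod_XsubC.
rewrite size_map_poly sp' => -[ds]; rewrite [RHS]ds -(card_uniqP us).
rewrite -(card_in_imset (f := fun g : {poly_d F} => phi g)); last first.
  by move=> g h _ _; apply: phi_inj.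
apply: eq_card => x; rewrite -(root_prod_XsubC s) -(eqp_root ps).
apply/imsetP/idP => [[g]|].
  by rewrite inE -phi0 phiE => gr ->.
have [g sg <-] := phis x; rewrite rootE -phiE phi0 => pg.
by exists (npolyp d g); rewrite ?inE /= npolypK.
Qed.

(** A root of p' modulo p is simple. *)
Lemma root_mod_simple g : p %| p' \Po g -> ~~ (p %| p'^`() \Po g).
Proof.
have /dvdpP[s sE] := irred_dvd_Xq pI' sp'.
move=> pg; apply/negP => pg'.
have := congr1 (fun h => h^`() \Po g) sE.
rewrite deriv_Xq // derivM comp_polyD !comp_polyM => E.
have : p %| - 1 \Po g by rewrite E dvdp_add // dvdp_mull.
rewrite rmorphN /= comp_polyC dvdpNr dvdp1 => /eqP s1.
by case: pI => -[]; rewrite s1.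
Qed.

(** Hensel lifting of the roots of p' from p to p ^ 2. *)
Lemma card_roots_mod2 : #|[set g : {poly_(d + d) F} | p ^+ 2 %| p' \Po g]| = d.
Proof.
have p0 : p != 0 by rewrite monic_neq0 ?pI.
pose f (g : {poly_(d + d) F}) : {poly_d F} := npolyp d (val g %% p).
have fE (g : {poly_(d + d) F}) : val (f g) = val g %% p.
  by rewrite val_npolyp // -ltnS -sp ltn_modp.
have dec g : g = g %% p + p * (g %/ p) by rewrite mulrC addrC -divp_eq.
have root_f (g : {poly_(d + d) F}) : p ^+ 2 %| p' \Po g -> p %| p' \Po f g.
  move=> pg; have : p %| p' \Po val g by rewrite (dvdp_trans _ pg) // expr2 dvdp_mulr.
  have [t] := comp_poly_taylor p' (val g %% p) (p * (val g %/ p)).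
  rewrite -dec => -> ; rewrite -[f g : {poly F}]/(val (f g)) fE.
  rewrite -addrA dvdp_addl // dvdp_add // -?mulrA ?dvdp_mulr //.
rewrite -[RHS]card_roots_mod -(card_in_imset (f := f)).
  apply: eq_card => r; rewrite inE; apply/imsetP/idP => [[g]|].
    by rewrite inE => /root_f pg ->.
  move=> /[dup] /dvdpP[t tE] /root_mod_simple rs.
  have : coprimep p (p'^`() \Po r) by rewrite (irreducible_poly_coprime _ pI.1).
  move=> /Bezout_eq1_coprimepP[[u v] /= uv].
  pose s := (- t * v) %% p.
  have ss : (size s <= d)%N by rewrite -ltnS -sp ltn_modp.
  have sg : (size (val r + p * s)%R <= d + d)%N.
    rewrite (leq_trans (size_polyD _ _)) // geq_max (leq_trans (size_npoly _)) ?leq_addr //.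
    by rewrite (leq_trans (size_polyMleq _ _)) // sp addSn leq_add2l.
  exists (npolyp (d + d) (val r + p * s)); last first.
    apply: val_inj; rewrite fE val_npolyp // modpD mulrC modp_mull addr0 modp_small //.
    by rewrite sp ltnS size_npoly.
  rewrite inE npolypK //; have [x ->] := comp_poly_taylor p' (val r) (p * s).
  rewrite exprMn -[p ^+ 2 * _ * _]mulrA dvdp_addl ?dvdp_mulIl //.
  rewrite tE /s -[X in p * X](subrK (- t * v)).
  set z := _ - _; have /dvdpP[y ->] : p %| z.
    by rewrite /z [X in _ - X](divp_eq _ p) opprD addrCA subrr addr0 dvdpNr dvdp_mull.
  have -> : t * p + p * (y * p + - t * v) * (p'^`() \Po r) =
     p ^+ 2 * (y * (p'^`() \Po r) + t * u); last by rewrite dvdp_mulIl.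
  have -> : t * p = t * p * (u * p + v * (p'^`() \Po r)) by rewrite uv mulr1.
  ring.
move=> g h; rewrite !inE => pg ph fgh.
have mgh : val g %% p = val h %% p by rewrite -!fE fgh.
have nr := root_mod_simple (root_f g pg); rewrite -[f g : {poly F}]/(val (f g)) fE in nr.
suff ss : val g %/ p = val h %/ p.
  by apply: val_inj; rewrite (dec (val g)) (dec (val h)) mgh ss.
rewrite -[g : {poly F}]/(val g) (dec (val g)) in pg.
rewrite -[h : {poly F}]/(val h) (dec (val h)) -mgh in ph.
move: pg ph.
set r := val g %% p in nr *; set s := val g %/ p; set s' := val h %/ p.
have [t ->] := comp_poly_taylor p' r (p * s).
have [t' ->] := comp_poly_taylor p' r (p * s').
move=> pg /(dvdp_sub pg).
have -> : p' \Po r + p * s * (p'^`() \Po r) + (p * s) ^+ 2 * t -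
    (p' \Po r + p * s' * (p'^`() \Po r) + (p * s') ^+ 2 * t') =
  p * ((s - s') * (p'^`() \Po r)) + p ^+ 2 * (s ^+ 2 * t - s' ^+ 2 * t') by ring.
rewrite dvdp_addl ?dvdp_mulIl // expr2 dvdp_mul2l // (irred_dvdpM pI.1) (negPf nr) orbF => ps.
apply/eqP; rewrite -subr_eq0; apply: contraT => ss0.
have sz (k : {poly_(d + d) F}) : (size (val k %/ p)%R <= d)%N.
  by rewrite size_divp // sp /= leq_subLR size_npoly.
have := dvdp_leq ss0 ps; rewrite sp ltnNge (leq_trans (size_polyD _ _)) //.
by rewrite size_polyN geq_max !sz.
Qed.

End Roots.

End PolyCount.

(** * Irreducible polynomials and their roots in local quotients *)

Section Generators.

Variable F : finFieldType.
Local Notation q := #|F|.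

(** The number of elements of F[X]/(p ^ m) whose minimal polynomial over F is p' ^ m,
    where p and p' are irreducible of degree d. These are the roots of p' modulo p
    that are not roots modulo p ^ 2 when m > 1. *)
Definition num_gens d m : nat :=
  if m == 1%N then d else (d * (q ^ (d * m.-1) - q ^ (d * m.-2)))%N.

(** If m > 1, each of the d roots modulo p has q ^ (d * (m - 1)) lifts modulo p ^ m,
    among which the q ^ (d * (m - 2)) lifts of its unique lift modulo p ^ 2 to a root
    of p' are left out. *)
Lemma card_gens_mod d m (p p' : {poly F}) : (0 < m)%N ->
  monic_irreducible_poly p -> size p = d.+1 ->
  monic_irreducible_poly p' -> size p' = d.+1 ->
  #|[set g : {poly_(d * m) F} | (p %| p' \Po g) && ((1 < m)%N ==> ~~ (p ^+ 2 %| p' \Po g))]|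
  = num_gens d m.
Proof.
move=> m0 pI sp pI' sp'.
have d0 : (0 < d)%N by have [[+ _] _] := pI; rewrite sp ltnS.
have compD (g h : {poly F}) : exists t, p' \Po (g + h) = p' \Po g + h * t.
  have [t ->] := comp_poly_taylor p' g h.
  by exists ((p'^`() \Po g) + h * t); ring.
have modP w (g h : {poly F}) : (w %| p' \Po (g + w * h)) = (w %| p' \Po g).
  by have [t ->] := compD g (w * h); rewrite dvdp_addl // -mulrA dvdp_mulIl.
have c1 b : #|[set g : {poly_(d + b) F} | p %| p' \Po g]| = (d * q ^ b)%N.
  rewrite (card_poly_mod (P := fun g => p %| p' \Po g) b pI.2 sp) //.
  by rewrite card_roots_mod.
have sp2 : size (p ^+ 2) = (d + d).+1.
  by rewrite expr2 (size_monicM pI.2) ?(monic_neq0 pI.2) // sp addSn addnS.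
have c2 b : #|[set g : {poly_(d + d + b) F} | p ^+ 2 %| p' \Po g]| = (d * q ^ b)%N.
  rewrite (card_poly_mod (P := fun g => p ^+ 2 %| p' \Po g) b (monic_exp 2 pI.2) sp2) //.
  by rewrite card_roots_mod2.
case: m m0 => // -[_|m _].
  rewrite /num_gens /=; have := c1 0%N; rewrite expn0 muln1 addn0 => c0; rewrite -[RHS]c0.
  by apply: eq_card => g; rewrite !inE andbT.
rewrite /num_gens /= mulnBr; have := c1 (d * m.+1)%N; rewrite -mulnS => <-.
have := c2 (d * m)%N; rewrite -addnA -!mulnS => <-.
rewrite -cardsDS; last first.
  by apply/subsetP=> g; rewrite !inE; apply: dvdp_trans; rewrite expr2 dvdp_mulIl.
by apply: eq_card => g; rewrite !inE andbC.
Qed.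

(** The roots of 'X^(q ^ d) - 'X in a splitting field are the fixed points of the
    d-th power of the Frobenius automorphism. *)
Lemma exists_subfield d : (0 < d)%N ->
  exists (L : splittingFieldType F) (E : {subfield L}), \dim E = d.
Proof.
move=> d0; pose Q : {poly F} := 'X^(q ^ d) - 'X.
have qd1 : (1 < q ^ d)%N by rewrite -(expn0 q) ltn_exp2l // finNzRing_gt1.
have sQ : size Q = (q ^ d).+1.
  by rewrite size_polyDl size_polyXn // size_polyN size_polyX.
have [|L [zs Qzs _]] := @FinSplittingFieldFor F Q; first by rewrite -size_poly_gt0 sQ.
have Uzs : uniq zs.
  rewrite -separable_prod_XsubC -(eqp_separable Qzs) separable_map unlock.
  by rewrite deriv_Xq // -scaleN1r coprimepZr ?oppr_eq0 ?oner_eq0 // coprimep1.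
have szs : size zs = (q ^ d)%N.
  by apply: succn_inj; rewrite -(size_prod_XsubC zs id) -(eqp_size Qzs) size_map_poly.
have [a _ aE] := finField_galois_generator (sub1v {:L}%AS).
rewrite /= dimv1 expn1 in aE.
exists L, [aspace of fixedSpace (a ^+ d)%g].
pose K : finFieldType := FinFieldExtType L.
have zsE : zs =i fixedSpace (a ^+ d)%g.
  move=> z; rewrite -root_prod_XsubC -(eqp_root Qzs) (sameP fixedSpaceP eqP).
  rewrite rmorphB /= map_polyXn map_polyX rootE !hornerE subr_eq0; congr (_ == z).
  elim: d {d0 Q qd1 sQ Qzs szs} => [|i IH]; first by rewrite gal_id.
  by rewrite expgSr expnSr exprM IH galM ?aE ?memvf.
apply/eqP; rewrite -(eqn_exp2l _ _ (finNzRing_gt1 F)) -szs.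
rewrite -(@card_vspace F K) -(@card_uniqP K zs Uzs); apply/eqP.
by apply: eq_card => z; rewrite zsE.
Qed.

Lemma exists_irred d : (0 < d)%N -> exists p : {poly F},
  [/\ monic_irreducible_poly p, size p = d.+1 & ~~ root p 0].
Proof.
move=> d0; have [L [E dE]] := exists_subfield d0.
have /and3P[_ sepE _] := finField_galois (sub1v E).
(* The separable generator may be 0 if d = 1; then 1 generates E as well. *)
have [x x0 xE] : exists2 x, x != 0 & <<1; x>>%VS = E.
  have := eq_adjoin_separable_generator sepE (sub1v _) => /=.
  set x := separable_generator _ _ => E1; have [x0|x0] := eqVneq x 0; last by exists x.
  exists 1; first exact: oner_neq0.
  by rewrite E1 x0 Fadjoin0; apply/Fadjoin_idP/mem1v.
have /polyOver1P[p pE] := minPolyOver 1%AS x.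
have sp : size p = d.+1.
  rewrite -(size_map_poly (in_alg L)) -pE size_minPoly adjoin_degreeE xE /= dE.
  by rewrite dimv1 divn1.
exists p; split=> //.
  split; last first.
    rewrite monicE -(fmorph_eq1 (in_alg L)) -lead_coef_map -pE.
    exact: monic_minPoly.
  split=> [|g sg gp]; first by rewrite sp.
  have gm : map_poly (in_alg L) g %| minPoly 1 x by rewrite pE dvdp_map.
  have go : map_poly (in_alg L) g \is a polyOver 1%AS by apply/polyOver1P; exists g.
  have /orP[] := minPoly_irr go gm; first by rewrite pE eqp_map.
  by rewrite -size_poly_eq1 size_map_poly (negPf sg).
apply: contra x0 => p0.
have : root (minPoly 1 x) 0 by rewrite pE -(rmorph0 (in_alg L)) fmorph_root.
rewrite root_factor_theorem subr0 => Xp.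
have /orP[/eqp_root E0|/eqp_size] := minPoly_irr (polyOverX 1%AS) Xp.
  by rewrite -[_ == _](rootX x) E0 root_minPoly.
by rewrite size_polyX size_poly1.
Qed.

End Generators.

(** * Krylov matrices and cyclic vectors *)

Section Krylov.

Variables (F : fieldType) (n : nat) (a : 'M[F]_n.+1).
Implicit Types g h : {poly F}.

Lemma horner_mx_comp_poly g h : horner_mx a (g \Po h) = horner_mx (horner_mx a h) g.
Proof.
elim/poly_ind: g => [|g c IH]; first by rewrite comp_poly0 !rmorph0.
rewrite comp_polyD comp_polyM comp_polyX comp_polyC !rmorphD !rmorphM /= IH.
by rewrite horner_mx_X !horner_mx_C.
Qed.

Lemma horner_mx_intertwine (b u : 'M[F]_n.+1) g : u * b = a * u ->
  u * horner_mx b g = horner_mx a g * u.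
Proof.
move=> ub; elim/poly_ind: g => [|g c IH]; first by rewrite !rmorph0 mulr0 mul0r.
rewrite !rmorphD !rmorphM /= !horner_mx_X !horner_mx_C mulrDr mulrDl mulrA IH -!mulrA ub.
by congr (_ + _); rewrite -mulmxE scalar_mxC.
Qed.

(** The matrix with rows v, v a, ..., v a ^ (D - 1). *)
Definition krylov D (v : 'rV[F]_n.+1) : 'M[F]_(D, n.+1) := \matrix_i (v *m a ^+ i).

Lemma horner_mx_coef D g : (size g <= D)%N -> horner_mx a g = \sum_(i < D) g`_i *: a ^+ i.
Proof.
move=> sg; have gE : g = \sum_(i < D) g`_i *: 'X^i.
  rewrite -poly_def; apply/polyP=> i; rewrite coef_poly; case: ltnP => // Di.
  by rewrite nth_default // (leq_trans sg).
rewrite {1}gE rmorph_sum; apply: eq_bigr => i _ /=.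
by rewrite horner_mxZ rmorphXn /= horner_mx_X.
Qed.

Lemma mul_krylov D v (r : 'rV_D) : r *m krylov D v = v *m horner_mx a (rVpoly r).
Proof.
rewrite (horner_mx_coef (size_poly _ _)) mulmx_sumr mulmx_sum_row.
apply: eq_bigr => i _; rewrite rowK -scalemxAr coef_rVpoly_ord; congr (_ *: _).
Qed.

Variables (w : {poly F}) (D : nat).
Hypotheses (wm : w \is monic) (sw : size w = D.+1) (aw : horner_mx a w = 0).

Lemma horner_mx_mod g : horner_mx a (g %% w) = horner_mx a g.
Proof. by rewrite [in RHS](divp_eq g w) rmorphD rmorphM /= aw mulr0 add0r. Qed.

Lemma size_mod g : (size (g %% w)%R <= D)%N.
Proof. by rewrite -ltnS -sw ltn_modp monic_neq0. Qed.

(** The matrix of multiplication by 'X in F[X]/(w). *)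
Definition mulX_mx : 'M[F]_D := \matrix_i poly_rV ('X^(i.+1) %% w).

Lemma krylov_mulX v : krylov D v *m a = mulX_mx *m krylov D v.
Proof.
apply/row_matrixP=> i; rewrite !row_mul !rowK mul_krylov poly_rV_K ?size_mod //.
by rewrite horner_mx_mod rmorphXn /= horner_mx_X exprSr -mulmxE mulmxA.
Qed.

End Krylov.

Section Cyclic.

Variables (F : fieldType) (n : nat) (a : 'M[F]_n.+1).
Variables (p : {poly F}) (m D : nat).
Hypotheses (pI : irreducible_poly p) (wm : p ^+ m \is monic) (sw : size (p ^+ m) = D.+1).
Hypothesis aw : forall g, (horner_mx a g == 0) = (p ^+ m %| g).
Local Notation w := (p ^+ m).

Let aw0 : horner_mx a w = 0. Proof. by apply/eqP; rewrite aw. Qed.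

Section CyclicVector.
Variable v : 'rV[F]_n.+1.
Hypothesis v0 : v *m horner_mx a (p ^+ m.-1) != 0.

(** The annihilator of v is generated by a power of p, which is not smaller than p ^ m
    by the choice of v. *)
Lemma cyclic_annihilator g : (v *m horner_mx a g == 0) = (w %| g).
Proof.
apply/eqP/idP=> [vg|]; last by rewrite -aw => /eqP->; rewrite mulmx0.
apply: contraT => /(irred_socle pI)[h]; rewrite -aw rmorphB rmorphM /= subr_eq0 => /eqP gh.
by move: v0; rewrite -gh -mulmxE mulmxA vg mul0mx eqxx.
Qed.

Lemma krylov_row_free : row_free (krylov a D v).
Proof.
apply: inj_row_free => r; rewrite mul_krylov => /eqP; rewrite cyclic_annihilator => wr.
apply: (can_inj rVpolyK); rewrite linear0; apply/eqP; apply: contraT => r0.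
by have := dvdp_leq r0 wr; rewrite sw leqNgt ltnS size_poly.
Qed.

End CyclicVector.

Section Hankel.

Variables (v : 'rV[F]_n.+1) (c : 'cV[F]_n.+1).
Hypothesis vc : v *m horner_mx a (p ^+ m.-1) *m c != 0.

Let K := krylov a D v.
Let L := (krylov a^T D c^T)^T.

Lemma trmx_horner_mx g : (horner_mx a g)^T = horner_mx a^T g.
Proof.
elim/poly_ind: g => [|g x IH]; first by rewrite !rmorph0 trmx0.
rewrite !rmorphD !rmorphM /= !horner_mx_X !horner_mx_C.
rewrite [LHS]raddfD /= tr_scalar_mx -mulmxE trmx_mul IH mulmxE.
by congr (_ + _); apply: (comm_mx_horner _ (comm_mx_refl _)).
Qed.

(** This Hankel matrix is the matrix of the bilinear form (g, h) |-> v (g h)(a) c on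
    F[X]/(p ^ m), which is nondegenerate because a nonzero ideal contains p ^ (m - 1). *)
Lemma hankel_unit : K *m L \in unitmx.
Proof.
rewrite -row_free_unit; apply: inj_row_free => r.
rewrite mulmxA mul_krylov => rKL.
have {}rKL (s : 'rV_D) : v *m horner_mx a (rVpoly r * rVpoly s) *m c = 0.
  move: (congr1 (fun z => z *m s^T) rKL) => /=; rewrite mul0mx -!mulmxA -trmx_mul.
  by rewrite mul_krylov trmx_mul trmxK -trmx_horner_mx trmxK rmorphM /= -mulmxE !mulmxA.
apply: (can_inj rVpolyK); rewrite linear0; apply/eqP; apply: contraT => r0.
have : ~~ (w %| rVpoly r).
  by apply/negP => /(dvdp_leq r0); rewrite sw leqNgt ltnS size_poly.
move=> /(irred_socle pI)[h]; rewrite -aw rmorphB rmorphM /= subr_eq0 => /eqP gh.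
have := rKL (poly_rV (h %% w)); rewrite poly_rV_K ?(size_mod wm sw) //.
rewrite rmorphM /= (horner_mx_mod aw0) gh => /eqP; by rewrite (negPf vc).
Qed.

(** A projection of rank D, the degree of p ^ m, onto the cyclic module generated
    by v; it commutes with a. *)
Definition hankel_idem : 'M[F]_n.+1 := L *m invmx (K *m L) *m K.

Lemma hankel_idemP : hankel_idem * hankel_idem = hankel_idem.
Proof.
rewrite /hankel_idem -!mulmxE -!mulmxA; congr (_ *m _); rewrite !mulmxA.
by rewrite -(mulmxA _ K) mulVmx ?hankel_unit // mul1mx.
Qed.

Lemma hankel_comm : a * hankel_idem = hankel_idem * a.
Proof.
set M := mulX_mx w D.
have Ka : K *m a = M *m K by apply: krylov_mulX.
have aL : a *m L = L *m M^T.
  apply: trmx_inj; rewrite !trmx_mul !trmxK; apply: krylov_mulX => //.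
  by rewrite -trmx_horner_mx aw0 trmx0.
have HM : K *m L *m M^T = M *m (K *m L) by rewrite -mulmxA -aL mulmxA Ka -mulmxA.
have uH := hankel_unit; rewrite /hankel_idem -!mulmxE.
move: (K *m L) uH HM => H uH HM.
rewrite -(mulmxA _ K) Ka !mulmxA aL -!mulmxA; congr (_ *m _).
rewrite !mulmxA; congr (_ *m _); apply: (can_inj (mulKmx uH)).
by rewrite !mulmxA HM mulmxV // mul1mx -mulmxA mulmxV // mulmx1.
Qed.

End Hankel.

(** A matrix that commutes with no nontrivial idempotent and whose minimal
    polynomial is a power of p is cyclic. *)
Lemma indecomposable_cyclic : (0 < m)%N ->
  (forall f, f * f = f -> a * f = f * a -> f = 0 \/ f = 1) -> D = n.+1.
Proof.
move=> m0 triv.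
have : horner_mx a (p ^+ m.-1) != 0.
  by rewrite aw dvdp_Pexp2l ?pI.1 // -ltnNge prednK.
have D0 : (0 < D)%N.
  rewrite -ltnS -sw (leq_trans pI.1) // dvdp_leq ?monic_neq0 //.
  by rewrite -(prednK m0) exprS dvdp_mulIl.
move=> /matrix0Pn[i [j ij]].
pose v : 'rV[F]_n.+1 := delta_mx 0 i; pose c : 'cV[F]_n.+1 := delta_mx j 0.
have vc : v *m horner_mx a (p ^+ m.-1) *m c != 0.
  apply: contraNneq ij => /(congr1 (fun z : 'M[F]_1 => z 0 0)).
  by rewrite -rowE -colE !mxE => ->.
have [f0|f1] := triv _ (hankel_idemP vc) (hankel_comm vc).
  have := mxrank_unit (hankel_unit vc); set K := krylov _ _ _; set L := trmx _ => rKL.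
  suff KL0 : K *m L = 0 by rewrite -rKL KL0 mxrank0 in D0.
  have : K *m hankel_idem v c *m L = K *m L.
    by rewrite /hankel_idem -/K -/L -!mulmxA mulVmx ?(hankel_unit vc) // mulmx1.
  by rewrite f0 mulmx0 mul0mx => <-.
apply/eqP; rewrite eqn_leq; apply/andP; split.
  have := mxrank_unit (hankel_unit vc) => <-.
  exact: leq_trans (mxrankM_maxl _ _) (rank_leq_col _).
rewrite -(mxrank1 F n.+1) -[1%:M]f1 /hankel_idem.
exact: leq_trans (mxrankM_maxr _ _) (rank_leq_row _).
Qed.

End Cyclic.

(** * Centralizers of primary matrices *)

Section PrimaryClass.

Variables (F : finFieldType) (n : nat).
Local Notation q := #|F|.

(** The matrices whose minimal polynomial is p ^ m, when p is irreducible; when p ^ m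
    is of degree n.+1 they are cyclic. *)
Definition primary_class (p : {poly F}) m : {set 'M[F]_n.+1} :=
  [set a | (horner_mx a (p ^+ m) == 0) && (horner_mx a (p ^+ m.-1) != 0)].

(** The centralizer of a in the algebra of all matrices. *)
Definition centralizer (a : 'M[F]_n.+1) : {set 'M[F]_n.+1} := [set c | a * c == c * a].

Variables (p : {poly F}) (d m : nat).
Hypotheses (pI : monic_irreducible_poly p) (sp : size p = d.+1) (dm : (d * m = n.+1)%N).
Local Notation w := (p ^+ m).

Let d_gt0 : (0 < d)%N. Proof. by case: d dm. Qed.
Let m_gt0 : (0 < m)%N. Proof. by case: m dm => //; rewrite muln0. Qed.

Lemma monic_irredX k : p ^+ k \is monic. Proof. exact: monic_exp pI.2. Qed.

Lemma size_irredX k : size (p ^+ k) = (d * k).+1.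
Proof.
by rewrite -[LHS]prednK ?size_poly_gt0 ?monic_neq0 ?monic_irredX // size_exp sp.
Qed.

Let sw : size w = n.+2. Proof. by rewrite size_irredX dm. Qed.

Lemma primary_classP a : reflect (forall g, (horner_mx a g == 0) = (w %| g)) (a \in primary_class p m).
Proof.
rewrite inE; apply: (iffP andP) => [[/eqP aw a0] g|aw]; last first.
  by rewrite !aw dvdpp dvdp_Pexp2l ?pI.1.1 // -ltnNge prednK.
apply/eqP/idP=> [ag|/dvdpP[h ->]]; last by rewrite rmorphM /= aw mulr0.
apply: contraT => /(irred_socle pI.1)[h /dvdpP[k E]].
have := congr1 (horner_mx a) E; rewrite rmorphB !rmorphM /= ag aw mul0r mulr0 sub0r => /eqP.
by rewrite oppr_eq0 (negPf a0).
Qed.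

Section Element.

Variable a : 'M[F]_n.+1.
Hypothesis aT : a \in primary_class p m.

Let aw : forall g, (horner_mx a g == 0) = (w %| g). Proof. exact/primary_classP. Qed.

Lemma primary_krylov : exists v, krylov a n.+1 v \in unitmx.
Proof.
have : horner_mx a (p ^+ m.-1) != 0 by move: aT; rewrite inE => /andP[].
move=> /matrix0Pn[i [j ij]]; exists (delta_mx 0 i).
rewrite -row_free_unit; apply: (krylov_row_free pI.1 sw aw).
by apply: contraNneq ij => /rowP/(_ j); rewrite -rowE !mxE => ->.
Qed.

Lemma horner_mx_npoly_inj : injective (fun g : {poly_n.+1 F} => horner_mx a g).
Proof.
move=> g h /eqP; rewrite -subr_eq0 -rmorphB aw => wgh; apply: val_inj.
apply/eqP; rewrite -subr_eq0; apply: contraT => gh0.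
have := dvdp_leq gh0 wgh; rewrite sw ltnNge (leq_trans (size_polyD _ _)) //.
by rewrite size_polyN geq_max !size_npoly.
Qed.

Lemma centralizer_horner c : c \in centralizer a -> exists g : {poly_n.+1 F}, c = horner_mx a g.
Proof.
rewrite inE => /eqP ac; have [v uK] := primary_krylov.
pose r := v *m c *m invmx (krylov a n.+1 v).
have vc : v *m c = v *m horner_mx a (rVpoly r) by rewrite -mul_krylov mulmxKV.
have sr : (size (rVpoly r) <= n.+1)%N := size_poly _ _.
exists (npolyp n.+1 (rVpoly r)); rewrite npolypK //.
apply: (can_inj (mulKmx uK)); apply/row_matrixP=> i; rewrite !row_mul !rowK.
have acX k : a ^+ k * c = c * a ^+ k by apply/commr_sym/commrX/commr_sym.
have agX k : a ^+ k * horner_mx a (rVpoly r) = horner_mx a (rVpoly r) * a ^+ k.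
  by apply/commr_sym/commrX; apply: (comm_horner_mx _ (comm_mx_refl _)).
by rewrite -!mulmxA !mulmxE acX agX -!mulmxE !mulmxA vc.
Qed.

Lemma horner_centralizer g : horner_mx a g \in centralizer a.
Proof. by rewrite inE -{1 4}(horner_mx_X a) -!rmorphM mulrC. Qed.

(** The centralizer of a is isomorphic to F[X]/(p ^ m), through evaluation at a. *)
Lemma card_centralizer (P : pred 'M[F]_n.+1) :
  #|[set c in centralizer a | P c]| = #|[set g : {poly_n.+1 F} | P (horner_mx a g)]|.
Proof.
rewrite -(card_imset _ horner_mx_npoly_inj); apply: eq_card => c; rewrite inE.
apply/andP/imsetP => [[/centralizer_horner[g ->] Pc]|[g]].
  by exists g; rewrite ?inE.
by rewrite inE => Pg ->; rewrite horner_centralizer.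
Qed.

Lemma centralizer_subalgebra : comm_subalgebra (centralizer a).
Proof.
apply/comm_subalgebraP; split.
- by rewrite inE mulr1 mul1r.
- move=> c x y; rewrite !inE => /eqP ax /eqP ay.
  by rewrite mulrDr mulrDl ay -!mulmxE -scalemxAr -scalemxAl !mulmxE ax.
- by move=> x y; rewrite !inE => /eqP ax /eqP ay; rewrite mulrA ax -mulrA ay mulrA.
by move=> x y /centralizer_horner[g ->] /centralizer_horner[h ->]; rewrite -!rmorphM mulrC.
Qed.

Lemma primary_horner_unit g : (horner_mx a g \in unitmx) = ~~ (p %| g).
Proof.
have [pg|npg] /= := boolP (p %| g); last first.
  have /Bezout_eq1_coprimepP[[u v] /= uv] := irred_coprimepX pI.1 m npg.
  have := congr1 (horner_mx a) uv; rewrite rmorphD !rmorphM rmorph1 /=.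
  have /eqP -> : horner_mx a w == 0 by rewrite aw.
  by rewrite mulr0 add0r => /mulmx1_unit[].
apply/negP=> ug; have : horner_mx a (g ^+ m) = 0.
  by apply/eqP; rewrite aw dvdp_exp2r.
rewrite rmorphXn /= => g0; have := unitrX m ug; rewrite g0.
by rewrite unitr0.
Qed.

Lemma primary_idem f : f * f = f -> a * f = f * a -> f = 0 \/ f = 1.
Proof.
move=> ff af; have [g fg] : exists g : {poly F}, f = horner_mx a g.
  by have [|g ->] := @centralizer_horner f; [rewrite inE af | exists g].
have : w %| g * (g - 1).
  by rewrite -aw rmorphM rmorphB rmorph1 /= -fg mulrBr mulr1 ff subrr.
have [pg|npg] := boolP (p %| g).
  have npg1 : ~~ (p %| g - 1).
    apply/negP=> pg1; have := dvdp_sub pg pg1; rewrite opprB addrC subrK dvdp1 => /eqP s1.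
    by have := pI.1.1; rewrite s1.
  rewrite (Gauss_dvdpl _ (irred_coprimepX pI.1 m npg1)).
  by rewrite -aw -fg => /eqP; left.
rewrite (Gauss_dvdpr _ (irred_coprimepX pI.1 m npg)) -aw rmorphB rmorph1 /= -fg subr_eq0 => /eqP.
by right.
Qed.

(** Since p does not vanish at 0, the matrix a is invertible. *)
Lemma centralizer_local : ~~ root p 0 -> local_block_algebra (centralizer a).
Proof.
move=> p0; have ua : a \in unitmx.
  rewrite -[a]horner_mx_X primary_horner_unit; apply/negP => pX.
  have pX' : p %= 'X.
    rewrite -dvdp_size_eqp // size_polyX eqn_leq pI.1.1 andbT -(size_polyX F).
    by rewrite dvdp_leq ?polyX_eq0.
  by move: p0; rewrite (eqp_root pX') rootE hornerX eqxx.
have sB := centralizer_subalgebra.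
have triv f : f \in centralizer a -> f * f = f -> f = 0 \/ f = 1.
  by rewrite inE => /eqP af ff; apply: primary_idem.
have p1 : prim_idem (centralizer a) 1.
  apply/prim_idemP; split; [exact: subalg1 | exact: mulr1 | exact: oner_neq0 |].
  by move=> f Bf ff _; apply: triv.
rewrite /local_block_algebra p1 andbT /block_algebra sB; apply/forallP=> e.
apply/implyP=> /prim_idemP[Be ee e0 _]; have [e1|->] := triv e Be ee.
  by rewrite e1 eqxx in e0.
apply/monogenic_atP; exists a; split=> //; first by rewrite inE.
by move=> b _ _ ab; rewrite inE ab.
Qed.

End Element.

End PrimaryClass.

(** * The class of primary matrices *)

Section Factor.

Variable F : finFieldType.

Lemma exists_irred_factor (g : {poly F}) : (1 < size g)%N ->
  exists2 p, monic_irreducible_poly p & p %| g.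
Proof.
move=> sg; have g0 : g != 0 by rewrite -size_poly_gt0 ltnW.
pose P (h : {poly_(size g) F}) := (1 < size h)%N && (h %| g).
have P0 : P (npolyp _ g) by rewrite /P npolypK // sg dvdpp.
case: (arg_minnP (fun h : {poly_(size g) F} => size h) P0) => p /andP[sp pg] pmin.
have p0 : val p != 0 by rewrite -size_poly_gt0 ltnW.
have lp : lead_coef p != 0 by rewrite lead_coef_eq0.
have qp : (lead_coef p)^-1 *: val p %= val p by rewrite eqp_scale ?invr_eq0.
exists ((lead_coef p)^-1 *: val p); last by rewrite dvdpZl ?invr_eq0.
split; last by rewrite monicE lead_coefZ mulVf.
split=> [|h sh]; first by rewrite (eqp_size qp).
rewrite (eqp_dvdr _ qp) (eqp_rtrans qp) => hp.
rewrite -dvdp_size_eqp // eqn_leq dvdp_leq //=.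
have hg : h %| g := dvdp_trans hp pg.
have hs : (size h <= size g)%N by rewrite dvdp_leq.
have := pmin (npolyp _ h); rewrite /P npolypK //; apply; rewrite hg andbT.
rewrite ltn_neqAle eq_sym sh /= size_poly_gt0.
by apply: contraNneq g0 => h0; rewrite h0 dvd0p in hg.
Qed.

(** The exact power of p that divides g. *)
Lemma irred_multiplicity (p g : {poly F}) : irreducible_poly p -> g != 0 ->
  exists m s, g = p ^+ m * s /\ ~~ (p %| s).
Proof.
move=> pI; have [k] := ubnP (size g); elim: k g => // k IH g; rewrite ltnS => gk g0.
have [/dvdpP[h hE]|npg] := boolP (p %| g); last by exists 0%N, g; rewrite mul1r.
have h0 : h != 0 by apply: contraNneq g0 => h0; rewrite hE h0 mul0r.
have hk : (size h < k)%N.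
  apply: leq_trans gk; rewrite hE size_mul ?(irredp_neq0 pI) //.
  by have := pI.1; case: (size p) => [|[|k']] // _; rewrite !addnS /= -addSn leq_addr.
have [m [s [sE ns]]] := IH h hk h0.
by exists m.+1, s; split=> //; rewrite hE sE mulrAC -exprSr.
Qed.

End Factor.

Section PrimaryCount.

Variables (F : finFieldType) (n : nat).
Local Notation q := #|F|.

Section OneClass.

Variables (p : {poly F}) (d m : nat).
Hypotheses (pI : monic_irreducible_poly p) (sp : size p = d.+1) (dm : (d * m = n.+1)%N).
Local Notation w := (p ^+ m).

Let d_gt0 : (0 < d)%N. Proof. by case: d dm. Qed.
Let m_gt0 : (0 < m)%N. Proof. by case: m dm => //; rewrite muln0. Qed.
Let wm : w \is monic := monic_irredX pI m.
Let sw : size w = n.+2. Proof. by rewrite (size_irredX pI sp) dm. Qed.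

Local Notation M := (mulX_mx w n.+1).

Lemma modp_sum_small (I : finType) (f : I -> {poly F}) : (\sum_i f i) %% w = \sum_i (f i %% w).
Proof. by apply: (big_morph (fun g => g %% w)); [move=> x y; rewrite modpD | rewrite mod0p]. Qed.

Lemma mulX_mx_horner (r : 'rV[F]_n.+1) g :
  r *m horner_mx M g = poly_rV ((rVpoly r * g) %% w).
Proof.
have sm h : (size (h %% w)%R <= n.+1)%N by apply: size_mod.
have step (s : 'rV[F]_n.+1) : s *m M = poly_rV ((rVpoly s * 'X) %% w).
  rewrite mulmx_sum_row; have -> : rVpoly s = \sum_(i < n.+1) s 0 i *: 'X^i.
    rewrite [LHS]poly_def; apply: eq_bigr => i _; rewrite insubT //= => ii.
    by congr (s _ _ *: _); apply: val_inj.
  rewrite mulr_suml modp_sum_small linear_sum; apply: eq_bigr => i _ /=.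
  by rewrite rowK -scalerAl -exprSr modpZl linearZ.
elim/poly_ind: g r => [|g c IH] r.
  by rewrite rmorph0 mulmx0 mulr0 mod0p linear0.
rewrite rmorphD rmorphM /= horner_mx_X horner_mx_C mulmxDr -mulmxE mulmxA IH step.
rewrite poly_rV_K // mulrDr modpD linearD /=.
congr (_ + _); first by congr poly_rV; rewrite mulrA mulrC modp_mul mulrC.
rewrite mul_mx_scalar mulrC mul_polyC modpZl modp_small ?linearZ /= ?rVpolyK //.
by rewrite sw ltnS size_poly.
Qed.

(** The matrix of multiplication by 'X serves as the representative of its class. *)
Lemma mulX_mx_primary : M \in primary_class n p m.
Proof.
apply: (introT (primary_classP pI dm _)) => g; apply/eqP/idP => [Mg|wg].
  have := mulX_mx_horner (poly_rV 1) g; rewrite Mg mulmx0 poly_rV_K ?size_poly1 // mul1r.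
  move=> /(congr1 rVpoly); rewrite linear0 poly_rV_K ?size_mod // => /esym/eqP.
  by [].
apply/row_matrixP=> i; rewrite row0 rowE mulX_mx_horner; apply/eqP.
have /eqP -> : (rVpoly (delta_mx 0 i) * g) %% w == 0 by rewrite -/(w %| _) dvdp_mull.
by rewrite linear0.
Qed.

Lemma card_primary_class :
  (#|primary_class n p m| * (q ^ n.+1 - q ^ (n.+1 - d)) = card_unitmx F n.+1)%N.
Proof.
rewrite (@card_conj_class F n.+1 M (primary_class n p m)); last first.
  move=> y; split=> [yT|[g ug gy]].
    have [v uK] := primary_krylov pI sp dm yT; exists (krylov y n.+1 v) => //.
    apply: krylov_mulX => //; apply/eqP; by move: yT; rewrite inE => /andP[].
  apply: (introT (primary_classP pI dm _)) => h.
  rewrite -(elimT (primary_classP pI dm _) mulX_mx_primary).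
  have := horner_mx_intertwine h gy => E.
  apply/eqP/eqP => h0.
    by apply: (can_inj (mulmxK ug)); rewrite mul0mx mulmxE -E h0 mulr0.
  by apply: (can_inj (mulKmx ug)); rewrite mulmx0 mulmxE E h0 mul0r.
congr muln.
transitivity #|[set c in centralizer M | c \in unitmx]|; last first.
  by apply: eq_card => c; rewrite !inE andbC eq_sym.
rewrite (card_centralizer pI sp dm mulX_mx_primary).
have dn : (d <= n.+1)%N by rewrite -dm leq_pmulr.
have := card_dvdp (n.+1 - d) pI.2 sp; rewrite subnKC // => <-.
rewrite -card_npoly -cardsT -cardsDS ?subsetT //.
apply: eq_card => g; rewrite !inE andbT.
by rewrite (primary_horner_unit pI dm mulX_mx_primary).
Qed.

Section Element.

Variable a : 'M[F]_n.+1.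
Hypothesis aT : a \in primary_class n p m.

Lemma card_centralizer_all : #|centralizer a| = (q ^ n.+1)%N.
Proof.
rewrite -card_npoly -cardsT; have := card_centralizer pI sp dm aT predT.
by have -> : [set c in centralizer a | predT c] = centralizer a by apply/setP=> c; rewrite inE andbT.
Qed.

(** The number of nilpotent elements tells the degree d of the residue field. *)
Lemma card_centralizer_nilpotent :
  #|[set c in centralizer a | c ^+ n.+1 == 0]| = (q ^ (n.+1 - d))%N.
Proof.
rewrite (card_centralizer pI sp dm aT (fun c => c ^+ n.+1 == 0)).
have dn : (d <= n.+1)%N by rewrite -dm leq_pmulr.
have := card_dvdp (n.+1 - d) pI.2 sp; rewrite subnKC // => <-.
apply: eq_card => g; rewrite !inE -rmorphXn /= (elimT (primary_classP pI dm _) aT).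
apply/idP/idP => [wg|pg].
  by rewrite -(irred_dvdpX pI.1 _ (isT : (0 < n.+1)%N)) (dvdp_trans _ wg) // dvdp_exp.
rewrite (dvdp_trans (dvdp_exp2r m pg)) // dvdp_exp2l // -dm leq_pmull //.
Qed.

Lemma card_centralizer_primary p' : monic_irreducible_poly p' -> size p' = d.+1 ->
  #|[set c in centralizer a | c \in primary_class n p' m]| = num_gens F d m.
Proof.
move=> pI' sp'; rewrite (card_centralizer pI sp dm aT) -(card_gens_mod m_gt0 pI sp pI' sp').
suff H N : N = n.+1 -> #|[set g : {poly_n.+1 F} | horner_mx a g \in primary_class n p' m]| =
   #|[set g : {poly_N F} | (p %| p' \Po g) && ((1 < m)%N ==> ~~ (p ^+ 2 %| p' \Po g))]| by exact: H.
move=> ->; apply: eq_card => g; rewrite !inE -!horner_mx_comp_poly !(elimT (primary_classP pI dm _) aT).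
rewrite !rmorphXn /=; set h := p' \Po g.
have -> : (w %| h ^+ m) = (p %| h).
  apply/idP/idP=> [wh|]; last exact: dvdp_exp2r.
  by rewrite -(irred_dvdpX pI.1 h m_gt0) (dvdp_trans _ wh) // dvdp_exp.
have [/dvdpP[k kE]|//] := boolP (p %| h).
case: m m_gt0 => // -[_|m' _] /=; first by rewrite expr0 expr1 dvdp1 (gtn_eqF pI.1.1).
rewrite kE expr2 dvdp_mul2r ?(irredp_neq0 pI.1) // exprMn [p ^+ m'.+2]exprS.
rewrite dvdp_mul2r ?expf_neq0 ?(irredp_neq0 pI.1) //.
by rewrite (irred_dvdpX pI.1 k (isT : (0 < m'.+1)%N)).
Qed.

End Element.

End OneClass.

End PrimaryCount.

(** * The number of local block algebras *)

Section LocalAlgebras.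

Variables (F : finFieldType) (n : nat).
Local Notation q := #|F|.
Implicit Type B : {set 'M[F]_n.+1}.

(** A local block algebra is the centralizer of a matrix whose minimal and
    characteristic polynomials are both equal to a power of an irreducible one. *)
Lemma local_block_algebra_primary B : local_block_algebra B ->
  exists (p : {poly F}) d m a, [/\ monic_irreducible_poly p, size p = d.+1,
    (d * m = n.+1)%N, a \in primary_class n p m & B = centralizer a].
Proof.
move=> /andP[/andP[sB /forallP/(_ 1) /implyP m1] p1].
have /monogenic_atP[a [Ba ua am]] := m1 p1.
have BE : B = centralizer a.
  apply/setP=> b; rewrite inE; apply/idP/eqP => [Bb|ab]; first exact: (subalgC sB Ba Bb).
  by apply: am; rewrite ?mulr1 ?mul1r.
have triv f : f * f = f -> a * f = f * a -> f = 0 \/ f = 1.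
  move=> ff af; case/prim_idemP: p1 => _ _ _; apply; rewrite ?mulr1 //.
  by rewrite BE inE af.
pose mu := mxminpoly a.
have mum : mu \is monic := mxminpoly_monic a.
have mu0 := monic_neq0 mum.
have aw g : (horner_mx a g == 0) = (mu %| g) by rewrite dvd_mxminpoly.
have [|p pI pmu] := @exists_irred_factor F mu.
  by rewrite size_mxminpoly ltnS mxminpoly_nonconstant.
have [m [s [muE nps]]] := irred_multiplicity pI.1 mu0.
have m0 : (0 < m)%N.
  by case: m muE => // muE; rewrite muE mul1r (negPf nps) in pmu.
have /Bezout_eq1_coprimepP[[u v] /= uv] := irred_coprimepX pI.1 m nps.
pose f := horner_mx a (u * p ^+ m).
have f1 : 1 - f = horner_mx a (v * s).
  by rewrite /f -(rmorph1 (horner_mx a)) -rmorphB -uv addrC addKr.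
have ff : f * f = f.
  apply/eqP; rewrite -subr_eq0 -{3}[f]mulr1 -mulrBr -opprB mulrN oppr_eq0 f1 -rmorphM aw.
  by rewrite muE mulrACA dvdp_mull.
have af : a * f = f * a by rewrite /f -{1 4}(horner_mx_X a) -!rmorphM mulrC.
have p_neq0 := irredp_neq0 pI.1.
have muw : mu = p ^+ m.
  have [f0|f1'] := triv f ff af; last first.
    exfalso; have : mu %| v * s by rewrite -aw -f1 f1' subrr.
    move=> mus; have : p ^+ m %| 1.
      rewrite -uv dvdp_add ?dvdp_mulIr //; apply: dvdp_trans mus.
      by rewrite muE dvdp_mulIl.
    by rewrite -(expr0 p) dvdp_Pexp2l ?pI.1.1 // leqNgt m0.
  have smu : s %| 1.
    have mus : mu %| u * p ^+ m by rewrite -aw -/f f0.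
    rewrite -uv dvdp_add ?dvdp_mulIr //.
    by apply: dvdp_trans mus; rewrite muE dvdp_mulIr.
  move: smu; rewrite dvdp1 => /size_poly1P[c c0 sc].
  have : lead_coef mu = 1 by apply/eqP.
  rewrite muE sc lead_coefM lead_coefC (monicP (monic_irredX pI m)) mul1r => ->.
  by rewrite mulr1.
have aw' g : (horner_mx a g == 0) = (p ^+ m %| g) by rewrite aw muw.
pose d := (size p).-1.
have sp : size p = d.+1 by rewrite prednK // ltnW // pI.1.1.
have dm : (d * m)%N = n.+1.
  have wm := monic_irredX pI m.
  exact: (indecomposable_cyclic pI.1 wm (size_irredX pI sp m) aw' m0 triv).
exists p, d, m, a; split=> //.
exact: (introT (primary_classP pI dm _)).
Qed.

(** The local block algebras with residue field of degree d over F, as told by the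
    number of their nilpotent elements. *)
Definition local_of_degree d :=
  [set B in local_block_algebras F n.+1 | #|[set c in B | c ^+ n.+1 == 0]| == (q ^ (n.+1 - d))%N].

Lemma centralizer_of_degree (p : {poly F}) d m a d' :
  monic_irreducible_poly p -> size p = d.+1 -> (d * m = n.+1)%N ->
  a \in primary_class n p m -> (d' <= n.+1)%N ->
  (#|[set c in centralizer a | c ^+ n.+1 == 0]| == (q ^ (n.+1 - d'))%N) = (d' == d).
Proof.
move=> pI sp dm aT d'n; rewrite (card_centralizer_nilpotent pI sp dm aT).
rewrite eqn_exp2l ?finNzRing_gt1 //.
have : (d <= n.+1)%N by rewrite -dm leq_pmulr //; case: m dm {aT} => //; rewrite muln0.
by move=> dn; apply/eqP/eqP; lia.
Qed.

(** Both sides count the pairs of an algebra B and a matrix of B with minimal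
    polynomial p ^ m, for a fixed p of degree d: such a matrix determines B, which is
    its centralizer. *)
Lemma card_local_of_degree d m : (d * m = n.+1)%N ->
  (#|local_of_degree d| * (num_gens F d m * (q ^ n.+1 - q ^ (n.+1 - d))) = card_unitmx F n.+1)%N.
Proof.
move=> dm; have d0 : (0 < d)%N by case: d dm.
have dn : (d <= n.+1)%N by rewrite -dm leq_pmulr //; case: m dm => //; rewrite muln0.
have [p [pI sp p0]] := exists_irred F d0.
rewrite -(card_primary_class pI sp dm) mulnA; congr muln.
have cB B b : B \in local_block_algebras F n.+1 -> b \in B -> b \in primary_class n p m -> B = centralizer b.
  rewrite inE => lB Bb bT; have sB : comm_subalgebra B by case/andP: lB => /andP[].
  have [p' [d' [m' [a [pI' sp' dm' aT BE]]]]] := local_block_algebra_primary lB.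
  apply/eqP; rewrite eqEcard (card_centralizer_all pI sp dm bT) BE.
  rewrite (card_centralizer_all pI' sp' dm' aT) leqnn andbT -BE.
  by apply/subsetP=> c Bc; rewrite inE (subalgC sB Bb Bc).
have lC b : b \in primary_class n p m -> centralizer b \in local_block_algebras F n.+1.
  by move=> bT; rewrite inE (centralizer_local pI sp dm).
have bC (b : 'M[F]_n.+1) : b \in centralizer b by rewrite inE.
have -> : #|primary_class n p m| =
    (\sum_(B in local_block_algebras F n.+1) #|[set b in B | b \in primary_class n p m]|)%N.
  rewrite -sum1_card (partition_big (@centralizer F n) (mem (local_block_algebras F n.+1))) //=.
  apply: eq_bigr => B lB; rewrite sum1dep_card; apply: eq_card => b; rewrite [LHS]inE [RHS]inE.
  apply/andP/andP => [[bT /eqP <-]|[Bb bT]]; first by split=> //; apply: bC.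
  by split=> //; rewrite eq_sym; apply/eqP/cB.
rewrite (bigID (mem (local_of_degree d))) /= [X in (_ + X)%N]big1 ?addn0.
  rewrite -sum_nat_const; apply: eq_big => B.
    by rewrite !inE andbA andbb.
  rewrite inE => /andP[lB]; rewrite inE in lB.
  have [p' [d' [m' [a [pI' sp' dm' aT ->]]]]] := local_block_algebra_primary lB.
  rewrite (centralizer_of_degree pI' sp' dm' aT dn) => /eqP dd'; rewrite -dd' in sp' dm'.
  have mm' : m' = m by apply/eqP; rewrite -(eqn_pmul2l d0) dm' dm.
  by rewrite mm' in dm' aT; rewrite (card_centralizer_primary pI' sp' dm' aT pI sp).
move=> B /andP[lB nB]; apply: eq_card0 => b; rewrite inE; apply/negP => /andP[Bb bT].
move: nB; rewrite inE lB /= (cB B b lB Bb bT).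
by rewrite (centralizer_of_degree pI sp dm bT dn) eqxx.
Qed.

Lemma card_local_block_algebras :
  #|local_block_algebras F n.+1| = (\sum_(d < n.+2 | (d %| n.+1)%N) #|local_of_degree d|)%N.
Proof.
have -> : #|local_block_algebras F n.+1| =
  (\sum_(B in local_block_algebras F n.+1) \sum_(d < n.+2 | (d %| n.+1)%N) (B \in local_of_degree d))%N.
  rewrite -sum1_card; apply: eq_bigr => B lB; move: (lB); rewrite inE => lB'.
  have [p [d [m [a [pI sp dm aT BE]]]]] := local_block_algebra_primary lB'.
  have dn : (d < n.+2)%N by rewrite ltnS -dm leq_pmulr //; case: m dm {aT} => //; rewrite muln0.
  have dv : (d %| n.+1)%N by rewrite -dm dvdn_mulr.
  rewrite (bigD1 (Ordinal dn)) //= big1 ?addn0.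
    by rewrite inE lB BE (centralizer_of_degree pI sp dm aT) // eqxx.
  move=> i /andP[_ id]; have iN : (i <= n.+1)%N by rewrite -ltnS.
  rewrite inE lB BE (centralizer_of_degree pI sp dm aT iN).
  by rewrite (_ : (i == d :> nat) = false) //; apply/negbTE.
rewrite exchange_big; apply: eq_bigr => d _ /=.
rewrite -sum1_card big_mkcond [RHS]big_mkcond; apply: eq_bigr => B _.
by rewrite [B \in local_of_degree d]inE; case: (B \in _); case: (_ == _).
Qed.

End LocalAlgebras.

(** * Idempotent systems in the general linear group *)

Section IdempotentSystem.

Variables (F : finFieldType) (m r : nat).
Local Notation n := m.+1.
Local Notation GL := {'GL_n[F]}.
Implicit Types (g x y : GL).

Local Notation mx g := (GLval g : 'M[F]_n).

Lemma GLval_inj : injective (fun g : GL => mx g).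
Proof. exact: val_inj. Qed.

Lemma GL_of_unit (a : 'M[F]_n) : a \in unitmx -> exists g : GL, mx g = a.
Proof. by move=> ua; exists (Sub a ua). Qed.

(* A complete system of orthogonal idempotents, with their row spaces V. *)
Variables (e V : 'I_r -> 'M[F]_n).
Hypothesis ee : forall i, e i * e i = e i.
Hypothesis eo : forall i j, i != j -> e i * e j = 0.
Hypothesis e1 : \sum_i e i = 1.
Hypothesis Ve : forall i, (V i :=: e i)%MS.

Lemma idem_system_ext (a b : 'M[F]_n) : (forall i, e i * a = e i * b) -> a = b.
Proof.
by move=> ab; rewrite -[a]mul1r -[b]mul1r -e1 !mulr_suml; apply: eq_bigr => i _; apply: ab.
Qed.

Lemma idem_system_comm (a : 'M[F]_n) :
  (forall i, (e i *m a <= e i)%MS) -> forall i, a * e i = e i * a.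
Proof.
move=> ea i.
have eE j : e j * a * e j = e j * a.
  by have /submxP[u uE] := ea j; rewrite (uE : e j * a = u * e j) -mulrA ee.
have eO j k : j != k -> e j * a * e k = 0.
  move=> jk; have /submxP[u uE] := ea j; rewrite (uE : e j * a = u * e j).
  by rewrite -mulrA eo // mulr0.
apply: idem_system_ext => j; rewrite mulrA.
have [->|ji] := eqVneq j i; first by rewrite eE mulrA ee.
by rewrite eO // mulrA eo // mul0r.
Qed.

(** Being in GL(V_i) means being the identity on the other summands and commuting with
    the projection e_i. *)
Lemma GL_summandP i x :
  reflect ((forall j, j != i -> e j * mx x = e j) /\ mx x * e i = e i * mx x)
          (x \in GL_summand V i).
Proof.
apply: (iffP idP).
  rewrite inE => /andP[+ /bigcapP xV]; rewrite inE => /andP[_ xi].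
  have xj j : j != i -> e j * mx x = e j.
    move=> ji; have := rstab_act (xV j ji); apply.
    by rewrite Ve.
  split=> //; apply: idem_system_comm => j.
  have [->|ji] := eqVneq j i; last by rewrite -[e j *m _]/(e j * _) xj.
  by rewrite -(eqmxMr _ (Ve i)) -(Ve i).
move=> [xj xi]; rewrite inE; apply/andP; split.
  rewrite inE in_setT /= (Ve i) (eqmxMr _ (Ve i)).
  by rewrite -[e i *m _]/(e i * mx x) -xi submxMl.
apply/bigcapP=> j ji; rewrite inE in_setT /=; apply/eqP.
have /submxP[u ->] : (V j <= e j)%MS by rewrite Ve.
by rewrite -mulmxA -[e j *m _]/(e j * mx x) xj.
Qed.

Lemma GL_summand_comm i x : x \in GL_summand V i -> forall j, mx x * e j = e j * mx x.
Proof.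
move=> /GL_summandP[xj xi]; apply: idem_system_comm => j.
have [->|ji] := eqVneq j i; last by rewrite -[e j *m _]/(e j * _) xj.
by rewrite -[e i *m _]/(e i * mx x) -xi submxMl.
Qed.

(** The component in GL(V_i) of an invertible matrix that commutes with e_i. *)
Lemma GL_summand_cut i (a : 'M[F]_n) : a \in unitmx -> a * e i = e i * a ->
  exists2 x : GL, mx x = e i * a + (1 - e i) & x \in GL_summand V i.
Proof.
move=> ua ai.
have ai' : invmx a * e i = e i * invmx a.
  apply: (can_inj (mulKmx ua)); rewrite !mulmxE !mulrA ai mulmxVr // mul1r.
  by rewrite -mulrA mulmxVr // mulr1.
have iI : (1 - e i) * e i = 0 by rewrite mulrBl mul1r ee subrr.
have Ii : e i * (1 - e i) = 0 by rewrite mulrBr mulr1 ee subrr.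
have II : (1 - e i) * (1 - e i) = 1 - e i by rewrite mulrBr mulr1 iI subr0.
have u : e i * a + (1 - e i) \in unitmx.
  apply: (proj1 (@mulmx1_unit _ _ _ (e i * invmx a + (1 - e i)) _)).
  have P1 : e i * a * (e i * invmx a) = e i.
    by rewrite -ai' !mulrA -(mulrA (e i) a) mulmxVr // mulr1 ee.
  have P2 : (1 - e i) * (e i * invmx a) = 0 by rewrite mulrA iI mul0r.
  have P3 : e i * a * (1 - e i) = 0 by rewrite -ai -mulrA Ii mulr0.
  by rewrite mulmxE mulrDl !(mulrDr _ (e i * invmx a)) II P1 P2 P3 add0r addr0 addrC subrK.
have [x xE] := GL_of_unit u; exists x => //; apply/GL_summandP; rewrite xE; split.
  by move=> j ji; rewrite mulrDr mulrA eo // mul0r add0r mulrBr mulr1 eo // subr0.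
by rewrite mulrDl mulrDr iI Ii !addr0 -ai -mulrA ee mulrA -ai -mulrA ee.
Qed.

Lemma GL_system_prod g (h : 'I_r -> GL) :
  (forall i, mx g * e i = e i * mx g) ->
  (forall i, mx (h i) = e i * mx g + (1 - e i)) ->
  (\prod_i h i)%g = g.
Proof.
move=> ge hE; apply: GLval_inj; apply: idem_system_ext => l.
have eh i : e l * mx (h i) = if i == l then e l * mx g else e l.
  rewrite hE mulrDr mulrBr mulr1 mulrA; have [->|il] := eqVneq i l.
    by rewrite ee subrr addr0.
  by rewrite eo 1?eq_sym // mul0r add0r subr0.
have H (s : seq 'I_r) : uniq s ->
    e l * mx (\prod_(i <- s) h i)%g = if l \in s then e l * mx g else e l.
  elim: s => [|i s IH] /=; first by rewrite big_nil mulr1.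
  case/andP=> nis us; rewrite big_cons in_cons GL_ME mulrA eh [l == i]eq_sym.
  case: eqP => [il|_] /=; last by rewrite IH.
  by rewrite il in nis; rewrite -ge -mulrA IH // (negPf nis) ge.
by have := H _ (index_enum_uniq 'I_r); rewrite mem_index_enum.
Qed.

Lemma GL_summands_commute i j x y : i != j ->
  x \in GL_summand V i -> y \in GL_summand V j -> mx x * mx y = mx y * mx x.
Proof.
move=> ij xi yj; have [xe _] := elimT (GL_summandP _ _) xi.
have [ye _] := elimT (GL_summandP _ _) yj.
have cx := GL_summand_comm xi; have cy := GL_summand_comm yj.
apply: idem_system_ext => l; rewrite !mulrA.
have [->|li] := eqVneq l i; last first.
  rewrite (xe l li); have [->|lj] := eqVneq l j.
    by rewrite -cy -mulrA xe // eq_sym.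
  by rewrite ye // xe.
by rewrite -cx -mulrA (ye i ij) // (ye i ij) cx.
Qed.

(** A group G of matrices commuting with the e_i is the direct product of the B_i as
    soon as B_i contains the component in GL(V_i) of each element of G. *)
Lemma GL_summands_dprod (B : 'I_r -> {group GL}) (G : {group GL}) :
  (forall i, B i \subset G) -> (forall i, B i \subset GL_summand V i) ->
  (forall g, g \in G -> forall i, mx g * e i = e i * mx g) ->
  (forall g i, g \in G -> exists2 x : GL, mx x = e i * mx g + (1 - e i) & x \in B i) ->
  (\big[dprod/1]_(i < r) B i)%g = G.
Proof.
move=> BG BV Ge Gx.
have GE : (\prod_(i < r) B i)%G = G.
  apply/val_inj/eqP; rewrite /= eqEsubset; apply/andP; split.
    by rewrite bigprodGE gen_subG; apply/bigcupsP.
  apply/subsetP=> g gG.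
  have hP i : exists x : GL, (mx x == e i * mx g + (1 - e i)) && (x \in B i).
    by have [x xE xB] := Gx g i gG; exists x; rewrite xE eqxx.
  pose h i := xchoose (hP i).
  have hB i : mx (h i) = e i * mx g + (1 - e i) /\ h i \in B i.
    by have /andP[/eqP ? ?] := xchooseP (hP i).
  rewrite -(GL_system_prod (h := h) (Ge g gG)); last by move=> i; case: (hB i).
  apply: group_prod => i _; rewrite bigprodGE; apply: mem_gen.
  by apply/bigcupP; exists i => //; case: (hB i).
rewrite -{}GE; apply/eqP/bigdprodYP => i _; rewrite bigprodGE.
set H := <<_>>%g.
have Hst : H \subset rstab (GLrepr F m) (V i).
  rewrite gen_subG; apply/bigcupsP=> j /= ji; apply: subset_trans (BV j) _.
  by rewrite /= subIset // (bigcap_inf i) ?orbT // eq_sym.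
have Hc : (H \subset 'C(B i))%g.
  rewrite gen_subG; apply/bigcupsP=> j /= ji; apply/centsP => x xj y yi; apply: GLval_inj.
  by apply: GL_summands_commute ji _ _; apply: (subsetP (BV _)).
rewrite subsetD Hc /= disjoint_sym; apply/pred0P=> x /=; apply/negbTE/negP.
rewrite !inE => /andP[/andP[x1 xB] xH]; case/negP: x1; apply/eqP/GLval_inj.
apply: idem_system_ext => l; rewrite GL_1E mulr1.
have [xe _] := elimT (GL_summandP _ _) (subsetP (BV i) _ xB).
have [->|li] := eqVneq l i; last exact: xe.
by apply: rstab_act (subsetP Hst _ xH) _; rewrite Ve.
Qed.

End IdempotentSystem.

(** * From abelian groups to block algebras *)

Section Fitting.

Variables (F : finFieldType) (m : nat).
Local Notation n := m.+1.
Implicit Types (x e : 'M[F]_n).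

(** The sequence of the powers of x is ultimately periodic. *)
Lemma idem_power x : exists2 N, (0 < N)%N & x ^+ N * x ^+ N = x ^+ N.
Proof.
pose f (i : 'I_(#|{: 'M[F]_n}|.+1)) := x ^+ i.
have /injectivePn[i [j ij fij]] : ~~ injectiveb f.
  apply/negP => /injectiveP f_inj; have := max_card (mem (codom f)).
  by rewrite card_codom // card_ord ltnn.
wlog lt_ij : i j ij fij / (i < j)%N.
  move=> W; have := ij; rewrite neq_ltn => /orP[|] h; first exact: (W i j).
  by apply: (W j i) => //; rewrite eq_sym.
pose t := (j - i)%N.
have t0 : (0 < t)%N by rewrite subn_gt0.
have st a k : x ^+ (i + a + k * t) = x ^+ (i + a).
  elim: k => [|k IH]; first by rewrite addn0.
  rewrite mulSn [(t + _)%N]addnC addnA -IH -[in RHS]addnA [(a + _)%N]addnC.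
  rewrite (_ : i + a + k * t + t = j + (k * t + a))%N; last by rewrite /t; lia.
  by rewrite !exprD -[x ^+ j]fij.
exists (t * i.+1)%N; first by rewrite muln_gt0 t0.
have E : (t * i.+1 = i + (t * i.+1 - i))%N by rewrite /t; nia.
by rewrite -exprD {1 3}E [(t * i.+1)%N in X in (_ + X)%N]mulnC st.
Qed.

(** In the local algebra with unit e, the element x is invertible or nilpotent. So x
    becomes an invertible matrix after adding 1 - e or 1. *)
Lemma local_unit_or_unit1 e x : e * e = e -> x * e = x -> e * x = x ->
  (forall N, (0 < N)%N -> x ^+ N * x ^+ N = x ^+ N -> x ^+ N = 0 \/ x ^+ N = e) ->
  x + (1 - e) \in unitmx \/ x + 1 \in unitmx.
Proof.
move=> ee xe ex loc; have [N N0 xN] := idem_power x.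
have [x0|x1] := loc N N0 xN; [right | left].
  have : (- x) ^+ N = 0 by rewrite exprNn x0 mulr0.
  move=> nx; have := subrX1 (- x) N; rewrite nx sub0r -opprD mulNr => /oppr_inj/esym.
  by move=> /mulmx1_unit[].
have EI : (1 - e) * (1 - e) = 1 - e by rewrite mulrBr mulr1 mulrBl mul1r ee subrr subr0.
have xE : x * (1 - e) = 0 by rewrite mulrBr mulr1 xe subrr.
have Ex : (1 - e) * x = 0 by rewrite mulrBl mul1r ex subrr.
have pw k : (x + (1 - e)) ^+ k.+1 = x ^+ k.+1 + (1 - e).
  elim: k => [//|k IH]; rewrite exprS IH mulrDl !(mulrDr _ (x ^+ k.+1)) EI -exprS.
  by rewrite xE addr0 [x ^+ k.+1]exprS mulrA Ex mul0r add0r.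
have : (x + (1 - e)) ^+ N \in unitmx.
  by rewrite -(prednK N0) pw (prednK N0) x1 addrC subrK unitmx1.
by rewrite -[_ \in unitmx]/(_ \is a GRing.unit) unitrX_pos.
Qed.

End Fitting.

Section UnitGroup.

Variables (F : finFieldType) (m : nat).
Local Notation n := m.+1.
Local Notation GL := {'GL_n[F]}.
Local Notation mx g := (GLval g : 'M[F]_n).

Definition unit_set (B : {set 'M[F]_n}) : {set GL} := [set g : GL | mx g \in B].

(** The group of units of an algebra of matrices. The units of a subalgebra are closed
    under products already, and taking the generated group makes sense for any set. *)
Definition unit_group (B : {set 'M[F]_n}) : {group GL} := <<unit_set B>>%G.

Lemma mem_unit_group (B : {set 'M[F]_n}) : 1 \in B -> (forall x y, x \in B -> y \in B -> x * y \in B) ->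
  forall g : GL, (g \in unit_group B) = (mx g \in B).
Proof.
move=> B1 BM g; rewrite /= gen_set_id ?inE //; apply/group_setP; split.
  by rewrite inE GL_1E.
by move=> x y; rewrite !inE GL_ME; apply: BM.
Qed.

End UnitGroup.

Section FamilyToAlgebra.

Variables (F : finFieldType) (m : nat).
Local Notation n := m.+1.
Local Notation GL := {'GL_n[F]}.
Local Notation mx g := (GLval g : 'M[F]_n).

(** An indecomposable module has no nontrivial idempotent endomorphism. *)
Lemma mxindecomposable_idem (a : GL) (V e f : 'M[F]_n) :
  (V :=: e)%MS -> e * e = e -> mxindecomposable (natural_repr <[a]>%G) V ->
  f * f = f -> e * f = f -> f * e = f -> f * mx a = mx a * f ->
  e * mx a = mx a * e -> f = 0 \/ f = e.
Proof.
move=> Ve ee [_ V0 nW] ff ef fe fa ea.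
have [->|f0] := eqVneq f 0; first by left.
have [->|fne] := eqVneq f e; first by right.
case: nW; exists f, (e - f).
have mod h : h * mx a = mx a * h -> mxmodule (natural_repr <[a]>%G) h.
  move=> ha; apply/mxmoduleP => _ /cycleP[k ->].
  suff /(_ k) hk : forall k, h * mx (a ^+ k)%g = mx (a ^+ k)%g * h.
    by rewrite /= -[h *m _]/(h * _) hk; exact: submxMl.
  elim=> [|i IH]; first by rewrite expg0 GL_1E mulr1 mul1r.
  by rewrite expgS GL_ME mulrA ha -mulrA IH mulrA.
have gf : (e - f) * f = 0 by rewrite mulrBl ef ff subrr.
have fg : f * (e - f) = 0 by rewrite mulrBr fe ff subrr.
split.
- by split=> //; apply: mod.
- by split; [apply: mod; rewrite mulrBl mulrBr fa ea | rewrite subr_eq0 eq_sym].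
- apply/mxdirect_addsP/eqP; rewrite -submx0; apply/rV_subP=> v.
  rewrite sub_capmx => /andP[/submxP[u vu] /submxP[w vw]].
  have : v *m f = v by rewrite vu -mulmxA [f *m f]ff.
  by rewrite vw -mulmxA [_ *m f]gf mulmx0 => <-; rewrite sub0mx.
apply/andP; split; rewrite Ve.
  rewrite addsmx_sub; apply/andP; split; first by rewrite -fe submxMl.
  have <- : (e - f) * e = e - f by rewrite mulrBl ee fe.
  exact: submxMl.
have {1}-> : e = f + (e - f) by rewrite addrC subrK.
exact: addmx_sub_adds.
Qed.

(** The algebra is made of the matrices that commute with the projections e_i onto the
    summands and with the generators a_i. *)
Lemma abelian_family_algebra (A : {group GL}) : in_abelian_family A ->
  exists2 B : {set 'M[F]_n}, block_algebra B & unit_group B = A.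
Proof.
case=> abA [r [V [Bg [[dV sV] indV defA aP]]]].
pose e i := proj_mx (V i) (\sum_(j < r | j != i) V j)%MS.
have dxV i : (V i :&: (\sum_(j < r | j != i) V j)%MS = 0)%MS.
  by have /mxdirect_sumsP := dV; apply.
have Vid i p (W : 'M_(p, n)) : (W <= V i)%MS -> W *m e i = W.
  by move=> sW; rewrite proj_mx_id.
have V0 i j p (W : 'M_(p, n)) : i != j -> (W <= V i)%MS -> W *m e j = 0.
  move=> ij sW; rewrite proj_mx_0 //; apply: submx_trans sW _.
  by rewrite (sumsmx_sup i).
have eV i : (e i <= V i)%MS by rewrite -[e i]mul1mx proj_mx_sub.
have ee i : e i * e i = e i by apply: Vid.
have eo i j : i != j -> e i * e j = 0 by move=> ij; apply: V0 (eV i).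
have e1 : \sum_i e i = 1.
  have /sub_sumsmxP[u uE] : (1%:M <= \sum_(i < r) V i)%MS by case/andP: sV.
  rewrite -[LHS]mul1r [X in X * _ = _](uE) mulr_sumr [RHS](uE : 1 = _).
  apply: eq_bigr => i _; rewrite mulr_suml (bigD1 i) //= big1 ?addr0.
    by rewrite -mulmxE -mulmxA Vid.
  by move=> j ji; rewrite -mulmxE -mulmxA (V0 j i) // mulmx0.
have Ve i : (V i :=: e i)%MS.
  by apply/eqmxP; rewrite eV andbT -{1}(Vid i _ _ (submx_refl _)) submxMl.
have /fin_all_exists[a aS] i : exists a : GL, [/\ a \in GL_summand V i,
     Bg i :=: ('C_(GL_summand V i)[a])%g & mxindecomposable (natural_repr <[a]>%G) (V i)] by exact: aP.
have sumP i x := GL_summandP ee eo e1 Ve i x.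
have ae i j : mx (a i) * e j = e j * mx (a i).
  by case: (aS i) => ai _ _; apply: (GL_summand_comm ee eo e1 Ve ai).
pose B := [set b : 'M[F]_n | [forall i, (e i * b == b * e i) && (mx (a i) * b == b * mx (a i))]].
have BP b : reflect (forall i, e i * b = b * e i /\ mx (a i) * b = b * mx (a i)) (b \in B).
  rewrite inE; apply: (iffP forallP) => bP i; have := bP i.
    by move=> /andP[/eqP ? /eqP ?].
  by case=> -> ->; rewrite !eqxx.
have B1 : 1 \in B by apply/BP => i; rewrite !mulr1 !mul1r.
have BM x y : x \in B -> y \in B -> x * y \in B.
  move=> /BP xB /BP yB; apply/BP => i; have [x1 x2] := xB i; have [y1 y2] := yB i.
  by rewrite !mulrA x1 x2 -!mulrA y1 y2.
have BL (c : F) x y : x \in B -> y \in B -> c *: x + y \in B.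
  move=> /BP xB /BP yB; apply/BP => i; have [x1 x2] := xB i; have [y1 y2] := yB i.
  by rewrite !mulrDr !mulrDl y1 y2 -!scalerAr -!scalerAl x1 x2.
have memU := mem_unit_group B1 BM.
have eqv (y z : GL) : mx y * mx z = mx z * mx y -> (y * z = z * y)%g.
  by move=> yz; apply: GLval_inj.
have BgB i : Bg i \subset unit_group B.
  apply/subsetP => x xi; rewrite memU; apply/BP => j.
  have [ai BE _] := aS i; have [aj _ _] := aS j.
  move: xi; rewrite BE inE => /andP[xi /cent1P xa].
  split; first by rewrite (GL_summand_comm ee eo e1 Ve xi).
  have [->|ji] := eqVneq j i; first by have := congr1 (fun z : GL => mx z) xa.
  exact: (GL_summands_commute ee eo e1 Ve ji aj xi).
have AE : unit_group B = A.
  apply/val_inj/eqP; rewrite eqEsubset; apply/andP; split; last first.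
    by rewrite /= -(bigdprodWY defA) gen_subG; apply/bigcupsP => i _; apply: BgB.
  apply/subsetP => g; rewrite memU => /BP gB.
  have hP i : exists2 x : GL, mx x = e i * mx g + (1 - e i) & x \in Bg i.
    have ge : mx g * e i = e i * mx g by case: (gB i).
    have [x xE xS] := GL_summand_cut ee eo e1 Ve (GL_unitmx g : mx g \in unitmx) ge.
    exists x => //; have [_ -> _] := aS i; rewrite inE xS; apply/cent1P.
    apply: eqv; rewrite xE.
    have aE : mx (a i) * (1 - e i) = (1 - e i) * mx (a i).
      by rewrite mulrBr mulrBl mulr1 mul1r ae.
    have aeg : mx (a i) * (e i * mx g) = e i * mx g * mx (a i).
      by rewrite mulrA ae -!mulrA; have [_ ->] := gB i.
    by rewrite mulrDr mulrDl aE aeg.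
  have /fin_all_exists2[h hE hB] := hP.
  rewrite -(GL_system_prod ee eo e1 (h := h) (g := g) _ hE); last by move=> i; case: (gB i).
  apply: group_prod => i _; rewrite -(bigdprodWY defA); apply: mem_gen.
  by apply/bigcupP; exists i => //; exact: hB.
exists B => //.
have BN x : x \in B -> - x \in B.
  by move=> xB; rewrite -[- x]addr0 -scaleN1r BL // -[0](addNr 1) -scaleN1r BL.
have BD x y : x \in B -> y \in B -> x + y \in B.
  by move=> xB yB; rewrite -[x]scale1r BL.
have Be i : e i \in B.
  apply/BP => j; split; last by rewrite ae.
  by have [->|ij] := eqVneq i j; rewrite // !eo // eq_sym.
have Bc x i : x \in B -> e i * x = x * e i by move=> /BP xB; case: (xB i).
have loc i f : f \in B -> f * f = f -> f * e i = f -> f = 0 \/ f = e i.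
  move=> fB ff fe; have [_ _ ind] := aS i; have [f1 f2] := elimT (BP f) fB i.
  have ef : e i * f = f by rewrite f1.
  exact: (mxindecomposable_idem (Ve i) (ee i) ind ff ef fe (esym f2) (esym (ae i i))).
have BX x k : x \in B -> x ^+ k \in B.
  by move=> xB; elim: k => [|k IH]; rewrite ?expr0 // exprS BM.
have unitz i x : x \in B -> exists2 z, e i * x + z \in unitmx & z \in B /\ {in B, forall y, z * y = y * z}.
  move=> xB; have xB' : e i * x \in B by rewrite BM.
  have [|||u|u] := @local_unit_or_unit1 F m (e i) (e i * x) (ee i).
  - by rewrite -mulrA -Bc // mulrA ee.
  - by rewrite mulrA ee.
  - move=> N N0 xN; apply: loc => //; first exact: BX.
    by case: N N0 {xN} => // N _; rewrite exprSr -!mulrA -Bc // (mulrA (e i)) ee.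
  - exists (1 - e i) => //; split; first by rewrite BD ?BN.
    by move=> y yB; rewrite mulrBl mulrBr mul1r mulr1 Bc.
  by exists 1 => //; split=> // y _; rewrite mulr1 mul1r.
(* Adding to e_i x and e_i y suitable elements that commute with all of B makes them
   units, and units commute since A is abelian. *)
have Bcomm x y : x \in B -> y \in B -> x * y = y * x.
  move=> xB yB; apply: (idem_system_ext e1) => i.
  have eM u v : v \in B -> u \in B -> e i * (u * v) = e i * u * (e i * v).
    by move=> vB uB; rewrite [RHS]mulrA -(mulrA (e i) u) -(Bc u) // (mulrA (e i) (e i)) ee mulrA.
  rewrite !eM //; set x' := e i * x; set y' := e i * y.
  have [xB' yB'] : x' \in B /\ y' \in B by rewrite !BM.
  have [z uz [zB zc]] := unitz i x xB; have [w uw [wB wc]] := unitz i y yB.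
  have [g gE] := GL_of_unit uz; have [h hE] := GL_of_unit uw.
  have gA : g \in A by rewrite -AE memU gE BD.
  have hA : h \in A by rewrite -AE memU hE BD.
  have := congr1 (fun k : GL => mx k) (centsP abA g gA h hA).
  rewrite -[mx (g * h)%g]/(mx g * mx h) -[mx (h * g)%g]/(mx h * mx g) gE hE.
  rewrite -/x' -/y' !mulrDl !mulrDr (zc y') // (zc w) // -(wc x') // => E.
  by have := etrans E (addrACA _ _ _ _) => /addIr/addIr.
have sB : comm_subalgebra B by apply/comm_subalgebraP; split.
rewrite /block_algebra sB; apply/forallP => f; apply/implyP => /prim_idemP[fB ff f0 fm].
have /existsP[i fi] : [exists i, f * e i != 0].
  apply: contraR f0 => /existsPn fe; rewrite -[f]mulr1 -e1 mulr_sumr big1 // => i _.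
  by apply/eqP; have := fe i; rewrite negbK.
have fei : f * e i = f.
  case: (fm (f * e i)) => //; first by rewrite BM.
  - by rewrite -mulrA (mulrA (e i)) Bc // -mulrA ee mulrA ff.
  - by rewrite -mulrA Bc // mulrA ff.
  by move/eqP; rewrite (negPf fi).
have -> : f = e i by case: (loc i f fB ff fei) => // f0'; rewrite f0' eqxx in f0.
have [ai _ _] := aS i.
apply/monogenic_atP; exists (mx (a i)); split; last 1 first.
- move=> b be eb ab; apply/BP => j.
  have [->|ji] := eqVneq j i; first by rewrite be eb.
  have [ja _] := elimT (sumP j (a j)) (let: And3 h _ _ := aS j in h).
  have ij : i != j by rewrite eq_sym.
  have jb : e j * b = 0 by rewrite -eb mulrA eo // mul0r.
  have bj : b * e j = 0 by rewrite -be -mulrA eo // mulr0.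
  split; first by rewrite jb bj.
  have -> : mx (a j) * b = b by rewrite -[in LHS]eb mulrA ae ja // eb.
  by rewrite -[in RHS]be -mulrA ja.
- apply/BP => j; split; first by rewrite ae.
  have [->//|ji] := eqVneq j i; have [aj _ _] := aS j.
  exact: (GL_summands_commute ee eo e1 Ve ji aj ai).
exact: (GL_unitmx (a i)).
Qed.

End FamilyToAlgebra.

(** * From block algebras to abelian groups *)

Section AlgebraToFamily.

Variables (F : finFieldType) (m : nat).
Local Notation n := m.+1.
Local Notation GL := {'GL_n[F]}.
Local Notation mx g := (GLval g : 'M[F]_n).
Implicit Type B : {set 'M[F]_n}.

Lemma mem_unit_group_alg B (g : GL) : comm_subalgebra B -> (g \in unit_group B) = (mx g \in B).
Proof. by case/comm_subalgebraP=> B1 _ BM _; apply: mem_unit_group. Qed.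

(** A decomposition of the image of e into submodules gives an idempotent below e that
    commutes with a. *)
Lemma idem_mxindecomposable (G : {group GL}) (a : GL) (e : 'M[F]_n) :
  a \in G -> mxmodule (natural_repr G) e -> e != 0 -> e * e = e -> mx a * e = e * mx a ->
  (forall f, f * f = f -> e * f = f -> f * e = f -> f * mx a = mx a * f -> f = 0 \/ f = e) ->
  mxindecomposable (natural_repr G) e.
Proof.
move=> aG modE e0 ee ae triv; split=> // -[W1 [W2 [[mW1 W10] [mW2 W20] dW sW]]].
have dxW : (W1 :&: W2 = 0)%MS by apply/mxdirect_addsP.
have [W1e W2e] : (W1 <= e)%MS /\ (W2 <= e)%MS.
  by apply/andP; rewrite -addsmx_sub; case/andP: sW.
have E1 : W1 *m e = W1 by have /submxP[u ->] := W1e; rewrite -mulmxA [e *m e]ee.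
have E2 : W2 *m e = W2 by have /submxP[u ->] := W2e; rewrite -mulmxA [e *m e]ee.
pose P := proj_mx W1 W2; pose f := e * P.
have P1 k (u : 'M[F]_(k, n)) : (u <= W1)%MS -> u *m P = u by apply: proj_mx_id.
have P2 k (u : 'M[F]_(k, n)) : (u <= W2)%MS -> u *m P = 0 by apply: proj_mx_0.
have fW : (f <= W1)%MS by apply: proj_mx_sub.
have fe : f * e = f by have /submxP[u uE] := fW; rewrite uE -[u *m W1 * e]/(u *m W1 *m e) -mulmxA E1.
have ef : e * f = f by rewrite /f mulrA ee.
have ff : f * f = f by rewrite {2}/f mulrA fe; apply: P1 fW.
have fa : f * mx a = mx a * f.
  have /sub_addsmxP[[u1 u2] /= eE] : (e <= W1 + W2)%MS by case/andP: sW.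
  have s1 : (u1 *m W1 *m mx a <= W1)%MS.
    by rewrite -mulmxA mulmx_sub //; have /mxmoduleP := mW1; apply.
  have s2 : (u2 *m W2 *m mx a <= W2)%MS.
    by rewrite -mulmxA mulmx_sub //; have /mxmoduleP := mW2; apply.
  have -> : mx a * f = e *m mx a *m P by rewrite /f mulrA ae.
  have -> : f = u1 *m W1.
    by rewrite /f {1}eE -mulmxE mulmxDl P1 ?P2 ?submxMl // addr0.
  by rewrite eE !mulmxDl (P1 _ _ s1) (P2 _ _ s2) addr0.
case: (triv f ff ef fe fa) => fE.
  case/eqP: W10; rewrite -(P1 _ _ (submx_refl W1)) -{1}E1 -mulmxA.
  by rewrite -[e *m P]/f fE mulmx0.
case/eqP: W20; rewrite -E2 -fE -[f]/(e *m P) mulmxA E2.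
exact: P2.
Qed.

(** The summands are the images of the primitive idempotents of B. *)
Lemma algebra_abelian_family B : block_algebra B -> in_abelian_family (unit_group B).
Proof.
move=> /andP[sB /forallP mB]; have memU := mem_unit_group_alg _ sB.
have BC := subalgC sB.
split.
  apply/centsP => x xB y yB; apply: GLval_inj.
  by rewrite memU in xB; rewrite memU in yB; exact: (BC _ _ xB yB).
pose P := [set f | prim_idem B f]; pose r := #|P|; pose e (i : 'I_r) : 'M[F]_n := enum_val i.
have pe i : prim_idem B (e i) by have := enum_valP i; rewrite inE.
have Be i : e i \in B by case/prim_idemP: (pe i).
have ee i : e i * e i = e i by case/prim_idemP: (pe i).
have e_neq0 i : e i != 0 by case/prim_idemP: (pe i).
have eo i j : i != j -> e i * e j = 0.
  by move=> ij; rewrite (prim_idem_ortho sB) //; apply: contra ij => /eqP/enum_val_inj ->.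
have e1 : \sum_i e i = 1.
  transitivity (\sum_(f in P) f); first by rewrite (big_enum_val (fun f : 'M[F]_n => f)).
  by rewrite -(prim_idem_sum sB); apply: eq_bigl => f; rewrite inE.
have Ve i : (e i :=: e i)%MS by [].
have aP i : exists a, [/\ a \in B, a \in unitmx
     & forall b, b * e i = b -> e i * b = b -> a * b = b * a -> b \in B].
  by apply/monogenic_atP; have /implyP := mB (e i); apply.
have /fin_all_exists[a0 a0P] := aP.
have cutP i : exists2 x : GL, mx x = e i * a0 i + (1 - e i) & x \in GL_summand e i.
  have [Ba ua _] := a0P i.
  by apply: (GL_summand_cut ee eo e1 Ve ua); apply: BC.
have /fin_all_exists2[a aE aS] := cutP.
have aB i : mx (a i) \in B.
  have [Ba _ _] := a0P i; rewrite aE.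
  by rewrite (subalgD sB) ?(subalgM sB) ?(subalgB sB) ?(subalg1 sB).
have max i b : b * e i = b -> e i * b = b -> mx (a i) * b = b * mx (a i) -> b \in B.
  move=> be eb ab; have [Ba _ am] := a0P i; apply: am => //.
  have -> : a0 i * b = mx (a i) * b.
    rewrite aE mulrDl mulrBl mul1r eb subrr addr0 -{1}eb mulrA.
    by rewrite (BC _ _ Ba (Be i)).
  have -> : b * a0 i = b * mx (a i); last by [].
  by rewrite aE mulrDr mulrBr mulr1 be subrr addr0 mulrA be.
have triv i f : f * f = f -> e i * f = f -> f * e i = f ->
    f * mx (a i) = mx (a i) * f -> f = 0 \/ f = e i.
  move=> ff ef fe fa; have Bf : f \in B by exact: (max i f fe ef (esym fa)).
  by case/prim_idemP: (pe i) => _ _ _; apply.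
have ind (G : {group GL}) i : a i \in G -> (forall g, g \in G -> mx g \in B) ->
    mxindecomposable (natural_repr G) (e i).
  move=> aG GB; apply: (idem_mxindecomposable aG) => //; last exact: triv.
    apply/mxmoduleP=> g gG; rewrite -[e i *m _]/(e i * mx g) BC ?GB //.
    exact: submxMl.
  exact: BC.
pose C i : {group GL} := 'C_(GL_summand e i)[a i]%G.
have CB i x : x \in C i -> mx x \in B.
  rewrite inE => /andP[xS /cent1P xa].
  have xe := GL_summand_comm ee eo e1 Ve xS.
  have -> : mx x = e i * mx x + (1 - e i).
    apply: (idem_system_ext e1) => j; have [xj _] := elimT (GL_summandP ee eo e1 Ve i x) xS.
    rewrite mulrDr mulrBr mulr1 mulrA; have [->|ji] := eqVneq j i.
      by rewrite ee subrr addr0.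
    by rewrite xj // eo // mul0r add0r subr0.
  rewrite subalgD ?subalgB ?subalg1 //; apply: (max i).
  - by rewrite -mulrA xe mulrA ee.
  - by rewrite mulrA ee.
  have xa' : mx x * mx (a i) = mx (a i) * mx x.
    by have := congr1 (fun g : GL => mx g) xa.
  by rewrite mulrA (BC _ _ (aB i) (Be i)) -!mulrA xa'.
exists r, e, C; split.
- split.
    apply/mxdirect_sumsP => i _; apply/eqP; rewrite -submx0; apply/rV_subP => v.
    rewrite sub_capmx => /andP[/submxP[u vu] /sub_sumsmxP[w vw]].
    have : v *m e i = v by rewrite vu -mulmxA [e i *m _]ee.
    rewrite vw mulmx_suml big1 => [<-|j /andP[_ ji]]; first by rewrite sub0mx.
    by rewrite -mulmxA [e j *m _]eo ?mulmx0.
  apply/andP; split; first exact: submx1.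
  have {1}<- : \sum_i e i = 1%:M := e1.
  by apply: summx_sub_sums.
- by move=> i; apply: ind => [|g]; rewrite memU.
- apply: (GL_summands_dprod ee eo e1 Ve).
  + by move=> i; apply/subsetP => x xC; rewrite memU (CB i).
  + by move=> i; apply: subsetIl.
  + by move=> g; rewrite memU => gB i; apply: BC.
  move=> g i; rewrite memU => gB.
  have [x xE xS] := GL_summand_cut ee eo e1 Ve (GL_unitmx g : mx g \in unitmx) (BC _ _ gB (Be i)).
  have xB : mx x \in B.
    by rewrite xE (subalgD sB) ?(subalgM sB) ?(subalgB sB) ?(subalg1 sB).
  exists x => //; rewrite inE xS; apply/cent1P; apply: GLval_inj.
  exact: (BC _ _ xB (aB i)).
move=> i; exists (a i); split=> //.
apply: ind; first exact: cycle_id.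
move=> g /cycleP[k ->]; elim: k => [|k IH]; first by rewrite expg0 GL_1E subalg1.
by rewrite expgS GL_ME subalgM.
Qed.

(** Over a field with an element l other than 0 and 1, an idempotent e is a linear
    combination of the units 1 and (l - 1) e + 1, and an element x of a local corner is
    a combination of idempotents and of one of the units x + (1 - e) and x + 1. *)
Lemma unit_group_sub (B1 B2 : {set 'M[F]_n}) : (2 < #|F|)%N ->
  comm_subalgebra B1 -> comm_subalgebra B2 -> unit_group B1 = unit_group B2 -> B1 \subset B2.
Proof.
move=> q2 s1 s2 UE.
have U12 u : u \in B1 -> u \in unitmx -> u \in B2.
  move=> uB uu; have [g gE] := GL_of_unit uu.
  by rewrite -gE -mem_unit_group_alg // -UE mem_unit_group_alg // gE.
have [l l0 l1] : exists2 l : F, l != 0 & l != 1.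
  have /subsetPn[l _] : ~~ ([set: F]%SET \subset [set 0; 1]%SET).
    apply: contraL q2 => /subset_leq_card; rewrite cardsT cards2 eq_sym oner_eq0.
    by rewrite -leqNgt.
  by rewrite !inE negb_or => /andP[]; exists l.
have eB2 e : e \in B1 -> e * e = e -> e \in B2.
  move=> eB ee; have uB : (l - 1) *: e + 1 \in B1 by rewrite subalgL ?subalg1.
  have : (l - 1) *: e + 1 \in unitmx.
    apply: (proj1 (@mulmx1_unit _ _ _ ((l^-1 - 1) *: e + 1) _)).
    have lE : (l - 1) * (l^-1 - 1) + (l - 1) + (l^-1 - 1) = 0.
      rewrite -{2}[l - 1]mulr1 -mulrDr subrK mulrBl mulfV // mul1r.
      by rewrite addrA subrK subrr.
    rewrite mulmxE mulrDl mul1r mulrDr mulr1 -scalerAl -scalerAr ee scalerA.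
    by rewrite addrA -!scalerDl lE scale0r add0r.
  move=> /(U12 _ uB) => B2u.
  have -> : e = (l - 1)^-1 *: ((l - 1) *: e + 1 - 1).
    by rewrite addrK scalerA mulVf ?scale1r // subr_eq0.
  by rewrite subalgZ ?subalgB ?subalg1.
apply/subsetP => b bB; rewrite -[b]mul1r -(prim_idem_sum s1) mulr_suml.
apply: subalg_sum => // e pe; case/prim_idemP: (pe) => Be ee _ em.
have xB : e * b \in B1 by rewrite subalgM.
have B2e := eB2 e Be ee.
have xe : e * b * e = e * b by rewrite -mulrA (subalgC s1 bB Be) mulrA ee.
have ex : e * (e * b) = e * b by rewrite mulrA ee.
have [N N0 xN|u|u] := local_unit_or_unit1 ee xe ex.
- apply: em => //; first by rewrite subalgX.
  by case: N N0 {xN} => // N _; rewrite exprSr -mulrA xe.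
- have := U12 _ _ u; rewrite subalgD ?subalgB ?subalg1 // => /(_ isT) h.
  by rewrite -[e * b](addrK (1 - e)) subalgB // subalgB ?subalg1.
have := U12 _ _ u; rewrite subalgD ?subalg1 // => /(_ isT) h.
by rewrite -[e * b](addrK 1) subalgB ?subalg1.
Qed.

Lemma card_abelian_family_le : (#|abelian_family F m| <= #|block_algebras F n|)%N.
Proof.
rewrite (leq_trans _ (leq_imset_card (@unit_group F m) _)) // subset_leq_card //.
apply/subsetP => A; rewrite inE => /asboolP/abelian_family_algebra[B bB <-].
by apply: imset_f; rewrite inE.
Qed.

Lemma card_abelian_family : (2 < #|F|)%N -> #|abelian_family F m| = #|block_algebras F n|.
Proof.
move=> q2; apply/eqP; rewrite eqn_leq card_abelian_family_le /=.
rewrite -(card_in_imset (f := @unit_group F m)); last first.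
  move=> B1 B2; rewrite !inE => /andP[s1 _] /andP[s2 _] UE.
  by apply/eqP; rewrite eqEsubset !unit_group_sub.
rewrite subset_leq_card //; apply/subsetP => _ /imsetP[B + ->]; rewrite inE => bB.
by rewrite inE; apply/asboolP/algebra_abelian_family.
Qed.

End AlgebraToFamily.

(** * The recursion for the number of block algebras *)

(** The map sending a divisor of N to the complementary one is an involution. *)
Lemma codivisorK N d : (0 < N)%N -> (d %| N)%N -> (N %/ (N %/ d))%N = d.
Proof.
move=> N0 /dvdnP[k NE]; move: N0; rewrite NE muln_gt0 => /andP[k0 d0].
by rewrite mulnK // mulKn.
Qed.

Section Recursion.

Variables (R : realFieldType) (F : finFieldType).
Local Notation q := (#|F|%:R : R).
Local Notation x := (q^-1).

(** The contribution to [weighted_local] k, where k = d b, of the local algebras of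
    length b with a residue field of degree d, for y = q ^ -d. *)
Definition local_weight (b : nat) (y : R) : R :=
  if b == 1%N then (1 - y)^-1 else b%:R * y ^+ b.-1 / (1 - y) ^+ 2.

(** The number of block algebras of degree n over the order of GL_n. *)
Definition ratio n : R := #|block_algebras F n|%:R / (card_unitmx F n)%:R.

Lemma card_unitmx_gt0 n : (0 < card_unitmx F n)%N.
Proof. by apply/card_gt0P; exists 1; rewrite inE unitmx1. Qed.

Lemma card_unitmx_neq0 n : (card_unitmx F n)%:R != 0 :> R.
Proof. by rewrite pnatr_eq0 -lt0n card_unitmx_gt0. Qed.

Lemma q_gt1 : 1 < q. Proof. by rewrite ltr1n finNzRing_gt1. Qed.

Lemma q_neq0 : q != 0. Proof. by rewrite gt_eqF // (lt_trans _ q_gt1). Qed.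

(** The weights of the recursion for the number of block algebras. *)
Definition weighted_local k : R :=
  k%:R * q ^+ k * (#|local_block_algebras F k|%:R / (card_unitmx F k)%:R).

Lemma ratio_rec n : n%:R * (q ^+ n * ratio n) =
  \sum_(k < n.+1) weighted_local k * (q ^+ (n - k) * ratio (n - k)).
Proof.
have /(congr1 (fun z => z%:R : R)) := card_block_algebras_rec F n.
rewrite natrM natr_sum => E.
rewrite mulrCA mulrA -mulrA [n%:R * _]mulrA E mulr_suml mulr_sumr.
apply: eq_bigr => k _; have kn : (k <= n)%N by rewrite -ltnS.
have /(congr1 (fun z => z%:R : R)) := card_idem F kn; rewrite !natrM => I.
have qE : q ^+ n = q ^+ k * q ^+ (n - k) by rewrite -exprD subnKC.
rewrite /weighted_local /ratio qE -I.
have gk := card_unitmx_neq0 k; have gnk := card_unitmx_neq0 (n - k).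
have : #|idem_of_rank F n k|%:R != 0 :> R.
  by apply: contraNneq (card_unitmx_neq0 n) => z; rewrite -I z mul0r.
move: gk gnk; set A := (_%:R : R); set B := (_%:R : R) => gk gnk i0.
by field; rewrite gk gnk i0.
Qed.

Lemma weighted_localE n : weighted_local n.+1 =
  \sum_(b < n.+2 | (b %| n.+1)%N) local_weight b (x ^+ (n.+1 %/ b)).
Proof.
rewrite /weighted_local card_local_block_algebras natr_sum mulr_suml mulr_sumr.
have Q := q_neq0.
pose f (d : 'I_n.+2) : 'I_n.+2 := inord (n.+1 %/ d).
have fE (d : 'I_n.+2) : f d = (n.+1 %/ d)%N :> nat by rewrite inordK // ltnS leq_div.
rewrite [RHS](reindex_onto f f) /=; last first.
  by move=> d dn; apply: val_inj; rewrite /= !fE codivisorK.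
apply: eq_big => d.
  rewrite -val_eqE /= !fE; apply/idP/andP => [dn|[dn /eqP dE]].
    by rewrite codivisorK // dvdn_div.
  rewrite -dE dvdn_div //.
move=> dn; rewrite fE codivisorK //; set b := (n.+1 %/ d)%N.
have d0 : (0 < d)%N by apply: dvdn_gt0 dn.
have db : (d * b = n.+1)%N by rewrite mulnC divnK.
have b0 : (0 < b)%N by rewrite divn_gt0 // dvdn_leq.
clearbody b.
have /(congr1 (fun z => z%:R : R)) := card_local_of_degree F db.
rewrite !natrM => I.
have qd1 : 1 < q ^+ d by rewrite exprn_egt1 ?q_gt1 // -lt0n.
have X : x ^+ d = (q ^+ d)^-1 by rewrite exprVn.
have qd0 : q ^+ d != 0 by rewrite expf_neq0.
have qd1' : q ^+ d - 1 != 0 by rewrite subr_eq0 gt_eqF.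
have dn' : (d <= n.+1)%N by rewrite -ltnS.
have qn : ((#|F| ^ n.+1 - #|F| ^ (n.+1 - d))%N)%:R = q ^+ n.+1 * (1 - x ^+ d).
  rewrite natrB ?leq_exp2l ?finNzRing_gt1 ?leq_subr // !natrX mulrBr mulr1; congr (_ - _).
  by have := exprD q (n.+1 - d) d; rewrite subnK // X => ->; rewrite mulfK.
have dR : d%:R != 0 :> R by rewrite pnatr_eq0 -lt0n.
have ge := card_unitmx_neq0 n.+1.
have y1 : 1 - x ^+ d != 0.
  by rewrite X subr_eq0 gt_eqF // invf_lt1 // (lt_trans _ qd1).
have L0 : #|local_of_degree F n d|%:R != 0 :> R.
  by apply: contraNneq ge => z; rewrite -I z mul0r.
have qN : q ^+ n.+1 != 0 by rewrite expf_neq0.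
have n1 : n.+1%:R = d%:R * b%:R :> R by rewrite -natrM db.
rewrite n1 -I qn /local_weight /num_gens.
have [b1|b1] := eqVneq b 1%N.
  by rewrite b1; field; rewrite y1 qN dR L0.
have [c bE] : exists c, b = c.+2 by case: (b) b0 b1 => [|[|c]] // _ _; exists c.
rewrite bE /=.
have G : ((d * (#|F| ^ (d * c.+1) - #|F| ^ (d * c)))%N)%:R = d%:R * ((q ^+ d) ^+ c.+1 * (1 - x ^+ d)).
  rewrite natrM natrB ?leq_exp2l ?finNzRing_gt1 ?leq_mul //; congr (_ * _).
  by rewrite !natrX !exprM mulrBr mulr1 X; congr (_ - _); rewrite exprSr mulfK.
rewrite G; have -> : (x ^+ d) ^+ c.+1 = ((q ^+ d) ^+ c.+1)^-1 by rewrite X exprVn.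
have QC : (q ^+ d) ^+ c.+1 != 0 by rewrite expf_neq0.
by field; rewrite QC y1 qN dR L0.
Qed.

Lemma ratio0 : ratio 0 = 1.
Proof.
have M0 (a b : 'M[F]_0) : a = b by rewrite [a]flatmx0 [b]flatmx0.
rewrite /ratio /card_unitmx; have -> : [set g : 'M[F]_0 | g \in unitmx] = [set (1 : 'M[F]_0)].
  by apply/setP => g; rewrite !inE (M0 g 1) unitmx1 eqxx.
have -> : block_algebras F 0 = [set setT].
  apply/setP => B; rewrite !inE; apply/idP/eqP => [/andP[sB _]|->].
    by apply/setP => b; rewrite inE (M0 b 1) subalg1.
  apply/andP; split.
    by apply/comm_subalgebraP; split=> [|c x y _ _|x y _ _|x y _ _]; rewrite ?inE.
  apply/forallP => e; apply/implyP => /prim_idemP[_ _ e0 _].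
  by rewrite (M0 e 0) eqxx in e0.
by rewrite !cards1 divr1.
Qed.

End Recursion.

Lemma card_unitmx_GL (F : finFieldType) m : card_unitmx F m.+1 = #|('GL_m.+1[F])%g|.
Proof.
rewrite /card_unitmx -(card_imset _ (@GLval_inj F m)); apply: eq_card => a.
rewrite inE; apply/idP/imsetP => [ua|[g _ ->]]; last exact: (GL_unitmx g).
by have [g gE] := GL_of_unit ua; exists g; rewrite ?inE.
Qed.

(** * Finite products of geometric series *)

Section GeometricProducts.

Variable R : realFieldType.
Implicit Types (f h : nat -> R) (y rho : R) (s : seq (R * nat)).

(** Coefficients of the product of the power series with coefficients h and f. *)
Definition conv h f n : R := \sum_(0 <= k < n.+1) h k * f (n - k)%N.

(** Coefficients of f(z) / (1 - y z ^ b). *)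
Definition geo_mul y b f n : R := \sum_(0 <= j < (n %/ b).+1) y ^+ j * f (n - b * j)%N.

Lemma geo_mulE y b f n : (0 < b)%N ->
  geo_mul y b f n = f n + (if (b <= n)%N then y * geo_mul y b f (n - b) else 0).
Proof.
move=> b0; rewrite /geo_mul big_nat_recl // expr0 mul1r muln0 subn0; congr (_ + _).
case: leqP => bn; last by rewrite divn_small // big_geq.
have -> : (n %/ b = ((n - b) %/ b).+1)%N.
  by rewrite -{1}(subnK bn) divnDr ?dvdnn // divnn b0 addn1.
rewrite mulr_sumr; apply: eq_bigr => j _.
by rewrite exprS -mulrA mulnS subnDA.
Qed.

(** Coefficients of z F'(z) / F(z) for F = 1 / (1 - y z ^ b). *)
Definition geo_log y b k : R := if (0 < k)%N && (b %| k)%N then b%:R * y ^+ (k %/ b) else 0.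

Lemma conv_geo_mul h y b f n : (0 < b)%N ->
  conv h (geo_mul y b f) n =
  conv h f n + (if (b <= n)%N then y * conv h (geo_mul y b f) (n - b) else 0).
Proof.
move=> b0; rewrite {1}/conv.
under eq_bigr => k _ do rewrite geo_mulE // mulrDr.
rewrite big_split; congr (_ + _) => /=.
case: leqP => bn.
  rewrite (@big_cat_nat _ _ _ (n - b).+1) //=; last by rewrite ltnS leq_subr.
  rewrite [X in _ + X]big_nat_cond [X in _ + X]big1 ?addr0; last first.
    by move=> k /andP[/andP[k1 k2] _]; case: leqP => h1; rewrite ?mulr0 //; lia.
  rewrite /conv mulr_sumr !big_nat; apply: eq_bigr => k /= kn.
  have -> : (b <= n - k)%N by lia.
  by rewrite mulrCA; congr (_ * (_ * geo_mul _ _ _ _)); lia.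
rewrite big_nat big1 // => k kn.
by case: leqP => h1; rewrite ?mulr0 //; lia.
Qed.

Lemma conv_geo_log y b f n : (0 < b)%N ->
  conv (geo_log y b) f n =
  if (b <= n)%N then b%:R * y * f (n - b)%N + y * conv (geo_log y b) f (n - b) else 0.
Proof.
move=> b0; have small k : (k < b)%N -> geo_log y b k = 0.
  rewrite /geo_log => kb; case: ifP => // /andP[k0 /dvdn_leq]; move/(_ k0); lia.
rewrite /conv; case: leqP => bn; last first.
  by rewrite big_nat big1 // => k kn; rewrite small ?mul0r //; lia.
rewrite (@big_cat_nat _ _ _ b) //=; last by lia.
rewrite [X in X + _]big_nat [X in X + _]big1 ?add0r; last first.
  by move=> k kb; rewrite small ?mul0r.
have -> : (n.+1 = (n - b).+1 + b)%N by lia.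
rewrite -{1}[b]add0n big_addn addnK mulr_sumr big_nat_recl // [in RHS]big_nat_recl //.
have g0 : geo_log y b 0 = 0 by rewrite /geo_log ltnn.
rewrite g0 mul0r mulr0 add0r add0n {1}/geo_log b0 dvdnn /= divnn b0 expr1.
congr (_ + _); apply: eq_big_nat => k _.
have -> : geo_log y b (k.+1 + b) = y * geo_log y b k.+1.
  rewrite /geo_log !addSn /= -addSn dvdn_addl // divnDr // divnn b0 addn1.
  by case: ifP; rewrite ?mulr0 // exprS mulrCA.
by rewrite mulrA; congr (_ * f _); lia.
Qed.

(** Coefficients of the product of the series 1 / (1 - y z ^ b), for (y, b) in s. *)
Fixpoint geo_prod s : nat -> R :=
  if s is (y, b) :: s' then geo_mul y b (geo_prod s') else fun n => (n == 0%N)%:R.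

(** Coefficients of z F'(z) / F(z), when F is the product above. *)
Definition geo_prod_log s k : R := \sum_(t <- s) geo_log t.1 t.2 k.

Lemma convDl h1 h2 f n : conv (fun k => h1 k + h2 k) f n = conv h1 f n + conv h2 f n.
Proof. by rewrite /conv -big_split; apply: eq_bigr => k _; rewrite mulrDl. Qed.

(** The equation z F' = (z F' / F) F. *)
Lemma geo_prod_rec s n : all (fun t => (0 < t.2)%N) s ->
  n%:R * geo_prod s n = conv (geo_prod_log s) (geo_prod s) n.
Proof.
elim: s n => [|[y b] s IH] n /=.
  rewrite /conv => _; rewrite big1 => [|k _]; last by rewrite /geo_prod_log big_nil mul0r.
  by case: n => [|n]; rewrite /= ?mul0r ?mulr0.
case/andP=> b0 s0; have IHs k := IH k s0; set f' := geo_mul y b _.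
have -> : conv (geo_prod_log ((y, b) :: s)) f' n =
          conv (geo_log y b) f' n + conv (geo_prod_log s) f' n.
  by rewrite -convDl; apply: eq_bigr => k _; rewrite /geo_prod_log big_cons.
have [k] := ubnP n; elim: k n => // k IHk n; rewrite ltnS => nk.
rewrite conv_geo_log // (conv_geo_mul (geo_prod_log s)) // -/f' -IHs /f' geo_mulE // -/f'.
case: leqP => bn; last by rewrite !addr0 add0r.
have := IHk (n - b)%N; have -> : (n - b < k)%N by lia.
move=> /(_ isT) E; rewrite mulrDr [RHS]addrCA; congr (_ + _).
rewrite -addrA -mulrDr -E -{1}(subnK bn) natrD; ring.
Qed.

Lemma geo_mul_ge0 y b f : 0 <= y -> (forall n, 0 <= f n) -> forall n, 0 <= geo_mul y b f n.
Proof. by move=> y0 f0 n; apply: sumr_ge0 => j _; rewrite mulr_ge0 ?exprn_ge0. Qed.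

Lemma geo_prod_ge0 s n : all (fun t => 0 <= t.1) s -> 0 <= geo_prod s n.
Proof.
elim: s n => [|[y b] s IH] n /=; first by rewrite ler0n.
by case/andP=> y0 s0; apply: geo_mul_ge0 => // k; apply: IH.
Qed.

(** Partial sums, with M terms, of the power series f at rho. *)
Definition psum f rho M : R := \sum_(0 <= n < M) f n * rho ^+ n.

Lemma psum_geo_mul y b f rho M : (0 < b)%N ->
  psum (geo_mul y b f) rho M =
  psum f rho M + y * rho ^+ b * psum (geo_mul y b f) rho (M - b).
Proof.
move=> b0; rewrite {1}/psum; under eq_bigr => n _ do rewrite geo_mulE // mulrDl.
rewrite big_split; congr (_ + _) => /=.
have [bM|Mb] := leqP b M; last first.
  rewrite (eqnP (ltnW Mb)) /psum [in RHS]big_geq // mulr0.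
  by rewrite big_nat big1 // => n nM; case: leqP => h1; rewrite ?mul0r //; lia.
rewrite (@big_cat_nat _ _ _ b) //= [X in X + _]big_nat [X in X + _]big1 ?add0r; last first.
  by move=> n nb; case: leqP => h1; rewrite ?mul0r //; lia.
rewrite -{1}[b]add0n -{1}(subnK bM) big_addn addnK /psum mulr_sumr.
apply: eq_bigr => n _; rewrite leq_addl addnK exprD; ring.
Qed.

Lemma psum_nondecr f rho M N : (forall n, 0 <= f n) -> 0 <= rho -> (M <= N)%N ->
  psum f rho M <= psum f rho N.
Proof.
move=> f0 r0 MN; rewrite /psum [leRHS](@big_cat_nat _ _ _ M) //= lerDl.
by apply: sumr_ge0 => n _; rewrite mulr_ge0 ?exprn_ge0.
Qed.

Lemma psum_geo_prod_le s rho M : 0 <= rho ->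
  all (fun t => [&& 0 <= t.1, (0 < t.2)%N & t.1 * rho ^+ t.2 < 1]) s ->
  psum (geo_prod s) rho M <= \prod_(t <- s) (1 - t.1 * rho ^+ t.2)^-1.
Proof.
move=> r0; elim: s => [|[y b] s IH] /=.
  rewrite big_nil => _; rewrite /psum; case: M => [|M]; first by rewrite big_geq.
  by rewrite big_nat_recl // big1 ?addr0 ?mulr1 // => i _; rewrite mul0r.
case/andP=> /and3P[y0 b0 yr] s0; rewrite big_cons /=.
have ss : all (fun t => 0 <= t.1) s by apply: sub_all s0 => t /and3P[].
rewrite -ler_pdivrMl ?invr_gt0 ?subr_gt0 // invrK.
apply: le_trans (IH s0); rewrite mulrBl mul1r lerBlDr {1}psum_geo_mul // lerD2l.
rewrite ler_wpM2l ?mulr_ge0 ?exprn_ge0 // psum_nondecr ?leq_subr // => n.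
by apply: geo_mul_ge0 => // k; apply: geo_prod_ge0.
Qed.

End GeometricProducts.

(** * Convergence of the weights *)

Local Open Scope classical_set_scope.
Local Open Scope ring_scope.

Section Limits.

Variable R : realType.
Implicit Types (y rho : R) (s : seq (R * nat)).

Lemma nondecr_bounded_cvg (v : nat -> R) (c : R) :
  (forall m n, (m <= n)%N -> v m <= v n) -> (forall n, v n <= c) -> exists l : R, v @ \oo --> l.
Proof.
move=> vm vc; exists (limn v); apply: nondecreasing_is_cvgn; first by move=> m n; apply: vm.
by exists c => _ [n _ <-]; apply: vc.
Qed.

Lemma psum_geo_prod_cvg s :
  all (fun t => [&& 0 <= t.1, (0 < t.2)%N & t.1 < 1]) s ->
  psum (geo_prod s) 1 @ \oo --> \prod_(t <- s) (1 - t.1)^-1.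
Proof.
elim: s => [_|[y b] s IH sall].
  rewrite big_nil -cvg_shiftS /=; apply: cvg_near_cst; near=> M.
  by rewrite /psum big_nat_recl // big1 ?addr0 ?mulr1 // => i _; rewrite mul0r.
have /andP[/and3P[/= y0 b0 y1] s0] := sall; rewrite big_cons /=.
have ge0 n : 0 <= geo_prod ((y, b) :: s) n.
  by apply: geo_prod_ge0; apply: sub_all sall => t /and3P[].
have [l cl] : exists l : R, psum (geo_prod ((y, b) :: s)) 1 @ \oo --> l.
  apply: (@nondecr_bounded_cvg _ (\prod_(t <- (y, b) :: s) (1 - t.1 * 1 ^+ t.2)^-1)).
    by move=> m n; apply: psum_nondecr.
  move=> n; apply: psum_geo_prod_le => //.
  by apply: sub_all sall => t; rewrite expr1n mulr1.
have cl' : (fun M => psum (geo_prod ((y, b) :: s)) 1 (M + b)) @ \oo --> l.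
  by rewrite (cvg_shiftn b (psum (geo_prod ((y, b) :: s)) 1)).
have cs : (fun M => psum (geo_prod s) 1 (M + b)) @ \oo --> \prod_(t <- s) (1 - t.1)^-1.
  by rewrite (cvg_shiftn b (psum (geo_prod s) 1)); apply: IH.
have E : (fun M => psum (geo_prod ((y, b) :: s)) 1 (M + b)) =
    (fun M => psum (geo_prod s) 1 (M + b) + y * psum (geo_prod ((y, b) :: s)) 1 M).
  by apply/funext => M; rewrite /= psum_geo_mul // expr1n mulr1 addnK.
have c2 : (fun M => psum (geo_prod ((y, b) :: s)) 1 (M + b)) @ \oo -->
    \prod_(t <- s) (1 - t.1)^-1 + y * l.
  by rewrite E; apply: cvgD => //; apply: cvgMr.
have lE : l = \prod_(t <- s) (1 - t.1)^-1 + y * l := cvg_unique _ cl' c2.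
have y1' : 1 - y != 0 by rewrite subr_eq0 gt_eqF.
suff <- : l = (1 - y)^-1 * \prod_(t <- s) (1 - t.1)^-1 by [].
apply: (mulfI y1'); rewrite mulrA mulfV // mul1r mulrBl mul1r.
by apply/eqP; rewrite subr_eq; apply/eqP; exact: lE.
Unshelve. all: by end_near. Qed.

Section Weights.

Variable y : R.
Hypotheses (y0 : 0 < y) (y1 : y < 1).

Let y1' : 1 - y != 0. Proof. by rewrite subr_eq0 gt_eqF. Qed.
Let y1_gt0 : 0 < 1 - y. Proof. by rewrite subr_gt0. Qed.

(** Partial sums of the series 1 / (1 - y) and 1 / (1 - y) ^ 2. *)
Definition geo_sum M : R := \sum_(0 <= j < M) y ^+ j.
Definition geo_sum1 M : R := \sum_(0 <= j < M) j.+1%:R * y ^+ j.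

Lemma geo_sumE M : geo_sum M = (1 - y ^+ M) / (1 - y).
Proof.
apply: (mulIf y1'); rewrite mulfVK // /geo_sum; elim: M => [|M IH].
  by rewrite big_geq // mul0r expr0 subrr.
by rewrite big_nat_recr //= mulrDl IH exprS; ring.
Qed.

Lemma geo_sum_le M : geo_sum M <= (1 - y)^-1.
Proof. by rewrite geo_sumE ler_pdivrMr // mulVf // lerBlDr lerDl exprn_ge0 // ltW. Qed.

Lemma geo_sum_cvg : geo_sum @ \oo --> (1 - y)^-1.
Proof.
have -> : geo_sum = fun M => (1 - y ^+ M) / (1 - y) by apply/funext => M; rewrite geo_sumE.
rewrite -[X in _ --> X]mul1r; apply: cvgMl; rewrite -[X in _ --> X]subr0.
by apply: cvgB; [apply: cvg_cst | apply: cvg_expr; rewrite ger0_norm // ltW].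
Qed.

Lemma geo_sum1E M : (1 - y) * geo_sum1 M = geo_sum M - M%:R * y ^+ M.
Proof.
rewrite /geo_sum1 /geo_sum; elim: M => [|M IH]; first by rewrite !big_geq // mulr0 mul0r subrr.
rewrite !big_nat_recr //= mulrDr IH exprS -natr1; ring.
Qed.

Lemma geo_sum1_le M : geo_sum1 M <= ((1 - y) ^+ 2)^-1.
Proof.
rewrite expr2 invfM -ler_pdivrMl ?invr_gt0 // invrK geo_sum1E.
apply: le_trans (geo_sum_le M); rewrite lerBlDr lerDl mulr_ge0 ?exprn_ge0 ?ler0n //.
exact: ltW.
Qed.

Lemma geo_sum1_cvg : geo_sum1 @ \oo --> ((1 - y) ^+ 2)^-1.
Proof.
have [l cl] : exists l : R, geo_sum1 @ \oo --> l.
  apply: (@nondecr_bounded_cvg _ (((1 - y) ^+ 2)^-1)); last exact: geo_sum1_le.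
  move=> m n mn; rewrite /geo_sum1 [leRHS](@big_cat_nat _ _ _ m) //= lerDl.
  by apply: sumr_ge0 => i _; rewrite mulr_ge0 ?exprn_ge0 ?ler0n // ltW.
have clS : (fun M => geo_sum1 M.+1) @ \oo --> l by rewrite cvg_shiftS.
(* The general term tends to 0. *)
have cM : (fun M => M%:R * y ^+ M) @ \oo --> (0 : R).
  have c1 : (fun M => M.+1%:R * y ^+ M) @ \oo --> (0 : R).
    rewrite -(subrr l).
    have -> : (fun M => M.+1%:R * y ^+ M) = (fun M => geo_sum1 M.+1 - geo_sum1 M).
      by apply/funext => M; rewrite /geo_sum1 big_nat_recr //= addrAC subrr add0r.
    exact: cvgB.
  have c0 : (fun M => y ^+ M) @ \oo --> (0 : R) by apply: cvg_expr; rewrite ger0_norm // ltW.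
  rewrite -(subrr (0 : R)).
  have -> : (fun M => M%:R * y ^+ M) = (fun M => M.+1%:R * y ^+ M - y ^+ M).
    by apply/funext => M; rewrite -natr1 mulrDl mul1r addrK.
  exact: cvgB.
have E : (1 - y) * l = (1 - y)^-1.
  have e1 : (fun M => (1 - y) * geo_sum1 M) @ \oo --> (1 - y) * l by apply: cvgMr.
  have e2 : (fun M => (1 - y) * geo_sum1 M) @ \oo --> (1 - y)^-1.
    have -> : (fun M => (1 - y) * geo_sum1 M) = (fun M => geo_sum M - M%:R * y ^+ M).
      by apply/funext => M; rewrite geo_sum1E.
    rewrite -[X in _ --> X]subr0; apply: cvgB cM; exact: geo_sum_cvg.
  exact: cvg_unique _ e1 e2.
by rewrite expr2 invfM -[X in _ * X]E mulKf.
Qed.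

(** The exponent c(a, b) of 1 / (1 - x ^ a z ^ b) in the infinite product; the
    truncated subtraction makes it 0 when b > a.+1. *)
Definition mult a b : nat := if b == 1%N then 1%N else (a.+2 - b)%N.

(** The sum over a > 0 of b y ^ a, counted c(a, b) times. It differs from the weight
    coming from local algebras when b = 1 only, where the latter includes a = 0. *)
Definition limit_weight b : R :=
  if b == 1%N then y / (1 - y) else b%:R * y ^+ b.-1 / (1 - y) ^+ 2.

(** The same sum, restricted to a <= N. *)
Definition partial_weight N b : R := \sum_(1 <= a < N.+1) (b%:R * y ^+ a) *+ mult a b.

Lemma partial_weight1 N : partial_weight N 1 = y * geo_sum N.
Proof.
rewrite /partial_weight /geo_sum big_add1 /= mulr_sumr; apply: eq_bigr => a _.
by rewrite mul1r mulr1n exprS.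
Qed.

Lemma partial_weightE N b : partial_weight N b.+2 = b.+2%:R * y ^+ b.+1 * geo_sum1 (N - b).
Proof.
rewrite /partial_weight /geo_sum1; have [Nb|bN] := leqP N b.
  rewrite (eqnP Nb) [in RHS]big_geq // mulr0 big_nat big1 // => a aN.
  by rewrite /mult /= (_ : (a.+2 - b.+2 = 0)%N) //; lia.
rewrite (@big_cat_nat _ _ _ b.+1) //=; last by lia.
rewrite big_nat big1 ?add0r; last first.
  by move=> a aN; rewrite /mult /= (_ : (a.+2 - b.+2 = 0)%N) //; lia.
rewrite -{1}[b.+1]add0n big_addn mulr_sumr (_ : N.+1 - b.+1 = N - b)%N //.
apply: eq_bigr => a _; rewrite /mult /= (_ : ((a + b.+1).+2 - b.+2 = a.+1)%N); last by lia.
rewrite -mulr_natr exprD; ring.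
Qed.

Lemma partial_weight_le N b : (0 < b)%N -> partial_weight N b <= limit_weight b.
Proof.
case: b => // -[_|b _]; rewrite /limit_weight /=.
  by rewrite partial_weight1 ler_wpM2l ?geo_sum_le // ltW.
rewrite partial_weightE ler_wpM2l ?geo_sum1_le // mulr_ge0 ?ler0n // exprn_ge0 // ltW //.
Qed.

Lemma partial_weight_cvg b : (0 < b)%N -> partial_weight ^~ b @ \oo --> limit_weight b.
Proof.
case: b => // -[_|b _]; rewrite /limit_weight /=.
  have -> : partial_weight ^~ 1%N = (fun N => y * geo_sum N).
    by apply/funext => N; rewrite partial_weight1.
  apply: cvgMr; exact: geo_sum_cvg.
have -> : partial_weight ^~ b.+2 = (fun N => b.+2%:R * y ^+ b.+1 * geo_sum1 (N - b)).
  by apply/funext => N; rewrite partial_weightE.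
apply: cvgMr; rewrite -(cvg_shiftn b) /=.
under eq_fun do rewrite addnK.
exact: geo_sum1_cvg.
Qed.

End Weights.

End Limits.

(** * The infinite product *)

Lemma sum_mult N a : (a <= N)%N -> (\sum_(1 <= b < N.+2) mult a b = 'C(a.+1, 2).+1)%N.
Proof.
move=> aN; rewrite big_ltn // big_add1 /= add1n; congr _.+1.
rewrite (@big_cat_nat _ _ _ a.+1) //= [X in (_ + X)%N]big_nat [X in (_ + X)%N]big1; last first.
  by move=> b bN; rewrite /mult /=; case: eqP => //; lia.
rewrite addn0.
have E b : (1 <= b < a.+1)%N -> mult a b.+1 = (a.+1 - b)%N.
  by move=> bN; rewrite /mult eqSS; case: (b =P 0%N) => b0; lia.
rewrite (eq_big_nat _ _ E) {E}.
elim: a {aN} => [|a IH]; first by rewrite big_geq // bin_small.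
rewrite big_ltn // big_add1 /= binS bin1 -IH addnC; congr (_ + _)%N.
Qed.

(** Limits commute with finite sums. *)
Lemma cvg_sum (R : realType) (I : Type) (r : seq I) (P : pred I) (f : nat -> I -> R) (l : I -> R) :
  (forall i, P i -> (fun N => f N i) @ \oo --> l i) ->
  (fun N => \sum_(i <- r | P i) f N i) @ \oo --> \sum_(i <- r | P i) l i.
Proof.
move=> fl; elim: r => [|i r IH].
  by rewrite big_nil; under eq_fun do rewrite big_nil; apply: cvg_cst.
rewrite big_cons; under eq_fun do rewrite big_cons.
by case: ifP => // Pi; apply: cvgD => //; apply: fl.
Qed.

Section Factors.

Variables (R : realType) (x : R).

(** The finitely many factors (x ^ a, b), standing for 1 / (1 - x ^ a z ^ b), with
    1 <= a <= N, of the infinite product. *)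
Definition factors N : seq (R * nat) :=
  flatten [seq nseq (mult t.1 t.2) (x ^+ t.1, t.2) |
           t <- [seq (a, b) | a <- index_iota 1 N.+1, b <- index_iota 1 N.+2]].

Lemma sum_factors N (f : R * nat -> R) : \sum_(t <- factors N) f t =
  \sum_(1 <= a < N.+1) \sum_(1 <= b < N.+2) f (x ^+ a, b) *+ mult a b.
Proof.
rewrite /factors big_flatten big_map big_allpairs_dep /=.
apply: eq_bigr => a _; apply: eq_bigr => b _ /=.
elim: (mult a b) => [|k IH] /=; first by rewrite big_nil mulr0n.
by rewrite big_cons IH mulrS.
Qed.

Lemma prod_factors N (f : R * nat -> R) : \prod_(t <- factors N) f t =
  \prod_(1 <= a < N.+1) \prod_(1 <= b < N.+2) f (x ^+ a, b) ^+ mult a b.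
Proof.
rewrite /factors big_flatten big_map big_allpairs_dep /=.
apply: eq_bigr => a _; apply: eq_bigr => b _ /=.
elim: (mult a b) => [|k IH] /=; first by rewrite big_nil expr0.
by rewrite big_cons IH exprS.
Qed.

Lemma factorsP N t : t \in factors N ->
  exists a b, [/\ (0 < a)%N, (0 < b)%N, (b <= a.+1)%N & t = (x ^+ a, b)].
Proof.
move=> /flattenP[s /mapP[ab /allpairsP[[a b] /= [aN bN ->]] ->]].
rewrite mem_nseq /= => /andP[mb /eqP ->]; exists a, b.
move: aN bN; rewrite !mem_index_iota => /andP[a0 _] /andP[b0 _]; split=> //.
by move: mb; rewrite /mult; case: eqP; lia.
Qed.

Hypotheses (x0 : 0 < x) (x1 : x < 1).

Let expx1 k : (0 < k)%N -> 0 < x ^+ k < 1.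
Proof. by move=> k0; rewrite exprn_gt0 //= exprn_ilt1 ?(ltW x0) // -lt0n. Qed.

(** Coefficients of z G'(z) / G(z), when G is the infinite product. *)
Definition limit_log k : R :=
  \sum_(1 <= b < k.+1 | (b %| k)%N) limit_weight (x ^+ (k %/ b)) b.

Lemma geo_prod_log_factors N k : (0 < k)%N -> geo_prod_log (factors N) k =
  \sum_(1 <= b < k.+1 | (b %| k)%N) partial_weight (x ^+ (k %/ b)) N b.
Proof.
move=> k0; rewrite /geo_prod_log sum_factors exchange_big /=.
transitivity (\sum_(1 <= b < N.+2 | (b %| k)%N) partial_weight (x ^+ (k %/ b)) N b).
  rewrite [RHS]big_mkcond; apply: eq_bigr => b _; rewrite /geo_log k0 /=.
  case: ifP => bk; last by rewrite big1 // => a _; rewrite mul0rn.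
  by apply: eq_bigr => a _; rewrite -!exprM mulnC.
rewrite [LHS](@big_nat_widen _ _ _ _ _ (N.+2 + k.+1)) ?leq_addr //.
rewrite [RHS](@big_nat_widen _ _ _ _ _ (N.+2 + k.+1)) ?leq_addl //.
rewrite big_mkcond [RHS]big_mkcond; apply: eq_big_nat => b /andP[b0 _].
case bk: (b %| k)%N => //=; have bk' : (b <= k)%N by apply: dvdn_leq.
rewrite (_ : (b < k.+1)%N = true) ?ltnS //; case: ltnP => // Nb.
rewrite /partial_weight big_nat big1 // => a aN.
by rewrite /mult; case: eqP; [lia | rewrite (_ : (a.+2 - b = 0)%N) //; lia].
Qed.

Lemma geo_prod_log_factors_le N k : (0 < k)%N -> geo_prod_log (factors N) k <= limit_log k.
Proof.
move=> k0; rewrite geo_prod_log_factors // /limit_log big_nat_cond [leRHS]big_nat_cond.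
apply: ler_sum => b /andP[/andP[b0 bk] bd].
have /andP[? ?] : 0 < x ^+ (k %/ b) < 1 by apply: expx1; rewrite divn_gt0.
exact: partial_weight_le.
Qed.

Lemma geo_prod_log_factors_cvg k : (0 < k)%N ->
  (fun N => geo_prod_log (factors N) k) @ \oo --> limit_log k.
Proof.
move=> k0; under eq_fun do rewrite geo_prod_log_factors // big_nat_cond.
rewrite /limit_log big_nat_cond; apply: cvg_sum => b /andP[/andP[b0 bk] bd].
have /andP[? ?] : 0 < x ^+ (k %/ b) < 1 by apply: expx1; rewrite divn_gt0.
exact: partial_weight_cvg.
Qed.

Lemma geo_prod_log0 (s : seq (R * nat)) : geo_prod_log s 0 = 0.
Proof. by rewrite /geo_prod_log big1 // => t _; rewrite /geo_log ltnn. Qed.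

Lemma limit_log_gt0 k : (0 < k)%N -> 0 < limit_log k.
Proof.
move=> k0; have xk := expx1 k0.
rewrite /limit_log big_ltn_cond // dvd1n divn1 {1}/limit_weight eqxx.
have /andP[xk0 xk1] := xk; rewrite ltr_pwDl ?divr_gt0 ?subr_gt0 //.
rewrite big_nat_cond; apply: sumr_ge0 => b /andP[/andP[b0 bk] bd].
have /andP[y0 y1] : 0 < x ^+ (k %/ b) < 1 by apply: expx1; rewrite divn_gt0 ?(ltnW b0) //.
have y2 : 0 <= 1 - x ^+ (k %/ b) by rewrite subr_ge0 ltW.
rewrite /limit_weight; case: eqP => _; first by rewrite divr_ge0 // ltW.
by rewrite divr_ge0 ?mulr_ge0 ?ler0n ?exprn_ge0 // ltW.
Qed.

(** Convergence of the infinite product at a point rho with x rho ^ 2 < 1. *)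
Section Bound.

Variable rho : R.
Hypotheses (rho1 : 1 <= rho) (xrho : x * rho ^+ 2 < 1).

Let rho0 : 0 < rho. Proof. by rewrite (lt_le_trans _ rho1). Qed.
Let y := x * rho.
Let y0 : 0 < y. Proof. by rewrite mulr_gt0. Qed.
Let y1 : y < 1.
Proof.
by apply: le_lt_trans xrho; rewrite /y expr2 mulrA ler_peMr // mulr_ge0 ?(ltW x0) ?(ltW rho0).
Qed.

Let factor_le a b : (b <= a.+1)%N -> x ^+ a * rho ^+ b <= rho * y ^+ a.
Proof.
move=> ba; rewrite /y exprMn mulrCA -exprS ler_wpM2l ?exprn_ge0 ?(ltW x0) //.
by rewrite ler_weXn2l.
Qed.

Lemma factors_bounds N : all (fun t => [&& 0 <= t.1, (0 < t.2)%N & t.1 * rho ^+ t.2 <= x * rho ^+ 2])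
  (factors N).
Proof.
apply/allP => t /factorsP[a [b [a0 b0 ba ->]]] /=; rewrite exprn_ge0 ?(ltW x0) // b0 /=.
apply: le_trans (factor_le ba) _; case: a a0 {ba} => // a _.
rewrite exprS mulrA (_ : rho * y = x * rho ^+ 2); last by rewrite /y expr2 mulrCA.
by rewrite ler_piMr // ?exprn_ile1 ?(ltW y0) ?(ltW y1) // ?mulr_ge0 ?exprn_ge0 ?(ltW x0) ?(ltW rho0).
Qed.

(** Each factor (1 - t)^-1 is at most the exponential of t / (1 - x rho ^ 2). *)
Lemma prod_le_expR (s : seq (R * nat)) :
  all (fun t => [&& 0 <= t.1, (0 < t.2)%N & t.1 * rho ^+ t.2 <= x * rho ^+ 2]) s ->
  \prod_(t <- s) (1 - t.1 * rho ^+ t.2)^-1 <=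
  expR ((1 - x * rho ^+ 2)^-1 * \sum_(t <- s) t.1 * rho ^+ t.2).
Proof.
elim: s => [|t s IH]; first by rewrite !big_nil mulr0 expR0.
move=> /= /andP[/and3P[t0 _ tx] s0]; rewrite !big_cons mulrDr expRD.
have z0 : 0 <= t.1 * rho ^+ t.2 by rewrite mulr_ge0 // exprn_ge0 // ltW.
have z1 : 0 < 1 - t.1 * rho ^+ t.2 by rewrite subr_gt0 (le_lt_trans tx).
rewrite ler_pM ?invr_ge0 ?(ltW z1) ?IH //.
  rewrite big_seq prodr_ge0 // => u us.
  have /and3P[_ _ ux] := allP s0 u us.
  by rewrite invr_ge0 subr_ge0 ltW // (le_lt_trans ux).
apply: le_trans (expR_ge1Dx _).
have -> : (1 - t.1 * rho ^+ t.2)^-1 = 1 + (1 - t.1 * rho ^+ t.2)^-1 * (t.1 * rho ^+ t.2).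
  by move: z1; set z := _ * _ => z1; field; rewrite gt_eqF.
rewrite lerD2l ler_wpM2r // lef_pV2 ?posrE ?subr_gt0 //; last exact: le_lt_trans tx _.
by rewrite lerB.
Qed.

(** Partial sums of the series 1 / (1 - y) ^ 3. *)
Definition geo_sum2 M : R := \sum_(0 <= j < M) 'C(j.+2, 2)%:R * y ^+ j.

Lemma geo_sum2_le M : geo_sum2 M <= ((1 - y) ^+ 3)^-1.
Proof.
have y1' : 0 < 1 - y by rewrite subr_gt0.
rewrite exprS invfM -ler_pdivrMl ?invr_gt0 // invrK.
have -> : (1 - y) * geo_sum2 M = geo_sum1 y M - 'C(M.+1, 2)%:R * y ^+ M.
  rewrite /geo_sum1 /geo_sum2; elim: M => [|M IH].
    by rewrite !big_geq // bin_small // mulr0 mul0r subrr.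
  have B : 'C(M.+2, 2)%:R = 'C(M.+1, 2)%:R + M.+1%:R :> R by rewrite binS bin1 natrD.
  by rewrite !big_nat_recr //= mulrDr IH exprS B; ring.
apply: le_trans (geo_sum1_le y0 y1 M); rewrite lerBlDr lerDl.
by rewrite mulr_ge0 ?ler0n ?exprn_ge0 // ltW.
Qed.

(** A bound for the values at rho of all the finite subproducts. *)
Definition product_bound : R :=
  expR ((1 - x * rho ^+ 2)^-1 * (rho * ((1 - y) ^+ 3)^-1)).

Lemma prod_factors_le N :
  \prod_(t <- factors N) (1 - t.1 * rho ^+ t.2)^-1 <= product_bound.
Proof.
apply: le_trans (prod_le_expR (factors_bounds N)) _; rewrite ler_expR.
rewrite ler_wpM2l ?invr_ge0 ?subr_ge0 ?(ltW xrho) // sum_factors /=.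
apply: le_trans (ler_wpM2l (ltW rho0) (geo_sum2_le N.+1)).
rewrite /geo_sum2 [leRHS]mulrC [X in X * _]big_ltn // mulrDl -[leLHS]add0r.
rewrite lerD ?mulr_ge0 ?ler0n ?exprn_ge0 ?(ltW y0) ?(ltW rho0) //.
rewrite mulr_suml big_nat_cond [leRHS]big_nat_cond; apply: ler_sum => a /andP[/andP[a0 aN] _].
apply: (@le_trans _ _ (\sum_(1 <= b < N.+2) (rho * y ^+ a) *+ mult a b)).
  apply: ler_sum => b _; have [ba|ab] := leqP b a.+1.
    by rewrite ler_wMn2r // factor_le.
  by rewrite /mult; case: eqP => [|_]; [lia | rewrite (_ : (a.+2 - b = 0)%N) //; lia].
rewrite sumrMnr sum_mult // -[leLHS]mulr_natr [leLHS]mulrC [rho * _]mulrC mulrA.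
rewrite ler_wpM2r ?(ltW rho0) // ler_wpM2r ?exprn_ge0 ?(ltW y0) //.
by rewrite ler_nat; have := binS a.+1 1; rewrite bin1; lia.
Qed.

End Bound.

End Factors.

(** * Limit of the coefficients, with an error term *)

Section Asymptotics.

Variables (R : realType) (x : R) (u w : nat -> R).
Hypotheses (x0 : 0 < x) (x1 : x < 1).
Hypotheses (u0 : u 0%N = 1) (uE : forall n, n%:R * u n = conv w u n).
Hypotheses (w0 : w 0%N = 0) (wE : forall k, w k.+1 = 1 + limit_log x k.+1).

(** The coefficients of (1 - z) times the series u. *)
Definition increment n : R := if n is n'.+1 then u n'.+1 - u n' else u 0%N.
Local Notation g := increment.

Lemma limit_log0 : limit_log x 0 = 0.
Proof. by rewrite /limit_log big_geq. Qed.

Lemma sum_increment n : \sum_(0 <= j < n.+1) g j = u n.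
Proof.
elim: n => [|n IH]; first by rewrite big_nat1.
by rewrite big_nat_recr //= IH addrC subrK.
Qed.

(** Multiplying u by 1 - z removes the constant 1 from the weights w. *)
Lemma increment_rec n : n%:R * g n = conv (limit_log x) g n.
Proof.
case: n => [|n]; first by rewrite /conv big_nat1 mul0r limit_log0 mul0r.
have cw : conv w g n.+1 = conv w u n.+1 - conv w u n.
  rewrite /conv big_nat_recr //= [in RHS]big_nat_recr //= subnn addrAC; congr (_ + _).
  rewrite -sumrB; apply: eq_big_nat => k kn.
  have kn' : (k <= n)%N by move: kn; rewrite ltnS.
  by rewrite (subSn kn') [increment _]/= mulrBr.
have cl : conv w g n.+1 = conv (limit_log x) g n.+1 + u n.
  rewrite /conv big_nat_recl // w0 mul0r add0r [in RHS]big_nat_recl // limit_log0 mul0r add0r.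
  rewrite -(sum_increment n) [X in _ + X]big_nat_rev /= add0n -big_split /=.
  by apply: eq_big_nat => k kn; rewrite wE mulrDl mul1r addrC !subSS.
rewrite -[RHS](addrK (u n)) -cl cw -!uE -natr1 /=; ring.
Qed.

Lemma increment_gt0 n : 0 < g n.
Proof.
have [k] := ubnP n; elim: k n => // k IH [_|n]; first by rewrite /= u0 ltr01.
rewrite ltnS => nk; rewrite -(pmulr_rgt0 _ (ltr0Sn R n)) increment_rec /conv.
rewrite big_nat_recr //= subnn; apply: ltr_wpDl; last first.
  by rewrite mulr_gt0 ?limit_log_gt0 //= u0 ltr01.
rewrite big_nat sumr_ge0 // => -[|j] jn; first by rewrite limit_log0 mul0r.
by rewrite mulr_ge0 ?ltW ?limit_log_gt0 ?IH //; lia.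
Qed.

(* Coefficients of the product over a <= N. *)
Let P N := geo_prod (factors x N).

Lemma factors_pos N : all (fun t => [&& 0 <= t.1, (0 < t.2)%N & t.1 < 1]) (factors x N).
Proof.
apply/allP => t /factorsP[a [b [a0 b0 _ ->]]] /=.
by rewrite b0 exprn_ge0 ?(ltW x0) //= exprn_ilt1 ?(ltW x0) // -lt0n.
Qed.

Lemma geo_prod0 (s : seq (R * nat)) : geo_prod s 0 = 1.
Proof.
elim: s => //= -[y b] s IH.
by rewrite /geo_mul div0n big_nat1 muln0 subn0 IH mulr1.
Qed.

Lemma partial_ge0 N n : 0 <= P N n.
Proof. by apply: geo_prod_ge0; apply: sub_all (factors_pos N) => t /and3P[]. Qed.

Lemma partial_rec N n : n%:R * P N n = conv (geo_prod_log (factors x N)) (P N) n.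
Proof. by apply: geo_prod_rec; apply: sub_all (factors_pos N) => t /and3P[]. Qed.

Lemma geo_prod_log_ge0 N k : 0 <= geo_prod_log (factors x N) k.
Proof.
rewrite /geo_prod_log big_seq; apply: sumr_ge0 => t /(allP (factors_pos N))/and3P[t0 _ _].
by rewrite /geo_log; case: ifP => // _; rewrite mulr_ge0 ?ler0n ?exprn_ge0.
Qed.

Lemma partial_le N n : P N n <= g n.
Proof.
have [k] := ubnP n; elim: k n => // k IH [_|n]; first by rewrite /P geo_prod0 /= u0.
rewrite ltnS => nk; rewrite -(ler_pM2l (ltr0Sn R n)) increment_rec partial_rec /conv.
rewrite big_nat [leRHS]big_nat; apply: ler_sum => -[|j] jn.
  by rewrite geo_prod_log0 limit_log0 !mul0r.
rewrite ler_pM ?geo_prod_log_ge0 ?partial_ge0 ?geo_prod_log_factors_le //.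
by apply: IH; lia.
Qed.

Lemma partial_cvg n : (fun N => P N n) @ \oo --> g n.
Proof.
have [k] := ubnP n; elim: k n => // k IH [_|n].
  by under eq_fun do rewrite /P geo_prod0; rewrite /= u0; apply: cvg_cst.
rewrite ltnS => nk; have n0 : n.+1%:R != 0 :> R by rewrite pnatr_eq0.
have -> : g n.+1 = n.+1%:R^-1 * conv (limit_log x) g n.+1 by rewrite -increment_rec mulKf.
have -> : (fun N => P N n.+1) =
    (fun N => n.+1%:R^-1 * conv (geo_prod_log (factors x N)) (P N) n.+1).
  by apply/funext => N; rewrite -partial_rec mulKf.
apply: cvgMr; rewrite /conv; under eq_fun do rewrite big_nat.
rewrite big_nat; apply: cvg_sum => -[|j] jn.
  by under eq_fun do rewrite geo_prod_log0 mul0r; rewrite limit_log0 mul0r; apply: cvg_cst.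
by apply: cvgM; [apply: geo_prod_log_factors_cvg | apply: IH; lia].
Qed.

Lemma psum_partial_cvg rho M : (fun N => psum (P N) rho M) @ \oo --> psum g rho M.
Proof. by apply: cvg_sum => n _; apply: cvgMl; apply: partial_cvg. Qed.

Lemma psum_increment_le rho M : 1 <= rho -> x * rho ^+ 2 < 1 ->
  psum g rho M <= product_bound x rho.
Proof.
move=> rho1 xrho; apply: (ler_cvg_to (@psum_partial_cvg rho M) (cvg_cst (product_bound x rho))).
apply: nearW => N /=; apply: le_trans (prod_factors_le x0 x1 rho1 xrho N).
apply: psum_geo_prod_le; first exact: (le_trans ler01 rho1).
apply: sub_all (factors_bounds x0 rho1 xrho N) => t /and3P[-> -> h] /=.
exact: (le_lt_trans h xrho).
Qed.

(** The finite products whose limit is l(q), when x is the inverse of q. *)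
Definition partial_product N : R := \prod_(1 <= k < N.+1) (1 - x ^+ k) ^- ((k * k.+1)./2 + 1).

Lemma partial_productE N : partial_product N = \prod_(t <- factors x N) (1 - t.1)^-1.
Proof.
rewrite prod_factors /partial_product; apply: eq_big_nat => a /andP[a0 aN].
rewrite /= prodrXr sum_mult // -exprVn; congr (_ ^+ _).
by rewrite bin2 /= mulnC addn1.
Qed.

Lemma x_rho1 : x * 1 ^+ 2 < 1. Proof. by rewrite expr1n mulr1. Qed.

Lemma partial_product_cvg : partial_product @ \oo --> limn partial_product.
Proof.
apply: nondecreasing_is_cvgn.
  apply/nondecreasing_seqP => N; rewrite /partial_product [leRHS]big_nat_recr //=.
  rewrite ler_peMr //.
    rewrite big_nat prodr_ge0 // => k _; rewrite invr_ge0 exprn_ge0 // subr_ge0.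
    by rewrite exprn_ile1 ?ltW.
  rewrite -exprVn exprn_ege1 // invf_ge1 ?gerBl ?exprn_ge0 ?(ltW x0) //.
  by rewrite subr_gt0 exprn_ilt1 ?(ltW x0).
exists (product_bound x 1) => _ [N _ <-]; rewrite partial_productE.
have := prod_factors_le x0 x1 (lexx 1) x_rho1 N.
by under eq_bigr do rewrite expr1n mulr1.
Qed.

Lemma partial_product_le N : partial_product N <= limn partial_product.
Proof.
apply: nondecreasing_cvgn_le; last by apply/cvg_ex; exists (limn partial_product); exact: partial_product_cvg.
apply/nondecreasing_seqP => {}N; rewrite /partial_product [leRHS]big_nat_recr //=.
rewrite ler_peMr //.
  rewrite big_nat prodr_ge0 // => k _; rewrite invr_ge0 exprn_ge0 // subr_ge0.
  by rewrite exprn_ile1 ?ltW.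
rewrite -exprVn exprn_ege1 // invf_ge1 ?gerBl ?exprn_ge0 ?(ltW x0) //.
by rewrite subr_gt0 exprn_ilt1 ?(ltW x0).
Qed.

Lemma psum_increment1 M : psum g 1 M.+1 = u M.
Proof. by rewrite -sum_increment /psum; apply: eq_bigr => n _; rewrite expr1n mulr1. Qed.

Lemma sequence_le_limit n : u n <= limn partial_product.
Proof.
rewrite -psum_increment1.
apply: (ler_cvg_to (@psum_partial_cvg 1 n.+1) (cvg_cst (limn partial_product))).
apply: nearW => N /=; apply: le_trans (partial_product_le N).
rewrite partial_productE.
have -> : \prod_(t <- factors x N) (1 - t.1)^-1 = \prod_(t <- factors x N) (1 - t.1 * 1 ^+ t.2)^-1.
  by apply: eq_bigr => t _; rewrite expr1n mulr1.
apply: psum_geo_prod_le => //; apply: sub_all (factors_pos N) => t.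
by rewrite expr1n mulr1.
Qed.

Lemma sequence_increasing : increasing_seq u.
Proof. by apply/increasing_seqP => n; rewrite -subr_gt0; exact: (increment_gt0 n.+1). Qed.

(** The limit is at most the product by [sequence_le_limit]; it is at least each partial
    product, whose coefficients are at most the increments of u. *)
Lemma sequence_cvg : u @ \oo --> limn partial_product.
Proof.
have [l cl] : exists l : R, u @ \oo --> l.
  apply: (@nondecr_bounded_cvg _ _ (limn partial_product)); last exact: sequence_le_limit.
  by move=> m n mn; rewrite (sequence_increasing m n).
suff <- : l = limn partial_product by [].
apply/eqP; rewrite eq_le; apply/andP; split.
  apply: (ler_cvg_to cl (cvg_cst _)); apply: nearW; exact: sequence_le_limit.
apply: (ler_cvg_to partial_product_cvg (cvg_cst _)); apply: nearW => N /=.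
have c1 : (fun M => psum (P N) 1 M.+1) @ \oo --> partial_product N.
  by rewrite cvg_shiftS partial_productE; apply: psum_geo_prod_cvg; apply: factors_pos.
apply: (ler_cvg_to c1 cl); apply: nearW => M /=; rewrite -psum_increment1.
by apply: ler_sum => n _; rewrite expr1n !mulr1 partial_le.
Qed.

(** The increments beyond n, weighted by rho ^ n, are bounded by the whole series at
    rho. *)
Lemma sequence_error rho n : 1 <= rho -> x * rho ^+ 2 < 1 ->
  `|u n - limn partial_product| <= product_bound x rho * rho ^- n.
Proof.
move=> rho1 xrho; have rho0 : 0 < rho := lt_le_trans ltr01 rho1.
rewrite ler0_norm ?subr_le0 ?sequence_le_limit // opprB.
have c : (fun M => u (M + n)%N - u n) @ \oo --> limn partial_product - u n.
  by apply: cvgB; [rewrite (cvg_shiftn n u); exact: sequence_cvg | exact: cvg_cst].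
apply: (ler_cvg_to c (cvg_cst _)); apply: nearW => M /=.
rewrite -!sum_increment (@big_cat_nat _ _ _ n.+1) //=; last by rewrite ltnS leq_addl.
rewrite addrAC subrr add0r ler_pdivlMr ?exprn_gt0 // mulr_suml.
apply: le_trans (psum_increment_le (M + n).+1 rho1 xrho).
rewrite /psum [leRHS](@big_cat_nat _ _ _ n.+1) //=; last by rewrite ltnS leq_addl.
rewrite -[leLHS]add0r lerD //.
  by apply: sumr_ge0 => j _; rewrite mulr_ge0 ?exprn_ge0 ?(ltW rho0) // ltW // increment_gt0.
rewrite big_nat [leRHS]big_nat; apply: ler_sum => j /andP[nj _].
by rewrite ler_wpM2l ?(ltW (increment_gt0 _)) // ler_weXn2l // ltnW.
Qed.

End Asymptotics.

(** * Abelian subgroups of the general linear group *)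

(** Geometric bounds at all rates below the square root of q: for a given r < q, take
    rho the square root of a number strictly between max(r, 1) and q. *)
Lemma little_o_of_geometric (R : realType) (q : R) (v : nat -> R) : 1 < q ->
  (forall rho, 1 <= rho -> q^-1 * rho ^+ 2 < 1 ->
     exists C : R, forall n, `|v n| <= C * rho ^- n) ->
  forall r : R, 0 < r < q ->
    (fun n : nat => `|v n|) =o_\oo (fun n : nat => r `^ (- (n%:R / 2))).
Proof.
move=> q1 bound r /andP[r0 rq]; have q0 : 0 < q := lt_trans ltr01 q1.
pose s := (Num.max r 1 + q) / 2; pose rho := Num.sqrt s; pose sigma := Num.sqrt r.
have rs : r < s.
  by have := le_max r r 1; rewrite lexx /= /s => h; lra.
have s1 : 1 < s.
  by have := le_max 1 r 1; rewrite lexx orbT /s => h; lra.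
have sq : s < q.
  by have : Num.max r 1 < q; [rewrite gt_max rq | rewrite /s => h; lra].
have s0 : 0 < s := lt_trans ltr01 s1.
have rho2 : rho ^+ 2 = s by rewrite sqr_sqrtr // ltW.
have rho0 : 0 < rho by rewrite sqrtr_gt0.
have sigma0 : 0 < sigma by rewrite sqrtr_gt0.
have rho1 : 1 <= rho by rewrite -sqrtr1 ler_sqrt // ltW.
have [|C Cv] := bound rho rho1; first by rewrite rho2 mulrC ltr_pdivrMr // mul1r.
have powE n : r `^ (- (n%:R / 2)) = sigma ^- n.
  rewrite powRN mulrC powRrM powR12_sqrt ?(ltW r0) // powR_mulrn //.
  exact: sqrtr_ge0.
have cvg0 : (fun n => C * (sigma / rho) ^+ n) @ \oo --> (0 : R).
  rewrite -[X in _ --> X](mulr0 C); apply: cvgMr; apply: cvg_expr.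
  rewrite ger0_norm ?divr_ge0 ?ltW // ltr_pdivrMr // mul1r.
  by rewrite ltr_sqrt.
apply/eqoP => e e0; near=> n.
rewrite powE normr_id [`|sigma ^- n|]ger0_norm ?invr_ge0 ?exprn_ge0 ?(ltW sigma0) //.
have small : C * (sigma / rho) ^+ n < e.
  by near: n; exact: cvgr_lt cvg0 e e0.
apply: le_trans (Cv n) _; rewrite ler_pdivlMr ?exprn_gt0 // mulrAC -mulrA.
by rewrite -expr_div_n ltW.
Unshelve. all: by end_near. Qed.

Section Sequence.

Variables (R : realType) (F : finFieldType).
Local Notation q := (#|F|%:R : R).

(** The sequence u_n. When q > 2 it is the sequence of the theorem. *)
Definition scaled_ratio n : R := q ^+ n * ratio R F n.

Lemma inv_q_gt0 : 0 < q^-1.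
Proof. by rewrite invr_gt0 (lt_trans ltr01) ?q_gt1. Qed.

Lemma inv_q_lt1 : q^-1 < 1.
Proof. by rewrite invf_lt1 ?q_gt1 // (lt_trans ltr01) ?q_gt1. Qed.

Lemma scaled_ratio0 : scaled_ratio 0 = 1.
Proof. by rewrite /scaled_ratio expr0 mul1r ratio0. Qed.

Lemma scaled_ratio_rec n : n%:R * scaled_ratio n = conv (weighted_local R F) scaled_ratio n.
Proof. by rewrite /conv big_mkord; exact: ratio_rec. Qed.

Lemma weighted_local0 : weighted_local R F 0 = 0.
Proof. by rewrite /weighted_local !mul0r. Qed.

Lemma weighted_local_limit k : weighted_local R F k.+1 = 1 + limit_log q^-1 k.+1.
Proof.
rewrite weighted_localE /limit_log -(big_mkord (fun b => (b %| k.+1)%N)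
  (fun b => local_weight b (q^-1 ^+ (k.+1 %/ b)))).
rewrite big_ltn_cond // dvd0n /= big_ltn_cond // [in RHS]big_ltn_cond // dvd1n divn1.
rewrite addrA; congr (_ + _).
  rewrite /local_weight /limit_weight eqxx; have : 1 - q^-1 ^+ k.+1 != 0.
    by rewrite subr_eq0 gt_eqF // exprn_ilt1 ?(ltW inv_q_gt0) ?inv_q_lt1.
  by move: (_ ^+ _) => y y1; field.
rewrite big_nat_cond [RHS]big_nat_cond; apply: eq_bigr => b /andP[/andP[b1 _] _].
by rewrite /local_weight /limit_weight gtn_eqF.
Qed.

Lemma l_constE : l_const R #|F| = limn (partial_product q^-1).
Proof.
rewrite /l_const; congr (lim (_ @ \oo)); apply/funext => N.
by rewrite /partial_product; apply: eq_bigr => k _; rewrite exprVn.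
Qed.

Lemma scaled_ratio_increasing : increasing_seq scaled_ratio.
Proof.
exact: (sequence_increasing inv_q_gt0 inv_q_lt1 scaled_ratio0 scaled_ratio_rec
          weighted_local0 weighted_local_limit).
Qed.

Lemma scaled_ratio_cvg : scaled_ratio @ \oo --> l_const R #|F|.
Proof.
rewrite l_constE; exact: (sequence_cvg inv_q_gt0 inv_q_lt1 scaled_ratio0 scaled_ratio_rec
          weighted_local0 weighted_local_limit).
Qed.

Lemma scaled_ratio_error (r : R) : 0 < r < q ->
  (fun n : nat => `|scaled_ratio n - l_const R #|F| |) =o_\oo
  (fun n : nat => r `^ (- (n%:R / 2))).
Proof.
apply: little_o_of_geometric; first exact: q_gt1.
move=> rho rho1 xrho; exists (product_bound q^-1 rho) => n; rewrite l_constE.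
exact: (sequence_error inv_q_gt0 inv_q_lt1 scaled_ratio0 scaled_ratio_rec
          weighted_local0 weighted_local_limit).
Qed.

End Sequence.

Lemma abelian_ratio_le (R : realType) (F : finFieldType) n :
  abelian_ratio F n R <= ratio R F n.
Proof.
case: n => [|m] /=; first by rewrite ratio0.
rewrite /ratio -card_unitmx_GL ler_pM2r ?invr_gt0 ?ltr0n ?card_unitmx_gt0 //.
by rewrite ler_nat card_abelian_family_le.
Qed.

Lemma abelian_ratioE (R : realType) (F : finFieldType) n : (2 < #|F|)%N ->
  abelian_ratio F n R = ratio R F n.
Proof.
move=> q2; case: n => [|m] /=; first by rewrite ratio0.
by rewrite /ratio -card_unitmx_GL card_abelian_family.
Qed.

Unset Implicit Arguments.

Theorem theorem1p7 (R : realType) (q : nat) (F : finFieldType)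
    (hq : #|F| = q) :
  ((2 < q)%N ->
     [/\ increasing_seq
           (fun n : nat => (q%:R : R) ^+ n * abelian_ratio F n R),
         (fun n : nat => (q%:R : R) ^+ n * abelian_ratio F n R) @ \oo
           --> l_const R q
       & forall r : R, 0 < r < q%:R ->
           (fun n : nat =>
              `|(q%:R : R) ^+ n * abelian_ratio F n R - l_const R q|)
           =o_\oo (fun n : nat => r `^ (- (n%:R / 2)))])
  /\
  (q = 2%N ->
     exists b : nat -> R,
       [/\ increasing_seq (fun n : nat => 2 ^+ n * b n),
           (fun n : nat => 2 ^+ n * b n) @ \oo --> l_const R 2,
           forall n : nat, abelian_ratio F n R <= b n
         & forall r : R, 0 < r < 2 ->
             (fun n : nat => `|2 ^+ n * b n - l_const R 2|)
             =o_\oo (fun n : nat => r `^ (- (n%:R / 2)))]).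
Proof.
split=> [q2|q2].
  rewrite -hq in q2 *.
  have -> : (fun n : nat => (#|F|%:R : R) ^+ n * abelian_ratio F n R) = scaled_ratio R F.
    by apply/funext => n; rewrite abelian_ratioE.
  split; [exact: scaled_ratio_increasing | exact: scaled_ratio_cvg |].
  move=> r r0.
  have -> : (fun n : nat => `|(#|F|%:R : R) ^+ n * abelian_ratio F n R - l_const R #|F| |) =
    (fun n : nat => `|scaled_ratio R F n - l_const R #|F| |).
    by apply/funext => n; rewrite abelian_ratioE.
  exact: scaled_ratio_error.
exists (ratio R F).
have E : (fun n : nat => 2 ^+ n * ratio R F n) = scaled_ratio R F.
  by rewrite /scaled_ratio hq q2.
have lE : l_const R 2 = l_const R #|F| by rewrite hq q2.
split.
- rewrite E; exact: scaled_ratio_increasing.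
- rewrite E lE; exact: scaled_ratio_cvg.
- exact: abelian_ratio_le.
move=> r r0.
have -> : (fun n : nat => `|2 ^+ n * ratio R F n - l_const R 2|) =
    (fun n : nat => `|scaled_ratio R F n - l_const R #|F| |).
  by rewrite /scaled_ratio hq q2.
by apply: scaled_ratio_error; rewrite hq q2.
Qed.
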